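(* Let $S\subset\mathbb{R}^d$ be a Borel set with $S=-S$ and $B(0,1)\subseteq S\subseteq B(0,\theta)$ for some $\theta\ge1$. Let $\mu$ be a non-trivial, locally finite measure on $\mathbb{R}^d$ given by a bounded Lebesgue density $m$. For each $t\in\mathbb{N}$ let $\eta_t$ be a Poisson point process on $\mathbb{R}^d$ with intensity measure $t\mu$, and let $(\rho_t)_{t\in\mathbb{N}}$ be a sequence of positive real numbers with $\lim_{t\to\infty}\rho_t=0$. Let $k\in\mathbb{N}$ and $A\in\mathcal{N}^k$, where $A$ is translation invariant, and consider the associated sequence of random variables $(F_t^A)_{t\in\mathbb{N}}$. Then the following statements hold. (i) (Sparse and thermodynamic regime.) Assume that $m$ is almost everywhere continuous and that there are $\alpha,\gamma>0$ with $\gamma k>d$ such that $m(x)\le\alpha(\lVert x\rVert+1)^{-\gamma}$ for all $x\in\mathbb{R}^d$. Assume in addition that $t\rho_t^d$ converges to a constant in $[0,\infty)$ as $t\to\infty$ and that $$\lim_{t\to\infty}\frac{t^k\rho_t^{d(k-1)}}{\log(t)}=\infty.$$ Then, if $\lim_{t\to\infty}t\rho_t^d=0$, one has $$\frac{F_t^A}{t^k\rho_t^{d(k-1)}}\longrightarrow\mathfrak{s}_S^A(m)\quad\text{almost surely as }t\to\infty.$$ Moreover, if $c:=\lim_{t\to\infty}t\rho_t^d\in(0,\infty)$, one has $$\frac{F_t^A}{t}\longrightarrow\mathfrak{t}_S^A(m)\quad\text{almost surely as }t\to\infty.$$ (ii) (Dense regime.) Let $m$ be given by $m(x)=\alpha(\lVert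 x\rVert+1)^{-\gamma}$ for some $\alpha,\gamma>0$ with $\gamma k>d$. Assume that $t\rho_t^d\to\infty$ as $t\to\infty$ and that moreover $$\lim_{t\to\infty}\frac{t(t\rho_t^d)^{d/\gamma-2}}{\log(t)}=\infty.$$ Then $$\frac{F_t^A}{t(t\rho_t^d)^{d/\gamma-1}}\longrightarrow\mathfrak{d}_S^A(m)\quad\text{almost surely as }t\to\infty.$$
   Context: $\lVert\cdot\rVert$ is the Euclidean norm, $B(x,r)$ the closed Euclidean ball, $\lambda$ the Lebesgue measure on $\mathbb{R}^d$. $\mathbf{N}$ is the space of locally finite subsets of $\mathbb{R}^d$ (identified with locally finite simple counting measures), with $\sigma$-algebra $\mathcal{N}$ generated by $\xi\mapsto\xi(B)$, $B$ Borel. A Poisson point process with intensity measure $\nu$ is a random element of $\mathbf{N}$ whose number of points in a Borel set $B$ is Poisson distributed with parameter $\nu(B)$ (almost surely $\infty$ if $\nu(B)=\infty$), with independent counts on disjoint Borel sets. Non-trivial means $\mu\ne0$. The processes $\eta_t$, $t\in\mathbb{N}$, are defined on a common probability space; no assumption is made on their joint distribution. For a Borel set $T=-T\subset\mathbb{R}^d$ and $\xi\in\mathbf{N}$, $G_T(\xi)$ is the graph with vertex set $\xi$ and an edge between distinct $x,y\in\xi$ whenever $x-y\in T$. A (connected) component of a graph is a non-empty connected induced subgraph with no edges to the remaining vertices. $\mathcal{N}^k=\{B\in\mathcal{N}:|\mathbf{x}|=k\text{ for all }\mathbf{x}\in B\}$. $A$ is translation invariant if $\mathbf{x}+x\in A$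 for all $\mathbf{x}\in A$, $x\in\mathbb{R}^d$. Write $\rho_tS=\{\rho_ts:s\in S\}$ and $\rho_tA=\{\rho_t\mathbf{x}:\mathbf{x}\in A\}$. $F_t^A$ is the number of $k$-element subsets $\mathbf{x}\subseteq\eta_t$ with $\mathbf{x}\in\rho_tA$ such that $G_{\rho_tS}(\mathbf{x})$ is a connected component of $G_{\rho_tS}(\eta_t)$. The limit constants are as follows. With $I(y_1,\dots,y_{k-1})=\mathbf{1}\{\{0,y_1,\dots,y_{k-1}\}\in A,\ G_S(\{0,y_1,\dots,y_{k-1}\})\text{ is connected}\}$, $$\mathfrak{s}_S^A(m)=\frac1{k!}\int_{\mathbb{R}^d}m(x)^k\,dx\int_{(\mathbb{R}^d)^{k-1}}I(x_1,\dots,x_{k-1})\,d(x_1,\dots,x_{k-1})$$ (for $k=1$ the second integral is read as $\mathbf{1}\{\{0\}\in A\}$), $$\mathfrak{t}_S^A(m)=\frac{c^{k-1}}{k!}\int_{(\mathbb{R}^d)^k}I(x_2,\dots,x_k)\,m(x_1)^k\,e^{-c\,\lambda(S\cup(S+x_2)\cup\dots\cup(S+x_k))\,m(x_1)}\,d(x_1,\dots,x_k),$$ where $c=\lim_{t\to\infty}t\rho_t^d$, and, for $m(x)=\alpha(\lVert x\rVert+1)^{-\gamma}$, $$\mathfrak{d}_S^A(m)=\frac{\alpha^k}{k!}\int_{(\mathbb{R}^d)^k}I(x_2,\dots,x_k)\,\lVert x_1\rVert^{-\gamma k}\,e^{-\alpha\lVert x_1\rVert^{-\gamma}\lambda\left(S\cup\bigcup_{i=2}^k(S+x_i)\right)}\,d(x_1,\dots,x_k).$$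 *)

(* Defs.v *)
From HB Require Import structures.
From Stdlib Require Import Relation_Operators.
From mathcomp Require Import all_boot all_order all_algebra.
From mathcomp Require Import all_classical all_reals all_analysis.
From mathcomp Require Import measurable_realfun.

Set Implicit Arguments.
Unset Strict Implicit.
Unset Printing Implicit Defensive.
Import Order.TTheory GRing.Theory Num.Theory.
Import numFieldNormedType.Exports.
Local Open Scope classical_set_scope.
Local Open Scope ring_scope.

(* Borel sigma-algebra of the (product = norm) topology. *)
Section borel_matrix.
Context (R : realType) (m n : nat).
HB.instance Definition _ := @isMeasurable.Build
  (sigma_display (@open 'M[R]_(m, n))) 'M[R]_(m, n) <<s (@open 'M[R]_(m, n)) >>
  (@sigma_algebra0 _ setT _) (@sigma_algebraC _ _) (@sigma_algebra_bigcup _ setT _).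
End borel_matrix.

Section tuple_measure_step.
Context d (T : measurableType d) (R : realType).
Variable mu : {sigma_finite_measure set T -> \bar R}.

Definition tcons n (p : T * n.-tuple T) : n.+1.-tuple T :=
  [tuple of p.1 :: p.2].

Lemma measurable_tcons n : measurable_fun setT (@tcons n).
Proof. exact: measurable_cons. Qed.

HB.instance Definition _ n :=
  isMeasurableFun.Build _ _ _ _ (@tcons n) (@measurable_tcons n).

Variables (n : nat) (nu : {sigma_finite_measure set (n.-tuple T) -> \bar R}).

Definition tuple_step : set (n.+1.-tuple T) -> \bar R :=
  pushforward (mu \x nu)%E (@tcons n).

Let tuple_step0 : tuple_step set0 = 0%E.
Proof. exact: measure0. Qed.

Let tuple_step_ge0 X : (0 <= tuple_step X)%E.
Proof. exact: measure_ge0. Qed.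

Let tuple_step_sigma_additive : semi_sigma_additive tuple_step.
Proof. exact: measure_semi_sigma_additive. Qed.

HB.instance Definition _ := isMeasure.Build _ _ _ tuple_step
  tuple_step0 tuple_step_ge0 tuple_step_sigma_additive.

(* The library's instance for `\x` only covers products of subprobabilities. *)
Let product_sigma_finite : sigma_finite setT (mu \x nu)%E.
Proof.
have /sigma_finiteP[F [TF ndF Foo]] := sigma_finiteT mu.
have /sigma_finiteP[G [TG ndG Goo]] := sigma_finiteT nu.
exists (fun i => F i `*` G i).
  rewrite -setXTT TF TG predeqE => -[x y]; split.
    move=> [/= [i _ Fix] [j _ Gjy]]; exists (maxn i j) => //; split.
    - by move: x Fix; exact/subsetPset/ndF/leq_maxl.
    - by move: y Gjy; exact/subsetPset/ndG/leq_maxr.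
  by move=> [i _ []/= ? ?]; split; exists i.
move=> i; have [? ?] := Foo i; have [? ?] := Goo i.
split; first exact: measurableX.
by rewrite product_measure1E// lte_mul_pinfty// ge0_fin_numE.
Qed.

Let tuple_step_sigma_finite : sigma_finite setT tuple_step.
Proof.
have [F TF Foo] := product_sigma_finite.
pose u (t : n.+1.-tuple T) : T * n.-tuple T := (thead t, [tuple of behead t]).
have uK p : u (tcons p) = p.
  case: p => x v; rewrite /u /tcons theadE; congr pair.
  exact: val_inj.
have mu_ : measurable_fun setT u.
  apply: measurable_fun_pair; first exact: measurable_tnth.
  exact: measurable_behead.
exists (fun i => u @^-1` F i).
  by rewrite -preimage_bigcup -TF preimage_setT.
move=> i; have [mF Fi] := Foo i; split.
  by rewrite -[X in measurable X]setTI; exact: mu_.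
rewrite /tuple_step /pushforward -comp_preimage.
by rewrite (_ : u \o _ = id) //; apply/funext => p /=; exact: uK.
Qed.

HB.instance Definition _ := Measure_isSigmaFinite.Build _ _ _ tuple_step
  tuple_step_sigma_finite.
End tuple_measure_step.

(* [n]-fold product measure. For [n = 0] it is the unit mass at the empty tuple,
   so an integral over it is the value of the integrand there. *)
Fixpoint tuple_measure d (T : measurableType d) (R : realType)
    (mu : {sigma_finite_measure set T -> \bar R}) n :
    {sigma_finite_measure set (n.-tuple T) -> \bar R} :=
  match n with
  | 0 => \d_[tuple]
  | n'.+1 => tuple_step mu (tuple_measure mu n')
  end.

Section lebesgue_rV.
Context (R : realType) (d : nat).

Definition row_of_tuple (t : d.-tuple (measurableTypeR R)) : 'rV[R]_d :=
  \row_i tnth t i.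

Definition tuple_of_row (v : 'rV[R]_d) : d.-tuple (measurableTypeR R) :=
  [tuple v 0 i | i < d].

Lemma tuple_of_rowK : cancel tuple_of_row row_of_tuple.
Proof. by move=> v; apply/rowP => i; rewrite mxE tnth_mktuple. Qed.

Lemma row_of_tupleK : cancel row_of_tuple tuple_of_row.
Proof. by move=> t; apply: eq_from_tnth => i; rewrite tnth_mktuple mxE. Qed.

Let rbox (p : 'rV[rat]_d * 'rV[rat]_d) : set 'rV[R]_d :=
  [set v | forall i, ratr (p.1 0 i) < v 0 i < ratr (p.2 0 i)].

Let open_rbox (U : set 'rV[R]_d) : open U ->
  U = \bigcup_(p in [set p | rbox p `<=` U]) rbox p.
Proof.
move=> oU; apply/seteqP; split=> [v Uv|v [p pU pv]]; last exact: pU.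
have /nbhs_ballP[e /= e0 eU] : nbhs v U by exact: open_nbhs_nbhs.
have /choice[a aP] i : exists q : rat, v 0 i - e < ratr q < v 0 i.
  have [] := @rat_in_itvoo R (v 0 i - e) (v 0 i); first by rewrite ltrBlDr ltrDl.
  by move=> q; rewrite in_itv/= => ?; exists q.
have /choice[b bP] i : exists q : rat, v 0 i < ratr q < v 0 i + e.
  have [] := @rat_in_itvoo R (v 0 i) (v 0 i + e); first by rewrite ltrDl.
  by move=> q; rewrite in_itv/= => ?; exists q.
exists (\row_i a i, \row_i b i) => /=.
  move=> w wab; apply: eU; split => // i j; rewrite ord1.
  have := wab j; rewrite /= !mxE => /andP[aw wb].
  have /andP[va _] := aP j; have /andP[_ bv] := bP j.
  rewrite /ball/= ltr_distlC; apply/andP; split.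
    exact: lt_trans va aw.
  exact: lt_trans wb bv.
move=> i /=; rewrite !mxE.
by have /andP[_ ->] := aP i; have /andP[-> _] := bP i.
Qed.

Lemma measurable_row_of_tuple : measurable_fun setT row_of_tuple.
Proof.
have mE : @measurable _ 'rV[R]_d = <<s (@open 'rV[R]_d) >> by [].
apply: (measurability _ mE) => _ [U oU <-].
rewrite setTI (open_rbox oU) preimage_bigcup bigcup_mkcond.
apply: countable_bigcupT_measurable => // p.
case: ifPn => _ //.
rewrite [X in measurable X](_ : _ = \bigcap_(i in [set: 'I_d])
    ((fun t => tnth t i) @^-1` `]ratr (p.1 0 i), ratr (p.2 0 i)[%classic)).
  apply: fin_bigcap_measurable => // i _.
  rewrite -[X in measurable X]setTI; apply: measurable_tnth => //.
apply/seteqP; split=> [t h i _|t h i].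
  by have := h i; rewrite mxE /= in_itv.
by rewrite mxE; have := h i I; rewrite /= in_itv.
Qed.

Lemma measurable_tuple_of_row : measurable_fun setT tuple_of_row.
Proof.
apply/measurable_fun_tnthP => i.
rewrite (_ : _ \o _ = fun v : 'rV[R]_d => v 0 i); last first.
  by apply/funext => v /=; rewrite tnth_mktuple.
apply: (measurability _ (RGenOpens.measurableE R)) => _ [_ [a [b ->]] <-].
rewrite setTI; apply: sub_sigma_algebra.
have /continuousP := @coord_continuous R 1 d 0 i; apply.
exact: interval_open.
Qed.

HB.instance Definition _ :=
  isMeasurableFun.Build _ _ _ _ row_of_tuple measurable_row_of_tuple.

Definition lebesgue_rV : set 'rV[R]_d -> \bar R :=
  pushforward (tuple_measure (@lebesgue_measure R) d) row_of_tuple.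

Let lebesgue_rV0 : lebesgue_rV set0 = 0%E.
Proof. exact: measure0. Qed.

Let lebesgue_rV_ge0 X : (0 <= lebesgue_rV X)%E.
Proof. exact: measure_ge0. Qed.

Let lebesgue_rV_sigma_additive : semi_sigma_additive lebesgue_rV.
Proof. exact: measure_semi_sigma_additive. Qed.

HB.instance Definition _ := isMeasure.Build _ _ _ lebesgue_rV
  lebesgue_rV0 lebesgue_rV_ge0 lebesgue_rV_sigma_additive.

Let lebesgue_rV_sigma_finite : sigma_finite setT lebesgue_rV.
Proof.
have [F TF Foo] := sigma_finiteT (tuple_measure (@lebesgue_measure R) d).
exists (fun i => tuple_of_row @^-1` F i).
  by rewrite -preimage_bigcup -TF preimage_setT.
move=> i; have [mF Fi] := Foo i; split.
  by rewrite -[X in measurable X]setTI; exact: measurable_tuple_of_row.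
rewrite /lebesgue_rV /pushforward -comp_preimage.
by rewrite (_ : _ \o _ = id) //; apply/funext => t /=; exact: row_of_tupleK.
Qed.

HB.instance Definition _ := Measure_isSigmaFinite.Build _ _ _ lebesgue_rV
  lebesgue_rV_sigma_finite.
End lebesgue_rV.
Arguments lebesgue_rV {R d}.

Section euclidean.
Context (R : realType) (d : nat).
Implicit Types (x v : 'rV[R]_d) (X S : set 'rV[R]_d).

(* The library norm on ['rV[R]_d] is the sup norm. *)
Definition enorm x : R := Num.sqrt (\sum_(i < d) x 0 i ^+ 2).

Definition eball x (r : R) : set 'rV[R]_d := [set y | enorm (y - x) <= r].

Definition translate v X : set 'rV[R]_d := [set x + v | x in X].

Definition dilate (r : R) X : set 'rV[R]_d := [set r *: x | x in X].

Definition locally_finite X := forall B, bounded_set B -> finite_set (X `&` B).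

Lemma locally_finite_finite X : finite_set X -> locally_finite X.
Proof. by move=> fX B _; exact: finite_setIl. Qed.

Let bounded_setP (B : set 'rV[R]_d) :
  bounded_set B <-> exists M, forall x, B x -> `|x| <= M.
Proof.
split=> [[M [_ BM]]|[M BM]].
  by exists (M + 1) => x Bx; apply: (BM (M + 1)) => //; rewrite ltrDl.
exists M; split; first exact: num_real.
by move=> N MN x /BM /= /le_trans; apply; exact: ltW.
Qed.

Lemma locally_finite_translate v X :
  locally_finite X -> locally_finite (translate v X).
Proof.
move=> lX B /bounded_setP[M BM].
have bB : bounded_set [set y | B (y + v)].
  apply/bounded_setP; exists (M + `|v|) => y /BM yM.
  by rewrite -(addrK v y) (le_trans (ler_normB _ _))// lerD2r.
apply: sub_finite_set (finite_image (fun y => y + v) (lX _ bB)).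
by move=> _ [[y Xy <-] Byv]; exists y.
Qed.

Lemma locally_finite_dilate r X :
  locally_finite X -> locally_finite (dilate r X).
Proof.
move=> lX; have [->|r0] := eqVneq r 0.
  apply: locally_finite_finite; apply: sub_finite_set (finite_set1 0).
  by move=> _ [y _ <-] /=; rewrite scale0r.
move=> B /bounded_setP[M BM].
have bB : bounded_set [set y | B (r *: y)].
  apply/bounded_setP; exists (M / `|r|) => y /BM.
  by rewrite normrZ ler_pdivlMr ?normr_gt0// mulrC.
apply: sub_finite_set (finite_image (fun y => r *: y) (lX _ bB)).
by move=> _ [[y Xy <-] Bry]; exists y.
Qed.

End euclidean.

Section configurations.
Context (R : realType) (d : nat).

(* Locally finite simple counting measures, as their supports. *)
Record conf := Conf {
  points :> set 'rV[R]_d;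
  points_locally_finite : locally_finite points }.

Lemma conf_inj : injective points.
Proof.
move=> [X lX] [Y lY] /= XY; case: Y / XY lY => lY.
by congr Conf; exact: Prop_irrelevance.
Qed.

HB.instance Definition _ := gen_eqMixin conf.
HB.instance Definition _ := gen_choiceMixin conf.
HB.instance Definition _ := isPointed.Build conf
  (Conf (locally_finite_finite (finite_set0 _))).

Definition point_count (xi : conf) (B : set 'rV[R]_d) : \bar R :=
  counting (xi `&` B).

Definition count_events : set (set conf) :=
  [set E | exists B : set 'rV[R]_d, exists C : set (\bar R),
    [/\ measurable B, measurable C & E = [set xi | C (point_count xi B)]]].

HB.instance Definition _ := @isMeasurable.Build
  (sigma_display count_events) conf <<s count_events >>
  (@sigma_algebra0 _ setT _) (@sigma_algebraC _ _) (@sigma_algebra_bigcup _ setT _).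

Definition translate_conf v (xi : conf) : conf :=
  Conf (@locally_finite_translate _ _ v _ (points_locally_finite xi)).

Definition dilate_conf r (xi : conf) : conf :=
  Conf (@locally_finite_dilate _ _ r _ (points_locally_finite xi)).

Definition conf_of_seq (s : seq 'rV[R]_d) : conf :=
  Conf (locally_finite_finite (finite_seq s)).

Definition translation_invariant (A : set conf) :=
  forall xi v, A xi -> A (translate_conf v xi).

Definition independent_counts d' (Omega : measurableType d')
    (P : probability Omega R) (eta : Omega -> conf) :=
  forall (n : nat) (B : 'I_n -> set 'rV[R]_d),
    (forall i, measurable (B i)) -> trivIset setT B ->
  forall C : 'I_n -> set (\bar R), (forall i, measurable (C i)) ->
    P [set w | forall i, C i (point_count (eta w) (B i))] =
    (\prod_(i < n) P [set w | C i (point_count (eta w) (B i))])%E.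

Record poisson_process d' (Omega : measurableType d')
    (P : probability Omega R) (nu : set 'rV[R]_d -> \bar R)
    (eta : Omega -> conf) : Prop := PoissonProcess {
  poisson_measurable : measurable_fun setT eta;
  (* [poisson_prob] takes a spurious second argument. *)
  poisson_count : forall B, measurable B -> (nu B < +oo)%E -> forall n : nat,
    P [set w | point_count (eta w) B = n%:R%:E] =
    poisson_prob (fine (nu B)) n [set n];
  poisson_count_infty : forall B, measurable B -> nu B = +oo%E ->
    {ae P, forall w, point_count (eta w) B = +oo%E};
  poisson_independent : independent_counts P eta }.

End configurations.

Section graphs.
Context (V : Type).

Record graph := Graph { vertex : set V; edge : V -> V -> Prop }.

Definition graph_connected (g : graph) :=
  forall x y, vertex g x -> vertex g y -> clos_refl_trans V (edge g) x y.

Definition induced_subgraph (h g : graph) :=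
  vertex h `<=` vertex g /\
  forall x y, vertex h x -> vertex h y -> (edge h x y <-> edge g x y).

Definition connected_component (h g : graph) :=
  [/\ vertex h !=set0, graph_connected h, induced_subgraph h g &
      forall x y, vertex h x -> vertex g y -> ~ vertex h y -> ~ edge g x y].

End graphs.

Section component_counts.
Context (R : realType) (d : nat).
Implicit Types (S T : set 'rV[R]_d) (A : set (conf R d)).

Definition difference_graph T (X : set 'rV[R]_d) : graph 'rV[R]_d :=
  Graph X (fun x y => [/\ X x, X y, x <> y & T (x - y)]).

Definition component_count k S A (rho : R) (xi : conf R d) : \bar R :=
  counting [set x : conf R d | [/\ x `<=` xi, (x #= `I_k)%card,
    (dilate_conf rho @` A) x &
    connected_component (difference_graph (dilate rho S) x)
                        (difference_graph (dilate rho S) xi)]].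

Variables (S : set 'rV[R]_d) (k : nat) (A : set (conf R d)).

(* In the limits below, [(R^d)^k] is split as [R^d * (R^d)^(k-1)]: [p.1] is the
   first point and [p.2] lists the others. [pattern] is the indicator of
   {0, y_1, ..., y_(k-1)} being an admissible connected configuration. *)
Definition pattern (y : k.-1.-tuple 'rV[R]_d) : R :=
  \1_[set y : k.-1.-tuple 'rV[R]_d | A (conf_of_seq (0 :: y)) /\
    graph_connected (difference_graph S (conf_of_seq (0 :: y)))] y.

Definition neighbourhood (y : k.-1.-tuple 'rV[R]_d) : set 'rV[R]_d :=
  S `|` \bigcup_(i < k.-1) translate (nth 0 y i) S.

Local Notation leb := (@lebesgue_rV R d).

Definition sparse_limit (m : 'rV[R]_d -> R) : \bar R :=
  ((k`!%:R^-1)%:E *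
   ((\int[leb]_x (m x ^+ k)%:E) *
    (\int[tuple_measure leb k.-1]_y (pattern y)%:E)))%E.

Definition thermodynamic_limit (c : R) (m : 'rV[R]_d -> R) : \bar R :=
  ((c ^+ k.-1 / k`!%:R)%:E *
   \int[leb \x tuple_measure leb k.-1]_p
     ((pattern p.2 * m p.1 ^+ k)%:E *
      expeR (- (c%:E * leb (neighbourhood p.2) * (m p.1)%:E))))%E.

Definition dense_limit (alpha gamma : R) : \bar R :=
  ((alpha ^+ k / k`!%:R)%:E *
   \int[leb \x tuple_measure leb k.-1]_p
     ((pattern p.2 * enorm p.1 `^ (- (gamma * k%:R)))%:E *
      expeR (- ((alpha * enorm p.1 `^ (- gamma))%:E *
                leb (neighbourhood p.2)))))%E.

End component_counts.

(* Main.v *)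
(* The mean of F_t is computed from the Mecke formula: after the substitution
   x_i = x + rho_t y_i it is the integral of an explicit intensity, whose limit
   follows by dominated convergence. In the dense regime one first rescales
   x = s u with s = (t rho_t^d)^(1/gamma), which brings it to the same form.

   For the almost sure statement, R^d is cut into cells of side rho_t / d. All
   isolated connected k-tuples starting in one cell list the same component, so
   each cell contributes at most 1 to F_t, and its contribution depends only on
   the process in a bounded halo of cells. Colouring the cells periodically makes
   the contributions of one colour independent, and a Chernoff bound gives
   P(|F_t - E F_t| > delta N_t) <= C exp(- kappa N_t) for the normalisation N_t.
   Since N_t / log t tends to infinity, these probabilities are summable and the
   Borel-Cantelli lemma applies. *)
Require Import Defs.
From HB Require Import structures.
From Stdlib Require Import Relation_Operators.
From mathcomp Require Import finmap all_boot all_order all_algebra.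
From mathcomp Require Import all_classical all_reals all_analysis.
From mathcomp Require Import measurable_realfun ring lra zify.

Set Implicit Arguments.
Unset Strict Implicit.
Unset Printing Implicit Defensive.
Import Order.TTheory GRing.Theory Num.Theory.
Import numFieldNormedType.Exports.
Local Open Scope classical_set_scope.
Local Open Scope ring_scope.

(** * Borel structure of row vectors and of the configuration space *)

(** A Poisson process is given only through its counts, so the Mecke formula has to be derived, and
    void probabilities suffice for this: configurations are simple, hence the events that a bounded
    set is void form a pi-system generating the sigma-algebra. Mecke sums run over ordered tuples
    while components are sets, so components are counted through their [k!] orderings throughout.
    Concentration is needed at the scale of the mean although there are infinitely many cells:
    contributions lie in [[0, 1]], so their exponential moments are controlled by their means alone,
    which gives an exponent linear in [N_t]. The bounds concern one [t] at a time, so no joint law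
    of the [eta t] enters. All regimes share one limit theorem for the integral of [intensity M e c]
    and differ only in the density [M], the shift scale [e] and the factor [c]. In the dense regime
    the limiting density is singular at the origin and its decay no longer gives an integrable bound
    there; the void probability does, which is why there are two dominating bounds. *)

Section borel_rV.
Context (R : realType) (d : nat).
Local Notation T := 'rV[R]_d.

Lemma measurable_coord (j : 'I_d) : measurable_fun setT (fun x : T => x 0 j).
Proof.
rewrite (_ : (fun x : T => x 0 j) =
    (fun t : d.-tuple (measurableTypeR R) => tnth t j) \o @tuple_of_row R d).
  apply: measurableT_comp; first exact: measurable_tnth.
  exact: measurable_tuple_of_row.
by apply/funext => x /=; rewrite tnth_mktuple.
Qed.

Lemma measurable_fun_rVP d' (X : measurableType d') (f : X -> T) :
  measurable_fun setT f <-> forall j, measurable_fun setT (fun x => f x 0 j).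
Proof.
split=> [mf j|mf].
  exact: (measurableT_comp (measurable_coord j) mf).
rewrite (_ : f = @row_of_tuple R d \o
    (fun x => [tuple f x 0 j | j < d] : d.-tuple (measurableTypeR R))).
  apply: measurableT_comp; first exact: measurable_row_of_tuple.
  apply/measurable_fun_tnthP => j.
  rewrite (_ : _ \o _ = fun x => f x 0 j); first exact: mf.
  by apply/funext => x /=; rewrite tnth_mktuple.
by apply/funext => x /=; apply/rowP => j; rewrite mxE tnth_mktuple.
Qed.

Lemma measurable_fun_rVB d' (X : measurableType d') (f g : X -> T) :
  measurable_fun setT f -> measurable_fun setT g ->
  measurable_fun setT (fun x => f x - g x).
Proof.
move=> /measurable_fun_rVP mf /measurable_fun_rVP mg.
apply/measurable_fun_rVP => j.
under eq_fun do rewrite mxE mxE.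
exact: measurable_funB.
Qed.

Lemma measurable_fun_rVD d' (X : measurableType d') (f g : X -> T) :
  measurable_fun setT f -> measurable_fun setT g ->
  measurable_fun setT (fun x => f x + g x).
Proof.
move=> /measurable_fun_rVP mf /measurable_fun_rVP mg.
apply/measurable_fun_rVP => j.
under eq_fun do rewrite mxE.
exact: measurable_funD.
Qed.

Lemma measurable_fun_rVZ d' (X : measurableType d') (r : R) (f : X -> T) :
  measurable_fun setT f -> measurable_fun setT (fun x => r *: f x).
Proof.
move=> /measurable_fun_rVP mf.
apply/measurable_fun_rVP => j.
under eq_fun do rewrite mxE.
exact: measurable_funM.
Qed.

Lemma measurable_set1_rV (x : T) : measurable [set x].
Proof.
rewrite (_ : [set x] = \bigcap_(j in [set: 'I_d]) ((fun y : T => y 0 j) @^-1` [set x 0 j])).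
  apply: fin_bigcap_measurable => // j _.
  rewrite -[X in measurable X]setTI; exact: measurable_coord.
apply/seteqP; split=> [y -> //|y xy /=].
by apply/rowP => j; apply: (xy j).
Qed.

Lemma norm_rV_le (x : T) (M : R) : 0 <= M ->
  (forall j, `|x 0 j| <= M) -> `|x| <= M.
Proof.
move=> M0 xM; rewrite /Num.norm/= mx_normrE; apply: bigmax_le => // -[i j] _ /=.
by rewrite ord1.
Qed.

Lemma coord_le_norm (x : T) j : `|x 0 j| <= `|x|.
Proof.
rewrite [leRHS]/Num.norm/= mx_normrE.
exact: (le_bigmax _ (fun i : 'I_1 * 'I_d => `|x i.1 i.2|) (0, j)).
Qed.

Lemma bounded_rVP (B : set T) :
  bounded_set B <-> exists M, forall x, B x -> `|x| <= M.
Proof.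
split=> [[M [_ BM]]|[M BM]].
  by exists (M + 1) => x Bx; apply: (BM (M + 1)) => //; rewrite ltrDl.
exists M; split; first exact: num_real.
by move=> N MN x /BM /= /le_trans; apply; exact: ltW.
Qed.

Lemma bounded_rVS (A B : set T) : A `<=` B -> bounded_set B -> bounded_set A.
Proof.
move=> AB /bounded_rVP[M BM]; apply/bounded_rVP; exists M => x /AB; exact: BM.
Qed.

Lemma bounded_rVU (A B : set T) :
  bounded_set A -> bounded_set B -> bounded_set (A `|` B).
Proof.
move=> /bounded_rVP[M AM] /bounded_rVP[N BN]; apply/bounded_rVP.
exists (Num.max M N) => x [/AM xM|/BN xN]; rewrite le_max ?xM//.
by rewrite xN orbT.
Qed.

Definition gindex (h : R) (x : T) : 'rV[int]_d := \row_j Num.floor (x 0 j / h).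

(** Cells are numbered through [pickle], so that sums over cells are series over [nat]. A number
    that codes no integer vector gives an empty cell. *)
Definition gcell (h : R) (i : nat) : set T := [set x | pickle (gindex h x) = i].

Lemma trivIset_gcell h : trivIset setT (gcell h).
Proof. by move=> i j _ _ [x [<- <-]]. Qed.

Lemma bigcup_gcell h : \bigcup_i gcell h i = setT.
Proof. by apply/seteqP; split=> // x _; exists (pickle (gindex h x)). Qed.

Lemma measurable_gcell h i : 0 < h -> measurable (gcell h i).
Proof.
move=> h0; have [[z <-]|noz] := pselect (exists z : 'rV[int]_d, pickle z = i).
  rewrite (_ : gcell _ _ = \bigcap_(j in [set: 'I_d])
      ((fun y : T => y 0 j) @^-1` `[(z 0 j)%:~R * h, (z 0 j + 1)%:~R * h[)).
    apply: fin_bigcap_measurable => // j _.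
    by rewrite -[X in measurable X]setTI; exact: measurable_coord.
  apply/seteqP; split=> [y /(pcan_inj pickleK) yz j _ /=|y yz].
    rewrite -yz /gindex mxE in_itv /= -ler_pdivlMr// -ltr_pdivrMr//.
    by rewrite floor_le_tmp floorD1_gt.
  rewrite /gcell/=; congr pickle; apply/rowP => j; rewrite mxE.
  have := yz j I; rewrite /= in_itv /= -ler_pdivlMr// -ltr_pdivrMr//.
  by move=> /floor_def ->.
rewrite (_ : gcell _ _ = set0) //; apply/seteqP; split=> // x.
by move=> xi; case: noz; exists (gindex h x).
Qed.

Lemma gcell_close (h : R) i x y : 0 < h -> gcell h i x -> gcell h i y ->
  forall j, `|x 0 j - y 0 j| < h.
Proof.
move=> h0 <- /(pcan_inj pickleK)/esym xy j.
have xyj : Num.floor (x 0 j / h) = Num.floor (y 0 j / h).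
  by have := congr1 (fun z : 'rV_d => z 0 j) xy; rewrite !mxE.
have /andP[] := floor_itv (x 0 j / h).
have /andP[] := floor_itv (y 0 j / h).
rewrite xyj !ler_pdivlMr// !ltr_pdivrMr// intrD mulrDl mul1r => a b c e.
rewrite ltr_norml; apply/andP; split; lra.
Qed.

Lemma gcell_bounded h i : 0 < h -> bounded_set (gcell h i).
Proof.
move=> h0; apply/bounded_rVP.
have [[x xi]|noz] := pselect (gcell h i !=set0); last first.
  by exists 0 => y yi; case: noz; exists y.
exists (`|x| + h) => y yi; apply: norm_rV_le; first by rewrite addr_ge0// ltW.
move=> j; have := gcell_close h0 yi xi j => /ltW xy.
rewrite -[y 0 j](subrK (x 0 j)) (le_trans (ler_normD _ _))// addrC lerD//.
exact: coord_le_norm.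
Qed.

End borel_rV.

(** * Cardinality as a sum of ones *)

Section counting.
Context (T : choiceType) (R : realType).
Implicit Types X : set T.
Local Open Scope ereal_scope.

Lemma counting_esum X : counting X = \esum_(x in X) (1 : \bar R).
Proof.
have fsum (F : set T) : finite_set F ->
    \sum_(x \in F) (1 : \bar R) = (#|` fset_set F|)%:R%:E.
  by move=> fF; rewrite fsbig_finite//= card_fset_sum1 natr_sum -sumEFin.
rewrite /counting; case: ifPn => /asboolP fX.
  by rewrite -fsum// -[in RHS](set_mem_set X) esum_fset// set_mem_set.
apply/esym/eq_infty => r; apply: esum_ge.
have [B BX rB] := infinite_set_fset (Num.truncn `|r|).+1 fX.
exists [set` B]; first by split.
rewrite fsum// set_fsetK lee_fin (le_trans (ler_norm _))//.
rewrite ltW// (lt_le_trans (truncnS_gt _))// ler_nat.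
exact: rB.
Qed.

Lemma le_counting X Y : X `<=` Y -> counting X <= counting Y :> \bar R.
Proof.
move=> XY; rewrite !counting_esum [leRHS](esumID X)// (setIidr XY).
by rewrite leeDl// esum_ge0.
Qed.

Lemma counting_ge0 X : 0 <= counting X :> \bar R.
Proof. by rewrite counting_esum esum_ge0. Qed.

Lemma counting_set0 : counting (@set0 T) = 0 :> \bar R.
Proof. by rewrite counting_esum esum_set0. Qed.

Lemma counting_eq0 X : counting X = 0 :> \bar R -> X = set0.
Proof.
move=> X0; apply/seteqP; split=> // x Xx.
have : counting [set x] <= counting X :> \bar R by apply: le_counting => _ ->.
by rewrite X0 counting_esum esum_set1// leNgt lte01.
Qed.

Lemma counting_set1 (x : T) : counting [set x] = 1 :> \bar R.
Proof. by rewrite counting_esum esum_set1. Qed.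

Lemma counting_subset1 X : is_subset1 X -> counting X <= 1 :> \bar R.
Proof.
move=> X1; have [->|/set0P[x Xx]] := eqVneq X set0.
  by rewrite counting_set0.
rewrite (_ : X = [set x]) ?counting_set1//.
by apply/seteqP; split=> [y Xy|y ->] //; exact: X1.
Qed.

Lemma counting_eq1 X : counting X = 1 :> \bar R -> exists x, X = [set x].
Proof.
move=> X1; have [X0|/set0P[x Xx]] := eqVneq X set0.
  by move: X1; rewrite X0 counting_set0 => /esym/eqP; rewrite onee_eq0.
exists x; apply/seteqP; split=> [y Xy|_ ->//]; apply: contrapT => yx.
suff : 1 + 1 <= counting X :> \bar R.
  by rewrite X1 leNgt -EFinD lte_fin ltrDl ltr01.
rewrite counting_esum [leRHS](esumID [set x])//; apply: leeD.
  by rewrite -[leLHS](counting_set1 x) -counting_esum; apply: le_counting => _ ->.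
by rewrite -[leLHS](counting_set1 y) -counting_esum; apply: le_counting => _ ->.
Qed.

End counting.

(** * Void events generate the sigma-algebra of configurations *)

Section conf_measurable.
Context (R : realType) (d : nat).
Local Notation T := 'rV[R]_d.
Local Notation conf := (conf R d).
Implicit Types (xi : conf) (B C W : set T).
Local Open Scope ereal_scope.

Lemma conf_gcell xi h i : (0 < h)%R -> finite_set (points xi `&` gcell h i).
Proof. by move=> h0; apply: points_locally_finite; exact: gcell_bounded. Qed.

Lemma countable_conf xi : countable (points xi).
Proof.
rewrite -(setIT (points xi)) -(bigcup_gcell d (1 : R)%R) setI_bigcupr.
apply: bigcup_countable => // i _; apply: finite_set_countable.
exact: conf_gcell.
Qed.

Lemma measurable_conf xi : measurable (points xi).
Proof.
apply: countable_measurable; last exact: countable_conf.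
by move=> x; exact: measurable_set1_rV.
Qed.

Lemma measurable_point_count B : measurable B ->
  measurable_fun setT (fun xi => point_count xi B).
Proof.
move=> mB _ C mC; rewrite setTI; apply: sub_sigma_algebra.
by exists B, C; split.
Qed.

Definition void_event B : set conf := [set xi | points xi `&` B = set0].

(** Boundedness is built in because a locally finite intensity is finite on bounded sets, so the
    probabilities of these events are explicit exponentials. *)
Definition void_events : set (set conf) :=
  [set E | exists B, [/\ measurable B, bounded_set B & E = void_event B]].

Lemma void_eventE B : void_event B = [set xi | point_count xi B = 0].
Proof.
apply/seteqP; split=> [xi /= v|xi /=]; last exact: counting_eq0.
by rewrite /point_count v counting_set0.
Qed.

Lemma measurable_void_event B : measurable B -> measurable (void_event B).
Proof.
move=> mB; rewrite void_eventE -[X in measurable X]setTI.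
exact: (measurable_point_count mB measurableT (emeasurable_set1 _)).
Qed.

Lemma void_eventI B C : void_event B `&` void_event C = void_event (B `|` C).
Proof.
by apply/seteqP; split=> xi /=; rewrite /void_event/= setIUr setU_eq0.
Qed.

Lemma void_events_setI : setI_closed void_events.
Proof.
move=> _ _ [B [mB bB ->]] [C [mC bC ->]]; exists (B `|` C); split.
- exact: measurableU.
- exact: bounded_rVU.
- exact: void_eventI.
Qed.

(** The number of cells of side [1 / (n + 1)] in which [xi] meets [B]. It sees [xi] only through
    void events. The grids for different [n] are not nested, so counts are recovered as a supremum
    rather than as a monotone limit. *)
Let occupied n B xi : \bar R :=
  \sum_(i <oo) (\1_(~` void_event (B `&` gcell n.+1%:R^-1 i)) xi)%:E.

Let h0 n : (0 < n.+1%:R^-1 :> R)%R. Proof. by rewrite invr_gt0. Qed.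

Let point_count_gcell h B xi : (0 < h)%R -> measurable B ->
  point_count xi B = \sum_(i <oo) point_count xi (B `&` gcell h i).
Proof.
move=> hp mB; rewrite /point_count.
transitivity (counting (\bigcup_i (points xi `&` (B `&` gcell h i))) : \bar R).
  by congr counting; rewrite -setI_bigcupr -setI_bigcupr bigcup_gcell setIT.
rewrite counting_esum esum_bigcupT//; last first.
  by apply/trivIset_setIl/trivIset_setIl; exact: trivIset_gcell.
rewrite nneseries_esumT; last by move=> i; exact: counting_ge0.
by apply: eq_esum => i _; rewrite counting_esum.
Qed.

Let occupied_le n B xi : measurable B -> occupied n B xi <= point_count xi B.
Proof.
move=> mB; rewrite (point_count_gcell xi (h0 n) mB).
apply: lee_nneseries => i _; first by rewrite lee_fin.
rewrite indicE; case: (boolP (xi \in _)) => [/set_mem v|_]; last exact: counting_ge0.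
have [x Hx] : exists x, (points xi `&` (B `&` gcell n.+1%:R^-1 i)) x.
  by apply/set0P/negP => /eqP; exact: v.
by rewrite -[leLHS](counting_set1 R x); apply: le_counting => _ ->.
Qed.

(** Distinct points differ in some coordinate, and cannot share a cell once the side is at most that
    difference. The maximum of the thresholds over the finitely many pairs serves all of them. *)
Let separated (F : seq T) : exists n, forall x y, x \in F -> y \in F ->
  gindex n.+1%:R^-1 x = gindex n.+1%:R^-1 y -> x = y.
Proof.
have sep (x y : T) : exists n0, forall n, (n0 <= n)%N ->
    gindex n.+1%:R^-1 x = gindex n.+1%:R^-1 y -> x = y.
  have [<-|/eqP xy] := eqVneq x y; first by exists 0%N.
  have [j xyj] : exists j, (x 0 j != y 0 j)%R.
    apply: contrapT => no; apply: xy; apply/rowP => j.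
    by apply/eqP/negP => /negP xy; apply: no; exists j.
  exists (Num.truncn (`|x 0 j - y 0 j|^-1)%R) => n nn /(congr1 pickle) xyn.
  have := gcell_close (h0 n) xyn erefl j.
  rewrite ltNge => /negP []; rewrite -[leRHS]invrK lef_pV2 ?posrE//; last first.
    by rewrite invr_gt0 normr_gt0 subr_eq0.
  by rewrite ltW// (lt_le_trans (truncnS_gt _))// ler_nat ltnS.
have /choice[f fP] (p : T * T) : exists n0, forall n, (n0 <= n)%N ->
    gindex n.+1%:R^-1 p.1 = gindex n.+1%:R^-1 p.2 -> p.1 = p.2 by exact: sep.
exists (\max_(p <- [seq (x, y) | x <- F, y <- F]) f p) => x y xF yF.
apply: (fP (x, y)); apply: leq_bigmax_seq => //.
by apply/allpairsP; exists (x, y).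
Qed.

Let point_count_sup B xi : measurable B ->
  point_count xi B = ereal_sup (range (fun n => occupied n B xi)).
Proof.
move=> mB; apply/eqP; rewrite eq_le; apply/andP; split; last first.
  by apply: ge_ereal_sup => _ [n _ <-]; exact: occupied_le.
rewrite /point_count counting_esum; apply: ge_ereal_sup => _ [F [fF FX] <-].
have [n nF] := separated (fset_set F).
apply: (@le_trans _ _ (occupied n B xi)); last first.
  by apply: ereal_sup_ubound; exists n.
rewrite -esum_fset// -counting_esum.
(* Viewing [F] as a configuration allows it to be counted cell by cell; by the choice of [n] each
   cell holds at most one of its points. *)
pose F' := conf_of_seq (fset_set F).
have F'E : points F' = F by apply/seteqP; split=> x /=; rewrite in_fset_set// inE.
have := @point_count_gcell _ setT F' (h0 n) measurableT.
rewrite /point_count F'E setIT => ->.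
apply: lee_nneseries => i _; first by move=> _; exact: counting_ge0.
rewrite setTI indicE; case: (boolP (xi \in _)) => [_|/negP Fi].
  apply: counting_subset1 => x y [Fx xi'] [Fy yi].
  apply: nF; rewrite ?in_fset_set ?inE//.
  by apply: (pcan_inj pickleK); rewrite [LHS]xi' yi.
rewrite (_ : F `&` _ = set0) ?counting_set0//.
apply/seteqP; split=> // x [Fx xi']; apply: Fi; apply/mem_set => /= v.
have [xix Bx] := FX _ Fx.
by suff : set0 x by []; rewrite -v.
Qed.

(** Each count is a supremum of countable sums of void indicators, by [point_count_sup].
    Consequently two finite measures of equal mass on configurations coincide as soon as they agree
    on void events. *)
Lemma conf_measurableE : @measurable _ conf = <<s void_events >>.
Proof.
apply/seteqP; split; last first.
  apply: smallest_sub; first exact: sigma_algebra_measurable.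
  by move=> _ [B [mB _ ->]]; exact: measurable_void_event.
apply: smallest_sub; first exact: smallest_sigma_algebra.
move=> _ [B [C [mB mC ->]]].
pose S := g_sigma_algebraType void_events.
suff : measurable_fun [set: S] (fun xi : S => point_count xi B).
  by move=> /(_ measurableT _ mC); rewrite setTI.
under eq_fun do rewrite point_count_sup//.
rewrite (_ : (fun _ => _) = (fun xi : S => esups (fun n => occupied n B xi) 0%N)).
  apply: measurable_fun_esups => n.
  apply: ge0_emeasurable_sum => // i _.
  apply/measurable_EFinP; apply: measurable_indic; apply: measurableC.
  apply: sub_sigma_algebra; exists (B `&` gcell n.+1%:R^-1 i); split => //.
    by apply: measurableI => //; exact: measurable_gcell.
  by apply: bounded_rVS (@gcell_bounded _ _ _ i (h0 n)); exact: subIsetr.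
apply/funext => xi; rewrite /esups/=; congr ereal_sup.
by apply/seteqP; split=> _ [n _ <-]; exists n.
Qed.

End conf_measurable.

(** * Sums over the points of a configuration as integrals *)

Section pts.
Context (R : realType) (d : nat).
Local Notation T := 'rV[R]_d.
Local Notation conf := (conf R d).
Implicit Types (xi : conf) (B C W : set T).
Local Open Scope ereal_scope.

Import HBNNSimple.

Definition pts xi : {measure set T -> \bar R} :=
  mrestr (@counting T R) (measurable_conf xi).

Lemma ptsE xi B : pts xi B = point_count xi B.
Proof. by rewrite /pts/= /mrestr setIC. Qed.

Lemma pts_gcell_fin xi (h : R) i : (0 < h)%R ->
  pts xi (gcell h i) \is a fin_num.
Proof.
by move=> h0; rewrite ptsE /point_count /counting asboolT//; exact: conf_gcell.
Qed.

Lemma integral_pts xi (f : T -> \bar R) : measurable_fun setT f ->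
  (forall x, 0 <= f x) -> \int[pts xi]_x f x = \esum_(x in points xi) f x.
Proof.
move=> mf f0.
have mxi := measurable_conf xi.
rewrite (ge0_negligible_integral (measurableC mxi))//; last first.
  by rewrite /= /mrestr setIC setICr; exact: counting_set0.
rewrite setTD setCK.
have xiE : points xi = \bigcup_i (points xi `&` gcell (1 : R)%R i).
  by rewrite -setI_bigcupr bigcup_gcell setIT.
have tI : trivIset setT (fun i => points xi `&` gcell (1 : R)%R i).
  by apply/trivIset_setIl; exact: trivIset_gcell.
have mcell i : measurable (gcell (1 : R)%R i : set T) by exact: measurable_gcell.
rewrite {1 2}xiE ge0_integral_bigcup//; last 2 first.
- by move=> i; exact: measurableI.
- exact: measurable_funTS.
rewrite esum_bigcupT// nneseries_esumT; last by move=> i; exact: integral_ge0.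
apply: eq_esum => i _.
have fF : finite_set (points xi `&` gcell (1 : R)%R i) by exact: conf_gcell.
rewrite esum_fset// fsbig_finite//=.
rewrite -[X in \int[_]_(x in X) _](_ : \big[setU/set0]_(x <- fset_set (points xi `&` gcell (1 : R)%R i)) [set x] = _).
  rewrite ge0_integral_bigsetU//; last 3 first.
  - by move=> x; exact: measurable_set1_rV.
  - by move=> x y _ _ [z [-> ->]].
  - exact: measurable_funTS.
  rewrite big_seq [RHS]big_seq; apply: eq_bigr => x.
  rewrite in_fset_set// inE => -[xix _].
  rewrite (eq_integral (cst (f x))); last by move=> y /set_mem ->.
  rewrite integral_cst//; last exact: measurable_set1_rV.
  rewrite ptsE /point_count (_ : _ `&` _ = [set x]) ?counting_set1 ?mule1//.
  by apply/seteqP; split=> [y []//|y ->].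
apply/seteqP; split=> x.
  by rewrite -bigcup_seq => -[y /=]; rewrite in_fset_set// inE => + ->.
by move=> xi'; rewrite -bigcup_seq; exists x => //=; rewrite in_fset_set// inE.
Qed.

(** The kernel [pts] has infinite mass in general, while measurability of section masses is
    available for bounded kernels. It is applied to the restrictions to unit cells, where the mass
    is finite, and the results are summed. *)
Lemma measurable_integral_pts d' (Y : measurableType d') (h : Y -> conf)
    (f : Y * T -> \bar R) : measurable_fun setT h -> measurable_fun setT f ->
  (forall z, 0 <= f z) ->
  measurable_fun setT (fun y => \int[pts (h y)]_x f (y, x)).
Proof.
move=> mh mf f0; pose f_ := nnsfun_approx measurableT mf.
have mk U : measurable U -> measurable_fun setT (fun y => pts (h y) U).
  move=> mU; under eq_fun do rewrite ptsE.
  exact: (measurableT_comp (measurable_point_count mU) mh).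
pose k : R.-ker Y ~> T := HB.pack (fun y => pts (h y)) (isKernel.Build _ _ _ _ _ _ mk).
apply: (@measurable_fun_xsection_integral _ _ _ _ _ f (fun y => pts (h y)) f_).
- by move=> a b ab; exact/nd_nnsfun_approx.
- by move=> z; exact/cvg_nnsfun_approx.
move=> n r; set E := _ @^-1` _.
have mE : measurable E by exact: measurable_funPTI.
have mcell i : measurable (gcell (1 : R)%R i : set T) by exact: measurable_gcell.
rewrite (_ : (fun y => _) =
    (fun y => \sum_(i <oo) mrestr (k y) (mcell i) (xsection E y))).
  apply: ge0_emeasurable_sum => // i _.
  have [] // := @measurable_prod_subset_xsection_kernel _ _ Y T R k _ (mcell i) _ _ mE.
  (* The bound has to be strict, hence the added one. *)
  move=> y; exists (fine (pts (h y) (gcell (1 : R)%R i)) + 1)%R => U mU.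
  rewrite EFinD fineK ?pts_gcell_fin//.
  rewrite (@le_lt_trans _ _ (pts (h y) (gcell (1 : R)%R i)))//.
    by apply: le_measure; rewrite ?inE//; exact: measurableI.
  by rewrite lteDl ?pts_gcell_fin// lte01.
apply/funext => y.
have mEy : measurable (xsection E y) by exact: measurable_xsection.
rewrite -[in LHS](setIT (xsection E y)) -(bigcup_gcell d (1 : R)%R) setI_bigcupr.
rewrite measure_bigcup//; last 2 first.
- by move=> i _; exact: measurableI.
- by apply/trivIset_setIl; exact: trivIset_gcell.
by apply: eq_eseriesl => i; rewrite in_setT.
Qed.

End pts.

(** * Restricting configurations and deleting points *)

Section remove.
Context (R : realType) (d : nat).
Local Notation T := 'rV[R]_d.
Local Notation conf := (conf R d).
Implicit Types (xi : conf) (B C W : set T).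
Local Open Scope ereal_scope.

Definition inter_conf W xi : conf :=
  Conf (fun B bB => sub_finite_set (@setSI _ B _ _ (@subIsetl _ (points xi) W))
                    (points_locally_finite xi bB)).

Definition remove_point (x : T) xi : conf := inter_conf (~` [set x]) xi.

Lemma measurable_conf_voidP d' (Y : measurableType d') (h : Y -> conf) :
  (forall B, measurable B -> measurable [set y | points (h y) `&` B = set0]) ->
  measurable_fun setT h.
Proof.
move=> mh; apply: (measurability _ (conf_measurableE R d)) => _ [_ [B [mB _ ->]] <-].
by rewrite setTI; exact: mh.
Qed.

Lemma measurable_inter_conf W : measurable W -> measurable_fun setT (inter_conf W).
Proof.
move=> mW; apply: measurable_conf_voidP => B mB.
rewrite (_ : [set _ | _] = void_event (W `&` B)).
  by apply: measurable_void_event; exact: measurableI.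
by apply/seteqP; split=> xi /=; rewrite /void_event/= setIA.
Qed.

(** That [B] is void after the deletion of [x] means that the sum over the points [y] of [xi] of the
    indicator of [B y] and [y <> x] vanishes. This sum is an integral against [pts], hence jointly
    measurable in [x] and [xi]. *)
Lemma measurable_remove_point :
  measurable_fun setT (fun p : T * conf => remove_point p.1 p.2).
Proof.
apply: measurable_conf_voidP => B mB.
pose E := [set q : (T * conf) * T | B q.2 /\ q.2 <> q.1.1].
have mE : measurable E.
  rewrite (_ : E = (snd @^-1` B) `&`
      ~` ((fun q : (T * conf) * T => (q.2 - q.1.1)%R) @^-1` [set 0%R])).
    apply: measurableI; first by rewrite -[X in measurable X]setTI; exact: measurable_snd.
    apply: measurableC; rewrite -[X in measurable X]setTI.
    apply: measurable_fun_rVB => //; first exact: measurableT_comp.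
    exact: measurable_set1_rV.
  apply/seteqP; split=> -[[x xi] y] /= [By yx]; split=> // yx'; apply: yx.
    by apply/eqP; rewrite -subr_eq0; apply/eqP; exact: yx'.
  by apply/eqP; rewrite subr_eq0; apply/eqP; exact: yx'.
pose f q : \bar R := (\1_E q)%:E.
have mf : measurable_fun setT f by exact/measurable_EFinP/measurable_indic.
have f0 q : 0 <= f q by rewrite lee_fin.
rewrite (_ : [set _ | _] = [set p : T * conf | \int[pts p.2]_x f (p, x) = 0]).
  rewrite -[X in measurable X]setTI.
  have := @measurable_integral_pts R d _ _ snd f measurable_snd mf f0.
  by move=> /(_ measurableT _ (emeasurable_set1 0)).
apply/seteqP; split=> -[x xi] /=; (rewrite integral_pts//; last
    exact: (measurableT_comp mf (pair1_measurable _))).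
  move=> v; apply: esum1 => y xiy; rewrite /f indicE.
  rewrite (_ : (_ \in _) = false)//; apply/negbTE/negP => /set_mem [/= By yx].
  by suff : set0 y by []; rewrite -v.
move=> h0; apply/seteqP; split=> // y [[xiy yx] By].
have : f ((x, xi), y) <= \esum_(z in points xi) f (x, xi, z).
  apply: esum_ge; exists [set y]; last by rewrite fsbig_set1.
  by split=> // _ ->.
by rewrite h0 /f indicE mem_set// lee_fin ler10.
Qed.

Lemma measurable_fun_remove_point d' (Y : measurableType d') (g : Y -> T)
    (h : Y -> conf) : measurable_fun setT g -> measurable_fun setT h ->
  measurable_fun setT (fun y => remove_point (g y) (h y)).
Proof.
by move=> mg mh; exact: (measurableT_comp measurable_remove_point (measurable_fun_pair mg mh)).
Qed.

End remove.

(** * The Mecke formula *)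

Section image_measure.
Context dY dZ (Y : measurableType dY) (Z : measurableType dZ) (R : realType).
Variables (m : {measure set Y -> \bar R}) (f : Y -> Z).
Hypothesis mf : measurable_fun setT f.

Definition image_measure : {measure set Z -> \bar R} :=
  @measure_function_pushforward__canonical__measure_function_Measure _ _ Y Z R m f mf.

Lemma image_measureE A : image_measure A = m (f @^-1` A).
Proof. by []. Qed.

Lemma integral_image_measure (g : Z -> \bar R) : measurable_fun setT g ->
  (forall z, (0 <= g z)%E) ->
  (\int[image_measure]_z g z = \int[m]_y g (f y))%E.
Proof. by move=> mg g0; rewrite /image_measure ge0_integral_pushforward. Qed.

End image_measure.

Section mixture.
Context dY dZ (Y : measurableType dY) (Z : measurableType dZ) (R : realType).
Variables (m : {measure set Y -> \bar R}) (ka : Y -> {measure set Z -> \bar R}).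
Hypothesis mka : forall U, measurable U -> measurable_fun setT (fun y => ka y U).
Local Open Scope ereal_scope.

(* The dummy argument carries the measurability proof that the measure instance needs. *)
Definition mixture_of (_ : forall U, measurable U -> measurable_fun setT (fun y => ka y U))
  (U : set Z) : \bar R := \int[m]_y ka y U.
Local Notation mixture := (mixture_of mka).

Let mixture0 : mixture set0 = 0.
Proof.
by rewrite /mixture_of (eq_integral (cst 0)) ?integral0// => y _; rewrite measure0.
Qed.

Let mixture_ge0 U : 0 <= mixture U. Proof. exact: integral_ge0. Qed.

Let mixture_sigma_additive : semi_sigma_additive mixture.
Proof.
move=> U mU tU mUU; rewrite [X in _ --> X](_ : _ =
  \int[m]_y (\sum_(n <oo) ka y (U n))); last first.
  apply: eq_integral => V _.
  by apply/esym/cvg_lim => //; exact/measure_semi_sigma_additive.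
apply/cvg_closeP; split.
  by apply: is_cvg_nneseries => n _ _; exact: integral_ge0.
by rewrite closeE// integral_nneseries// => n; exact: mka.
Qed.

HB.instance Definition _ := isMeasure.Build _ _ R
  mixture mixture0 mixture_ge0 mixture_sigma_additive.

Definition mixture_measure : {measure set Z -> \bar R} := mixture.

Import HBNNSimple.

Let integral_mixture_nnsfun (f : {nnsfun Z >-> R}) :
  \int[mixture_measure]_z (f z)%:E = \int[m]_y \int[ka y]_z (f z)%:E.
Proof.
rewrite integralT_nnsfun sintegralE.
under [RHS]eq_integral do rewrite integralT_nnsfun sintegralE.
rewrite /= ge0_integral_fsum//.
- apply: eq_fsbigr => r /set_mem [z _ <-].
  rewrite ge0_integralZl//; last by rewrite lee_fin.
  exact: mka.
- move=> r; apply: emeasurable_funM => //; exact: mka.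
- by move=> r y _; exact: nnsfun_mulemu_ge0.
Qed.

(** A Tonelli formula for kernels without any finiteness, as is required for [palm_measure]: it
    holds for simple functions by linearity and passes to the limit by monotone convergence on both
    sides. *)
Lemma integral_mixture (f : Z -> \bar R) : measurable_fun setT f ->
  (forall z, 0 <= f z) ->
  \int[mixture_measure]_z f z = \int[m]_y \int[ka y]_z f z.
Proof.
move=> mf f0; pose f_ := nnsfun_approx measurableT mf.
have lim_f (mu : {measure set Z -> \bar R}) :
    \int[mu]_z f z = limn (fun n => \int[mu]_z (f_ n z)%:E).
  rewrite -monotone_convergence//.
  - by apply: eq_integral => z _; apply/esym/cvg_lim => //; exact: cvg_nnsfun_approx.
  - by move=> n; exact/measurable_EFinP.
  - by move=> n z _; rewrite lee_fin.
  - by move=> z _ a b ab; rewrite lee_fin; exact/lefP/nd_nnsfun_approx.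
rewrite lim_f; under [RHS]eq_integral do rewrite lim_f.
rewrite monotone_convergence//.
- by under eq_fun do rewrite integral_mixture_nnsfun.
- move=> n; apply: (measurable_fun_integral_kernel mka); last exact/measurable_EFinP.
  by move=> z; rewrite lee_fin.
- by move=> n y _; apply: integral_ge0 => z _; rewrite lee_fin.
- move=> y _ a b ab; apply: ge0_le_integral => //.
  + by move=> z _; rewrite lee_fin.
  + exact/measurable_EFinP.
  + exact/measurable_EFinP.
  + by move=> z _; rewrite lee_fin; exact/lefP/nd_nnsfun_approx.
Qed.

End mixture.

Section poisson_facts.
Context (R : realType) (d : nat) (dO : measure_display) (Omega : measurableType dO).
Local Open Scope ereal_scope.
Variables (P : probability Omega R) (nu : {measure set 'rV[R]_d -> \bar R}).
Variable eta : Omega -> conf R d.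
Hypothesis eta_poisson : poisson_process P nu eta.
Hypothesis nu_lf : forall B : set 'rV[R]_d, measurable B -> bounded_set B -> nu B < +oo.
Local Notation T := 'rV[R]_d.
Implicit Types (B C : set T).
Local Open Scope ereal_scope.

Let meta := poisson_measurable eta_poisson.

Lemma measurable_poisson_count B : measurable B ->
  measurable_fun setT (fun w => point_count (eta w) B).
Proof. by move=> mB; exact: (measurableT_comp (measurable_point_count mB) meta). Qed.

Lemma poisson_prob1 (r : R) n : (0 <= r)%R ->
  poisson_prob r n [set n] = (r ^+ n / n`!%:R * expR (- r))%:E.
Proof.
rewrite /poisson_prob /poisson_pmf; case: ltP => [r0 _|r0 r0'].
  by rewrite esum_set1 ?r0// lee_fin !mulr_ge0// ?expR_ge0// exprn_ge0// ltW.
have -> : r = 0%R by apply/eqP; rewrite eq_le r0 r0'.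
rewrite diracE oppr0 expR0 mulr1; case: n => [|n].
  by rewrite mem_set// expr0 fact0 divr1.
rewrite exprS mul0r mul0r (_ : (_ \in _) = false)//.
by apply/negbTE/negP => /set_mem.
Qed.

Lemma poisson_countE B n : measurable B -> nu B < +oo ->
  P [set w | point_count (eta w) B = n%:R%:E] =
  (fine (nu B) ^+ n / n`!%:R * expR (- fine (nu B)))%:E.
Proof.
move=> mB Boo; by rewrite (poisson_count eta_poisson)// poisson_prob1// fine_ge0.
Qed.

Lemma poisson_void B : measurable B -> nu B < +oo ->
  P (eta @^-1` void_event B) = (expR (- fine (nu B)))%:E.
Proof.
move=> mB Boo; have := poisson_countE 0 mB Boo.
by rewrite expr0 fact0 divr1 mul1r => <-; rewrite void_eventE.
Qed.

Lemma poisson_independent2 B1 B2 (C1 C2 : set (\bar R)) :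
  measurable B1 -> measurable B2 -> B1 `&` B2 = set0 ->
  measurable C1 -> measurable C2 ->
  P [set w | C1 (point_count (eta w) B1) /\ C2 (point_count (eta w) B2)] =
  P [set w | C1 (point_count (eta w) B1)] * P [set w | C2 (point_count (eta w) B2)].
Proof.
move=> mB1 mB2 B12 mC1 mC2.
pose B (i : 'I_2) := if i == ord0 then B1 else B2.
pose C (i : 'I_2) := if i == ord0 then C1 else C2.
have := @poisson_independent _ _ _ _ _ _ _ eta_poisson 2%N B.
have mB i : measurable (B i) by rewrite /B; case: ifP.
have mC i : measurable (C i) by rewrite /C; case: ifP.
have tB : trivIset setT B.
  move=> i j _ _ [x []]; rewrite /B.
  case: i => [[|[|//]] i2]; case: j => [[|[|//]] j2] /= x1 x2; try exact: val_inj.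
    by suff : set0 x by []; rewrite -B12.
  by suff : set0 x by []; rewrite -B12.
move=> /(_ mB tB C mC); rewrite !big_ord_recl big_ord0 mule1 /B /C /= => <-.
congr (P _); apply/seteqP; split=> w /=.
  by move=> [w1 w2] [[|[|//]] i2] /=.
by move=> h; split; [exact: (h ord0)|exact: (h (lift ord0 ord0))].
Qed.

(** Since [n / n! = 1 / (n - 1)!], a shift of the index pulls out one factor [r] and leaves the
    total mass. Rate zero is separate because [poisson_prob] is then a Dirac mass. *)
Lemma poisson_mean (r : R) : (0 <= r)%R ->
  \sum_(n <oo) (n%:R * (r ^+ n / n`!%:R * expR (- r)))%:E = r%:E.
Proof.
move=> r0; have pmf0 n : (0 <= r ^+ n / n`!%:R * expR (- r))%R.
  by rewrite !mulr_ge0// ?expR_ge0// exprn_ge0.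
have tot : \sum_(n <oo) (r ^+ n / n`!%:R * expR (- r))%:E = 1 :> \bar R.
  have [r1|r1] := ltP 0%R r; last first.
    have -> : r = 0%R by apply/eqP; rewrite eq_le r1 r0.
    rewrite nneseries_recl//.
    rewrite oppr0 expR0 expr0 fact0 divr1 mulr1 eseries0 ?adde0//.
    by move=> n n1 _; rewrite -(prednK n1) exprS !mul0r.
  have : poisson_prob r 0 setT = 1 by exact: probability_setT.
  rewrite /poisson_prob r1 -nneseries_esumT; last first.
    by move=> n; rewrite lee_fin poisson_pmf_ge0.
  by rewrite /poisson_pmf r1 => <-.
rewrite nneseries_recl//; last by move=> n _; rewrite lee_fin mulr_ge0.
rewrite mul0r add0e.
rewrite -nneseries_addn; last by move=> n; rewrite lee_fin mulr_ge0.
rewrite -[RHS]mule1 -tot -nneseriesZl//; last by move=> n _; rewrite lee_fin.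
apply: eq_eseriesr => n _; rewrite addn1 -EFinM; congr EFin.
rewrite exprS factS natrM; field.
by rewrite nat1r !pnatr_eq0 -lt0n fact_gt0.
Qed.

Lemma poisson_count_fin B w : bounded_set B ->
  exists n : nat, point_count (eta w) B = n%:R%:E.
Proof.
move=> bB; rewrite /point_count /counting asboolT; last exact: points_locally_finite.
by eexists.
Qed.

(** The count in [B] is independent of the voidness of the disjoint set [C]. Only independence of
    events is available, so the count is expanded over its values and the events are factored one by
    one. *)
Lemma poisson_void_mean B C : measurable B -> bounded_set B -> measurable C ->
  nu B < +oo -> B `&` C = set0 ->
  \int[P]_(w in eta @^-1` void_event C) point_count (eta w) B =
  nu B * P (eta @^-1` void_event C).
Proof.
move=> mB bB mC Boo BC; set V := eta @^-1` _.
have mV : measurable V.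
  by rewrite -[V]setTI; apply: meta => //; exact: measurable_void_event.
have mN n : measurable [set w | point_count (eta w) B = n%:R%:E].
  rewrite -[X in measurable X]setTI.
  exact: (measurable_poisson_count mB measurableT (emeasurable_set1 _)).
rewrite integral_mkcond.
rewrite (eq_integral (fun w => \sum_(n <oo) (n%:R)%:E *
    (\1_(V `&` [set w | point_count (eta w) B = n%:R%:E]) w)%:E)); last first.
  move=> w _; rewrite patchE; have [wV|wV] := boolP (w \in V); last first.
    rewrite eseries0// => n _ _; rewrite indicE in_setI (negbTE wV) mule0//.
  have [n wn] := poisson_count_fin w bB.
  rewrite (@nneseriesD1 _ _ n)//.
  rewrite indicE mem_set//; last by split=> //; exact: set_mem.
  rewrite mule1 wn eseries0 ?adde0// => i _ /andP[_ ni].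
  rewrite indicE (_ : (_ \in _) = false) ?mule0//.
  apply/negbTE/negP => /set_mem[_]; rewrite /= wn => -[] /eqP.
  by rewrite eqr_nat eq_sym (negbTE ni).
rewrite integral_nneseries//; last first.
  move=> n; apply: emeasurable_funM => //; apply/measurable_EFinP/measurable_indic.
  exact: measurableI.
have Bfin : nu B \is a fin_num by rewrite ge0_fin_numE.
rewrite -[in RHS](fineK Bfin) -[in RHS]poisson_mean; last exact: fine_ge0.
have PVfin : P V \is a fin_num by exact: fin_num_measure.
rewrite muleC -[X in X * _](fineK PVfin) -nneseriesZl//.
rewrite fineK//.
apply: eq_eseriesr => n _.
rewrite ge0_integralZl//; last first.
  by apply/measurable_EFinP/measurable_indic; exact: measurableI.
rewrite integral_indic//; last exact: measurableI.
rewrite setIT EFinM -poisson_countE// muleCA; congr *%E.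
rewrite muleC -[X in _ = _ * P X](_ : [set w | [set 0] (point_count (eta w) C)] = V).
  rewrite -(@poisson_independent2 _ _ [set n%:R%:E])//.
  by congr (P _); rewrite setIC; apply/seteqP; split=> w [] /=; rewrite /V void_eventE.
by rewrite /V void_eventE.
Qed.

Definition palm_map (xi : conf R d) (x : T) : T * conf R d := (x, remove_point x xi).

Lemma measurable_palm_map xi : measurable_fun setT (palm_map xi).
Proof.
apply: measurable_fun_pair => //.
exact: measurable_fun_remove_point.
Qed.

Definition palm_measure w : {measure set (T * conf R d) -> \bar R} :=
  image_measure (pts (eta w)) (measurable_palm_map (eta w)).

Definition joint_map (x : T) (w : Omega) : T * conf R d := (x, eta w).

Lemma measurable_joint_map x : measurable_fun setT (joint_map x).
Proof. exact: measurable_fun_pair. Qed.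

Definition joint_measure x : {measure set (T * conf R d) -> \bar R} :=
  image_measure P (measurable_joint_map x).

Let measurable_palm_measure U : measurable U ->
  measurable_fun setT (fun w => palm_measure w U).
Proof.
move=> mU.
pose f (q : Omega * T) : \bar R := (\1_U (palm_map (eta q.1) q.2))%:E.
have mf : measurable_fun setT f.
  have mp : measurable_fun setT (fun q : Omega * T => palm_map (eta q.1) q.2).
    apply: measurable_fun_pair => //.
    apply: measurable_fun_remove_point => //; exact: measurableT_comp.
  have mU1 : measurable_fun setT (EFin \o (\1_U : T * conf R d -> R)).
    exact/measurable_EFinP/measurable_indic.
  exact: (measurableT_comp mU1 mp).
rewrite (_ : (fun w => _) = (fun w => \int[pts (eta w)]_x f (w, x))).
  by apply: measurable_integral_pts => // q; rewrite lee_fin.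
apply/funext => w.
rewrite -[X in palm_measure w X](setIT U) -integral_indic// integral_image_measure//.
exact/measurable_EFinP/measurable_indic.
Qed.

Let measurable_joint_measure U : measurable U ->
  measurable_fun setT (fun x => joint_measure x U).
Proof.
move=> mU; pose V := [set q : T * Omega | U (joint_map q.1 q.2)].
have mV : measurable V.
  rewrite -[V]setTI; apply: measurable_fun_pair => //; exact: measurableT_comp.
rewrite (_ : (fun x => _) = P \o xsection V); first exact: measurable_fun_xsection.
apply/funext => x; rewrite /joint_measure image_measureE; congr (P _).
by apply/seteqP; split=> w; rewrite /xsection/= inE.
Qed.

(** [M1] is the reduced Campbell measure of [eta], and [M2] the product of [nu] with the law of
    [eta]; the two sides of [mecke] are the integrals of [f] against them. *)
Let M1 := mixture_measure P measurable_palm_measure.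
Let M2 := mixture_measure nu measurable_joint_measure.

Let M2E B E : measurable B -> measurable E ->
  M2 (B `*` E) = nu B * P (eta @^-1` E).
Proof.
move=> mB mE; rewrite /M2 /mixture_measure /= /mixture_of.
rewrite (eq_integral (fun x => P (eta @^-1` E) * (\1_B x)%:E)); last first.
  move=> x _; rewrite /joint_measure image_measureE indicE.
  have [xB|xB] := boolP (x \in B).
    rewrite mule1; congr (P _); apply/seteqP; split=> w /=; first by case.
    by move=> Ew; split=> //; exact: set_mem.
  rewrite mule0 -[RHS](measure0 P); congr (P _).
  by apply/seteqP; split=> w //= [/mem_set]; rewrite (negbTE xB).
rewrite ge0_integralZl//; last by apply/measurable_EFinP; exact: measurable_indic.
by rewrite integral_indic// setIT muleC.
Qed.

(* Deleting the point [x] of [B] makes [C] void iff either [C] is void already and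
   [x] lies outside [C], or [x] is the only point in [C] (the event [W] below). *)
Let M1E B C : measurable B -> bounded_set B -> measurable C -> bounded_set C ->
  M1 (B `*` void_event C) = nu B * P (eta @^-1` void_event C).
Proof.
move=> mB bB mC bC.
have Boo : nu B < +oo by exact: nu_lf.
have Coo : nu C < +oo by exact: nu_lf.
have fin D : measurable D -> nu D < +oo -> nu D \is a fin_num.
  by move=> mD Doo; rewrite ge0_fin_numE.
have le_lty D E : measurable D -> measurable E -> D `<=` E -> nu E < +oo -> nu D < +oo.
  by move=> mD mE DE; apply: le_lt_trans; apply: le_measure; rewrite ?inE.
pose V := eta @^-1` void_event C.
pose W := [set w | [set 1] (point_count (eta w) (C `&` B)) /\
                   [set 0] (point_count (eta w) (C `\` B))].
have mV : measurable V.
  by rewrite -[V]setTI; apply: meta => //; exact: measurable_void_event.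
have mW : measurable W.
  apply: measurableI; rewrite -[X in measurable X]setTI.
    apply: (measurable_poisson_count _ measurableT (emeasurable_set1 _)).
    exact: measurableI.
  apply: (measurable_poisson_count _ measurableT (emeasurable_set1 _)).
  exact: measurableD.
have palmE w : palm_measure w (B `*` void_event C) =
    ((fun w => point_count (eta w) (B `\` C)) \_ V) w + (\1_W w)%:E.
  rewrite patchE /palm_measure image_measureE ptsE; set E := _ @^-1` _.
  have EP x : (points (eta w) `&` E) x <-> [/\ points (eta w) x, B x &
      forall y, points (eta w) y -> C y -> y = x].
    split=> [[xw [Bx /= v]]|[xw Bx h]].
      split=> // y yw Cy; apply: contrapT => yx.
      by suff : set0 y by []; rewrite -v.
    split=> //; split=> //=; apply/seteqP; split=> // y [[yw /= yx] Cy].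
    exact/yx/h.
  have [/set_mem wV|/negP wV] := boolP (w \in V).
    rewrite indicE (_ : (w \in W) = false) ?adde0; last first.
      apply/negbTE/negP => /set_mem[/= w1 _].
      have [x xE] := counting_eq1 w1.
      have : (points (eta w) `&` (C `&` B)) x by rewrite xE.
      by move=> [xw [Cx _]]; suff : set0 x by []; rewrite -wV.
    congr counting; apply/seteqP; split=> x.
      move=> /EP[xw Bx _]; split=> //; split=> // Cx.
      by suff : set0 x by []; rewrite -wV.
    move=> [xw [Bx Cx]]; apply/EP; split=> // y yw Cy.
    by suff : set0 y by []; rewrite -wV.
  have [z [zw Cz]] : exists z, (points (eta w) `&` C) z.
    by apply/set0P/negP => /eqP wC; apply: wV; apply/mem_set.
  rewrite add0e indicE; have [/set_mem[/= w1 w0]|/negP nW] := boolP (w \in W).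
    have [x xE] := counting_eq1 w1.
    have [xw [Cx Bx]] : (points (eta w) `&` (C `&` B)) x by rewrite xE.
    rewrite /point_count (_ : _ `&` _ = [set x]) ?counting_set1//.
    apply/seteqP; split=> y; last first.
      move=> ->; apply/EP; split=> // y' yw' Cy'.
      have [By'|By'] := pselect (B y').
        by have : [set x] y' by rewrite -xE.
      by suff : set0 y' by []; rewrite -(counting_eq0 w0).
    by move=> /EP[yw By h]; rewrite /= (h x).
  rewrite /point_count (_ : _ `&` _ = set0) ?counting_set0//.
  apply/seteqP; split=> // x /EP[xw Bx h]; apply: nW; apply/mem_set.
  have zx := h _ zw Cz; rewrite {}zx in zw Cz.
  split=> /=; rewrite /point_count.
    rewrite (_ : _ `&` _ = [set x]) ?counting_set1//.
    by apply/seteqP; split=> [y [yw [Cy _]]|y ->//]; exact: h.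
  rewrite (_ : _ `&` _ = set0) ?counting_set0//.
  by apply/seteqP; split=> // y [yw [Cy By]]; apply: By; rewrite (h y).
rewrite /M1 /mixture_measure /= /mixture_of.
under eq_integral do rewrite palmE.
rewrite ge0_integralD//; last 3 first.
- by move=> w _; apply: erestrict_ge0 => w' _; exact: counting_ge0.
- apply/(measurable_restrictT _ mV); apply: measurable_funTS.
  by apply: measurable_poisson_count; exact: measurableD.
- exact/measurable_EFinP/measurable_indic.
rewrite integral_indic// setIT.
have mBC : measurable (B `\` C) by exact: measurableD.
have mCB : measurable (C `\` B) by exact: measurableD.
have mCIB : measurable (C `&` B) by exact: measurableI.
have BCoo : nu (B `\` C) < +oo by apply: le_lty Boo => //; exact: subDsetl.
have CBoo : nu (C `\` B) < +oo by apply: le_lty Coo => //; exact: subDsetl.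
have CIBoo : nu (C `&` B) < +oo by apply: le_lty Coo => //; exact: subIsetl.
rewrite -integral_mkcond poisson_void_mean//; last 2 first.
- by apply: bounded_rVS bB; exact: subDsetl.
- by rewrite setDE -setIA setICl setI0.
have PW : P W = P [set w | point_count (eta w) (C `&` B) = 1] *
                P [set w | point_count (eta w) (C `\` B) = 0].
  rewrite /W (@poisson_independent2 (C `&` B) (C `\` B) [set 1] [set 0])//.
  by rewrite setDE setIACA setICr setI0.
rewrite [X in _ + X](PW : _ = _) (poisson_countE 1)// (poisson_countE 0)// poisson_void//.
have nuC : nu C = nu (C `&` B) + nu (C `\` B).
  by rewrite -measureU// ?setUIDK// setDE setIACA setICr setI0.
have nuB : nu B = nu (C `&` B) + nu (B `\` C).
  rewrite setIC -measureU//; [by rewrite setUIDK|exact: measurableI|].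
  by rewrite setDE setIACA setICr setI0.
rewrite nuC nuB.
(* With [a], [b], [c] the masses of [B] without [C], of the intersection and of [C] without [B], the
   claim is [a exp(-(b+c)) + b exp(-b) exp(-c) = (a+b) exp(-(b+c))]. *)
case: (nu (B `\` C)) (fin _ mBC BCoo) => [a||] //= _.
case: (nu (C `&` B)) (fin _ mCIB CIBoo) => [b||] //= _.
case: (nu (C `\` B)) (fin _ mCB CBoo) => [c||] //= _.
apply/eqP; rewrite eqe; apply/eqP.
by rewrite expr1 expr0 !fact0 (_ : 1`! = 1)%N// !divr1 opprD expRD; ring.
Qed.

(* Both sides integrate [f] against a measure on [T * conf R d]. Void events form a
   pi-system generating the sigma-algebra of configurations, so it suffices to
   compare the two measures on products with void events. *)
Lemma mecke (f : T * conf R d -> \bar R) : measurable_fun setT f ->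
  (forall z, 0 <= f z) ->
  \int[P]_w \int[pts (eta w)]_x f (x, remove_point x (eta w)) =
  \int[nu]_x \int[P]_w f (x, eta w).
Proof.
move=> mf f0.
transitivity (\int[M1]_z f z).
  rewrite integral_mixture//; apply: eq_integral => w _.
  by rewrite integral_image_measure.
transitivity (\int[M2]_z f z); last first.
  rewrite integral_mixture//; apply: eq_integral => x _.
  by rewrite integral_image_measure.
have mcell i : measurable (gcell (1 : R)%R i : set T) by exact: measurable_gcell.
have bcell i : bounded_set (gcell (1 : R)%R i : set T) by exact: gcell_bounded.
(* With the first factor fixed and bounded, both sides are finite measures in [E], as uniqueness on
   a pi-system requires. General [B] are then recovered cell by cell in [M12]. *)
have M12b B E : measurable B -> bounded_set B -> measurable E ->
    M1 (B `*` E) = M2 (B `*` E).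
  move=> mB bB mE.
  have mBT : measurable (B `*` [set: conf R d]) by exact: measurableX.
  pose m1 := image_measure (mrestr M1 mBT) measurable_snd.
  pose m2 := image_measure (mrestr M2 mBT) measurable_snd.
  have sndE F : snd @^-1` F `&` (B `*` [set: conf R d]) = B `*` F.
    by apply/seteqP; split=> -[x xi] /=; [move=> [? []]|move=> []].
  suff : m1 E = m2 E by rewrite /m1 /m2 !image_measureE /= /mrestr sndE.
  apply: (@measure_unique _ R _ (@void_events R d) (fun=> setT) _ _ _ _ m1 m2) => //.
  - exact: conf_measurableE.
  - exact: void_events_setI.
  - move=> _; exists set0; split=> //.
      by apply/bounded_rVP; exists 0%R.
    by apply/seteqP; split=> // xi _; rewrite /void_event/= setI0.
  - by rewrite bigcup_const//; exists 0%N.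
  - move=> _ [C [mC bC ->]]; rewrite /m1 /m2 !image_measureE /= /mrestr sndE.
    by rewrite M1E// M2E//; exact: measurable_void_event.
  - move=> _; rewrite /m1 !image_measureE /= /mrestr sndE.
    rewrite (_ : setT = @void_event R d set0); last first.
      by apply/seteqP; split=> // xi _; rewrite /void_event/= setI0.
    rewrite M1E//; last by apply/bounded_rVP; exists 0%R.
    rewrite (@le_lt_trans _ _ (nu B * 1))//; last by rewrite mule1 nu_lf.
    apply: lee_pmul => //; apply: probability_le1.
    by rewrite -[X in measurable X]setTI; apply: meta => //; exact: measurable_void_event.
have M12 B E : measurable B -> measurable E -> M1 (B `*` E) = M2 (B `*` E).
  move=> mB mE.
  have BE : B `*` E = \bigcup_i ((B `&` gcell (1 : R)%R i) `*` E).
    apply/seteqP; split=> [[x xi] [Bx Ex]|[x xi] [i _ [[Bx _] Ex]]]; last by split.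
    by exists (pickle (gindex (1 : R)%R x)).
  have tBE : trivIset setT (fun i => (B `&` gcell (1 : R)%R i) `*` E).
    move=> i j _ _ [[x xi] [[[_ xi1] _] [[_ xj] _]]].
    by apply: (@trivIset_gcell R d 1%R i j) => //; exists x.
  have mBE i : measurable ((B `&` gcell (1 : R)%R i) `*` E).
    by apply: measurableX => //; exact: measurableI.
  rewrite BE !measure_bigcup//; apply: eq_eseriesr => i _; apply: M12b => //.
    exact: measurableI.
  by apply: bounded_rVS (bcell i); exact: subIsetr.
apply: eq_measure_integral => E mE _.
apply: (@measure_unique _ R _ [set A `*` B | A in measurable & B in measurable]
  (fun i => gcell (1 : R)%R i `*` setT) _ _ _ _ M1 M2) => //.
- exact: measurable_prod_measurableType.
- move=> _ _ [X1 mX1 [X2 mX2 <-]] [Y1 mY1 [Y2 mY2 <-]].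
  exists (X1 `&` Y1); first exact: measurableI.
  by exists (X2 `&` Y2); [exact: measurableI|rewrite setXI].
- by move=> i; exists (gcell (1 : R)%R i) => //; exists setT.
- apply/seteqP; split=> // -[x xi] _.
  by exists (pickle (gindex (1 : R)%R x)).
- by move=> _ [B mB [F mF <-]]; exact: M12.
- move=> i; rewrite M12// M2E// (@le_lt_trans _ _ (nu (gcell (1 : R)%R i) * 1))//.
    by apply: lee_pmul => //; apply: probability_le1; rewrite -[X in measurable X]setTI; exact: meta.
  by rewrite mule1 nu_lf.
Qed.

End poisson_facts.

(** * Independence over disjoint windows *)

Section poisson_independence.
Context (R : realType) (d : nat) (dO : measure_display) (Omega : measurableType dO).
Local Open Scope ereal_scope.
Variables (P : probability Omega R) (nu : {measure set 'rV[R]_d -> \bar R}).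
Variable eta : Omega -> conf R d.
Hypothesis eta_poisson : poisson_process P nu eta.
Local Notation T := 'rV[R]_d.
Local Notation conf := (conf R d).
Implicit Types (B C U V W : set T).

Let meta := poisson_measurable eta_poisson.

Definition window W (w : Omega) : conf := inter_conf W (eta w).

Lemma measurable_window W : measurable W -> measurable_fun setT (window W).
Proof. by move=> mW; exact: (measurableT_comp (measurable_inter_conf mW) meta). Qed.

Let window_void W C :
  window W @^-1` void_event C = [set w | [set 0] (point_count (eta w) (W `&` C))].
Proof.
apply/seteqP; split=> w /=; rewrite /void_event /window/= -setIA.
  by move=> v; rewrite /point_count v counting_set0.
exact: counting_eq0.
Qed.

(** For fixed [G] both sides are finite measures in [E], so agreement on the pi-system of void
    events extends to all events. *)
Let indep_extend U (G : set Omega) : measurable U -> measurable G ->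
  (forall C, measurable C ->
    P (window U @^-1` void_event C `&` G) = P (window U @^-1` void_event C) * P G) ->
  forall E, measurable E -> P (window U @^-1` E `&` G) = P (window U @^-1` E) * P G.
Proof.
move=> mU mG indep E mE.
have PG0 : (0 <= fine (P G))%R by exact: fine_ge0.
pose m1 := image_measure (mrestr P mG) (measurable_window mU).
pose m2 : {measure set conf -> \bar R} := mscale (NngNum PG0) (image_measure P (measurable_window mU)).
have PGE : (fine (P G))%:E = P G by rewrite fineK//; exact: fin_num_measure.
have m2E F : m2 F = P (window U @^-1` F) * P G.
  by rewrite /m2 /= /mscale/= PGE muleC.
rewrite -m2E.
apply: (@measure_unique _ R _ (@void_events R d) (fun=> setT) _ _ _ _ m1 m2) => //.
- exact: conf_measurableE.
- exact: void_events_setI.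
- move=> _; exists set0; split=> //; first by apply/bounded_rVP; exists 0%R.
  by apply/seteqP; split=> // xi _; rewrite /void_event/= setI0.
- by rewrite bigcup_const//; exists 0%N.
- by move=> _ [C [mC bC ->]]; rewrite m2E -indep.
- move=> _; rewrite /m1 image_measureE /= /mrestr.
  by rewrite (@le_lt_trans _ _ 1) ?ltry// probability_le1// preimage_setT setTI.
Qed.

(** The process only provides independent counts, that is, the case where both [E] and [F] are void
    events. The extension is done for one window at a time, with the event of the other window in
    the role of [G]. *)
Lemma window_independent U V (E F : set conf) : measurable U -> measurable V ->
  U `&` V = set0 -> measurable E -> measurable F ->
  P (window U @^-1` E `&` window V @^-1` F) =
  P (window U @^-1` E) * P (window V @^-1` F).
Proof.
move=> mU mV UV mE mF.
have mpre W G : measurable W -> measurable G -> measurable (window W @^-1` G).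
  move=> mW mG; rewrite -[X in measurable X]setTI.
  exact: measurable_window.
apply: indep_extend => //; first exact: mpre.
move=> C mC; rewrite setIC muleC; apply: indep_extend => //.
  by apply: mpre => //; exact: measurable_void_event.
move=> D mD; rewrite setIC muleC !window_void.
rewrite -(@poisson_independent2 _ _ _ _ _ _ _ eta_poisson _ _ [set 0] [set 0])//.
- exact: measurableI.
- exact: measurableI.
- by rewrite setIACA UV set0I.
Qed.

(** By [window_independent] and uniqueness on rectangles, the joint law of the two windows is the
    product of their laws; Tonelli then separates the integrals. *)
Lemma window_expectation2 U V (f g : conf -> R) : measurable U -> measurable V ->
  U `&` V = set0 -> measurable_fun setT f -> measurable_fun setT g ->
  (forall xi, 0 <= f xi)%R -> (forall xi, 0 <= g xi)%R ->
  \int[P]_w (f (window U w) * g (window V w))%:E =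
  (\int[P]_w (f (window U w))%:E) * (\int[P]_w (g (window V w))%:E).
Proof.
move=> mU mV UV mf mg f0 g0.
pose XU : {mfun Omega >-> conf} := HB.pack (window U)
  (isMeasurableFun.Build _ _ _ _ _ (measurable_window mU)).
pose XV : {mfun Omega >-> conf} := HB.pack (window V)
  (isMeasurableFun.Build _ _ _ _ _ (measurable_window mV)).
have mUV : measurable_fun setT (fun w => (window U w, window V w)).
  by apply: measurable_fun_pair; exact: measurable_window.
pose m := image_measure P mUV.
pose fg (z : conf * conf) := (f z.1 * g z.2)%:E.
have mfg : measurable_fun setT fg.
  by apply/measurable_EFinP; apply: measurable_funM; exact: measurableT_comp.
transitivity (\int[m]_z fg z).
  by rewrite integral_image_measure// => z; rewrite lee_fin mulr_ge0.
transitivity (\int[(distribution P XU \x distribution P XV)]_z fg z).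
  apply: eq_measure_integral => A mA _; symmetry.
  apply: product_measure_unique => // E F mE mF.
  rewrite /distribution /m image_measureE -window_independent//.
rewrite fubini_tonelli1//; last by move=> z; rewrite lee_fin mulr_ge0.
rewrite /fubini_F /fg /=.
transitivity (\int[distribution P XU]_x
    ((f x)%:E * \int[distribution P XV]_y (g y)%:E)).
  apply: eq_integral => x _; under eq_integral do rewrite EFinM.
  rewrite ge0_integralZl//; first exact/measurable_EFinP.
    by move=> y _; rewrite lee_fin.
  by rewrite lee_fin.
rewrite /= ge0_integralZr//; last 3 first.
- exact/measurable_EFinP.
- by move=> x _; rewrite lee_fin.
- by apply: integral_ge0 => y _; rewrite lee_fin.
rewrite /distribution !ge0_integral_pushforward//;
  by [exact/measurable_EFinP | move=> ? _; rewrite lee_fin].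
Qed.

Lemma window_expectation_prod (I : choiceType) (r : seq I) (W : I -> set T)
    (h : I -> conf -> R) : uniq r -> (forall i, measurable (W i)) ->
  (forall i j, i \in r -> j \in r -> i != j -> W i `&` W j = set0) ->
  (forall i, measurable_fun setT (h i)) -> (forall i xi, 0 <= h i xi)%R ->
  \int[P]_w (\prod_(i <- r) h i (window (W i) w))%R%:E =
  \prod_(i <- r) \int[P]_w (h i (window (W i) w))%:E.
Proof.
move=> + mW + mh h0; elim: r => [_ _|i r IH /=/andP[ir ur] tW].
  rewrite big_nil; under eq_integral do rewrite big_nil.
  by rewrite (integral_cst P measurableT 1) mul1e; exact: probability_setT.
rewrite big_cons -IH//; last first.
  by move=> j k jr kr; apply: tW; rewrite in_cons ?jr ?kr orbT.
pose V := \big[setU/set0]_(j <- r) W j.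
have mV : measurable V by exact: bigsetU_measurable.
pose g xi := (\prod_(j <- r) h j (inter_conf (W j) xi))%R.
(* Restricting to [V] and then to [W j] is restricting to [W j], so the remaining product depends
   only on the window [V], which is disjoint from [W i]. This reduces the step to two windows. *)
have gE w : (\prod_(j <- r) h j (window (W j) w))%R = g (window V w).
  rewrite /g big_seq [RHS]big_seq; apply: eq_bigr => j jr; congr (h j _).
  apply: conf_inj; rewrite /= -setIA; congr setI.
  by rewrite setIC; apply/esym/setIidl; rewrite /V -bigcup_seq; exact: bigcup_sup.
under eq_integral do rewrite big_cons gE.
rewrite [X in _ = _ * X](eq_integral (fun w => (g (window V w))%:E)); last first.
  by move=> w _; rewrite gE.
rewrite (window_expectation2 _ _ _ (mh i))//.
- rewrite /V -bigcup_seq setI_bigcupr bigcup0// => j jr.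
  by apply: tW; rewrite ?mem_head ?in_cons ?jr ?orbT//; apply: contraNneq ir => ->.
- apply: measurable_prod => j _.
  by apply: (measurableT_comp (mh j)); exact: measurable_inter_conf.
- by move=> xi; apply: prodr_ge0 => j _; exact: h0.
Qed.

End poisson_independence.

(** * Sums over tuples of distinct points *)

Section point_sum.
Context (R : realType) (d : nat).
Local Notation T := 'rV[R]_d.
Local Notation conf := (conf R d).
Implicit Types (xi : conf) (s u : seq T) (f : seq T -> conf -> \bar R).
Local Open Scope ereal_scope.

Definition seq_measurable n f :=
  measurable_fun setT (fun p : n.-tuple T * conf => f p.1 p.2).

(* Sums [f (x :: s) (xi \ x)] over the points [x] of [xi]; its [k]-th iterate at
   the empty sequence is a sum over the [k]-tuples of distinct points of [xi]. *)
Definition point_sum f : seq T -> conf -> \bar R :=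
  fun s xi => \int[pts xi]_x f (x :: s) (remove_point x xi).

Lemma point_sum_ge0 f : (forall s xi, 0 <= f s xi) ->
  forall s xi, 0 <= point_sum f s xi.
Proof. by move=> f0 s xi; exact: integral_ge0. Qed.

Lemma seq_measurable_cons n f dY (Y : measurableType dY) (x : Y -> T)
    (s : Y -> n.-tuple T) (h : Y -> conf) : seq_measurable n.+1 f ->
  measurable_fun setT x -> measurable_fun setT s -> measurable_fun setT h ->
  measurable_fun setT (fun y => f (x y :: s y) (h y)).
Proof.
move=> mf mx ms mh.
have mp : measurable_fun setT (fun y => ([the n.+1.-tuple T of x y :: s y], h y)).
  by apply: measurable_fun_pair => //; exact: measurable_cons.
exact: (measurableT_comp mf mp).
Qed.

Lemma measurable_point_sum n f : (forall s xi, 0 <= f s xi) ->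
  seq_measurable n.+1 f -> seq_measurable n (point_sum f).
Proof.
move=> f0 mf; rewrite /seq_measurable /point_sum.
pose F (q : (n.-tuple T * conf) * T) := f (q.2 :: q.1.1) (remove_point q.2 q.1.2).
apply: (@measurable_integral_pts _ _ _ _ snd F) => //; last by move=> z; exact: f0.
apply: seq_measurable_cons => //; first exact: measurableT_comp.
by apply: measurable_fun_remove_point => //; exact: measurableT_comp.
Qed.

Section mean.
Context (dO : measure_display) (Omega : measurableType dO).
Variables (P : probability Omega R) (nu : {sigma_finite_measure set T -> \bar R}).
Variable eta : Omega -> conf.
Hypothesis eta_poisson : poisson_process P nu eta.
Hypothesis nu_lf : forall B : set T, measurable B -> bounded_set B -> nu B < +oo.

Let meta := poisson_measurable eta_poisson.

Lemma seq_measurable_eta n f : seq_measurable n f ->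
  measurable_fun setT (fun q : n.-tuple T * Omega => f q.1 (eta q.2)).
Proof.
move=> mf.
have mp : measurable_fun setT (fun q : n.-tuple T * Omega => (q.1, eta q.2)).
  by apply: measurable_fun_pair => //; exact: measurableT_comp.
exact: (measurableT_comp mf mp).
Qed.

Lemma measurable_mean n f : (forall s xi, 0 <= f s xi) -> seq_measurable n f ->
  measurable_fun setT (fun s : n.-tuple T => \int[P]_w f s (eta w)).
Proof.
move=> f0 mf; pose g (q : n.-tuple T * Omega) := f q.1 (eta q.2).
apply: (@measurable_fun_fubini_tonelli_F _ _ _ _ _ P g).
- exact: seq_measurable_eta.
- by move=> q; exact: f0.
Qed.

Let mean_point_sum n f : (forall s xi, 0 <= f s xi) -> seq_measurable n.+1 f ->
  \int[tuple_measure nu n]_s \int[P]_w point_sum f s (eta w) =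
  \int[tuple_measure nu n.+1]_s \int[P]_w f s (eta w).
Proof.
move=> f0 mf.
have mG := measurable_mean f0 mf.
rewrite [RHS]/= /tuple_step ge0_integral_pushforward//; last first.
  by move=> s _; exact: integral_ge0.
rewrite preimage_setT fubini_tonelli2//; last 2 first.
- apply: (measurableT_comp mG); exact: measurable_tcons.
- by move=> z /=; exact: integral_ge0.
apply: eq_integral => s _; rewrite /fubini_G /=.
have mF : measurable_fun setT (fun z : T * conf => f (z.1 :: s) z.2).
  exact: seq_measurable_cons.
exact: (mecke eta_poisson nu_lf mF).
Qed.

(** The multivariate Mecke formula. Each [point_sum] deletes the point it selects, which is the form
    [mecke] requires, so one sum is traded for one integral against [nu] at each step. *)
Lemma mean_iter_point_sum k f : (forall s xi, 0 <= f s xi) -> seq_measurable k f ->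
  \int[P]_w iter k point_sum f [::] (eta w) =
  \int[tuple_measure nu k]_s \int[P]_w f s (eta w).
Proof.
elim: k f => [|k IH] f f0 mf.
  rewrite /= integral_dirac//.
    by rewrite diracT mul1e.
  exact: measurable_mean.
rewrite iterSr IH//; last exact: measurable_point_sum.
  exact: mean_point_sum.
exact: point_sum_ge0.
Qed.

End mean.

Definition remove_seq u xi : conf := inter_conf [set x | x \notin u] xi.

Lemma remove_seq_nil xi : remove_seq [::] xi = xi.
Proof.
by apply: conf_inj; apply/seteqP; split=> [x []|x] //= xix; split.
Qed.

Lemma remove_seq_cons x u xi :
  remove_point x (remove_seq u xi) = remove_seq (x :: u) xi.
Proof.
apply: conf_inj; apply/seteqP; split=> y /=.
  by move=> [[xiy yu] /eqP yx]; split=> //; rewrite in_cons negb_or yx.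
by rewrite in_cons negb_or => -[xiy /andP[/eqP yx yu]].
Qed.

Definition injections k xi : set (seq T) :=
  [set u | [/\ size u = k, uniq u & forall x, x \in u -> points xi x]].

(** A selected point is removed before the next selection, so exactly the lists without repetition
    arise, the latest point coming first. *)
Lemma iter_point_sumE k f s xi : (forall s xi, 0 <= f s xi) ->
  (forall n, seq_measurable n f) ->
  iter k point_sum f s xi =
  \esum_(u in injections k xi) f (u ++ s) (remove_seq u xi).
Proof.
elim: k f => [|k IH] f f0 mf.
  rewrite (_ : injections 0 xi = [set [::]]).
    by rewrite esum_set1//= remove_seq_nil.
  by apply/seteqP; split=> [u [/size0nil ->]|_ ->].
rewrite iterSr IH//; last 2 first.
- exact: point_sum_ge0.
- by move=> n; exact: measurable_point_sum.
transitivity (\esum_(u in injections k xi) \esum_(x in points (remove_seq u xi))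
    f (x :: u ++ s) (remove_seq (x :: u) xi)).
  apply: eq_esum => u _; rewrite /point_sum integral_pts//; last first.
    apply: (@seq_measurable_cons (size (u ++ s)) f _ _ id (cst (in_tuple (u ++ s)))) => //.
    exact: measurable_fun_remove_point.
  by apply: eq_esum => x _; rewrite remove_seq_cons.
rewrite esum_esum//.
rewrite (@reindex_esum _ _ _ (injections k xi `*`` (fun u => points (remove_seq u xi)))
  (injections k.+1 xi) (fun p => p.2 :: p.1))//.
split.
- move=> [u x] /= [[su uu uxi] [xix xu]]; split=> /=; rewrite ?su ?uu ?andbT//.
  by move=> y; rewrite in_cons => /orP[/eqP ->|/uxi].
- by move=> [u x] [v y] _ _ /= [-> ->].
- move=> [|x u] [//= [su] /andP[xu uu] uxi]; exists (u, x) => //=; split.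
    by split=> // y yu; apply: uxi; rewrite in_cons yu orbT.
  by split=> //; apply: uxi; rewrite mem_head.
Qed.

End point_sum.

(** * Isolated tuples, cells and colours *)

Section admissible.
Context (R : realType) (d : nat).
Local Notation T := 'rV[R]_d.
Local Notation conf := (conf R d).
Variables (S : set T) (k : nat) (A : set conf).
Implicit Types (xi : conf) (s u : seq T) (r : R).

Lemma dilateE r (X : set T) x : 0 < r -> dilate r X x = X (r^-1 *: x).
Proof.
move=> r0; apply/propext; split=> [[y Xy <-]|Xx].
  by rewrite scalerA mulVf ?gt_eqF// scale1r.
by exists (r^-1 *: x) => //; rewrite scalerA divff ?gt_eqF// scale1r.
Qed.

Lemma dilate_confE r xi : 0 < r ->
  (dilate_conf r @` A) xi = A (dilate_conf r^-1 xi).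
Proof.
move=> r0; have V (a b : R) (eta : conf) : a * b = 1 -> dilate_conf a (dilate_conf b eta) = eta.
  move=> ab; apply: conf_inj; apply/seteqP; split=> x /=.
    by move=> [_ [y yb <-] <-]; rewrite scalerA ab scale1r.
  by move=> xb; exists (b *: x); [exists x|rewrite scalerA ab scale1r].
apply/propext; split=> [[eta Aeta <-]|Axi].
  by rewrite V// mulVf ?gt_eqF.
by exists (dilate_conf r^-1 xi) => //; rewrite V// divff ?gt_eqF.
Qed.

Definition connected_seq r u : Prop :=
  graph_connected (difference_graph (dilate r S) [set` u]).

Definition separated_from r u xi : Prop :=
  forall x z, x \in u -> points xi z -> ~ dilate r S (x - z).

Definition admissible r u : Prop :=
  (dilate_conf r @` A) (conf_of_seq u) /\ connected_seq r u.

Definition isolated_in r u xi : Prop := admissible r u /\ separated_from r u xi.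

Definition isolated_injections r xi : set (seq T) :=
  [set u | injections k xi u /\ isolated_in r u (remove_seq u xi)].

Definition is_component r xi (x : conf) : Prop :=
  [/\ x `<=` points xi, (x #= `I_k)%card, (dilate_conf r @` A) x &
    Defs.connected_component (difference_graph (dilate r S) x)
                        (difference_graph (dilate r S) xi)].

Lemma card_eq_seq u (X : set T) : uniq u -> X = [set` u] ->
  (X #= `I_k)%card <-> size u = k.
Proof.
move=> uu ->; have -> : [set` u] = [set` [fset y in u]%fset].
  by apply/seteqP; split=> y /=; rewrite inE.
split=> [/card_eq_fsetP|<-]; rewrite ?card_fseq ?undup_id//.
by apply/card_eq_fsetP; rewrite card_fseq undup_id.
Qed.

Lemma is_component_seq r xi u : (0 < k)%N ->
  isolated_injections r xi u -> is_component r xi (conf_of_seq u).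
Proof.
move=> k0 [[su uu uxi] [[Au cu] sep]]; split=> //.
- by apply/(card_eq_seq uu).
- split=> //=.
  + by case: u su {uu uxi Au cu sep} => [k0'|x u _]; [move: k0; rewrite -k0'|exists x; rewrite /= mem_head].
  + split=> //= x y xu yu; split=> -[_ _ xy Sxy]; split=> //; exact: uxi.
  + move=> x y xu yxi yu [_ _ _ Sxy]; apply: sep Sxy => //=.
    by split=> //; apply/negP.
Qed.

Lemma seq_is_component r xi x u : is_component r xi x -> uniq u ->
  points x = [set` u] -> isolated_injections r xi u.
Proof.
move=> [xxi cx Ax [_ conn ind sep]] uu xu.
have xE : x = conf_of_seq u by apply: conf_inj.
split; first split=> //.
- exact/(card_eq_seq uu xu).
- by move=> y yu; apply: xxi; rewrite xu.
split; first split.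
- by rewrite -xE.
- by move: conn; rewrite xu.
move=> y z yu [zxi zu] Syz.
have yx : points x y by rewrite xu.
have zx : ~ points x z by rewrite xu; exact/negP.
apply: (sep y z yx zxi zx); split=> //; first exact: xxi.
by move=> yz; apply: zx; rewrite -yz.
Qed.

(** Each component is listed by exactly its [k!] permutations, so pairs of a component and an
    ordering of it reindex the lists. Positivity of [k] rules out the empty list, since components
    are non-empty. *)
Lemma counting_isolated_injections r xi : (0 < k)%N ->
  counting (isolated_injections r xi) =
  ((k`!%:R)%:E * component_count k S A r xi)%E :> \bar R.
Proof.
move=> k0; pose C : set conf := is_component r xi.
pose F (x : conf) : set (seq T) := [set u | uniq u /\ points x = [set` u]].
have cF x : C x -> counting (F x) = (k`!%:R)%:E :> \bar R.
  move=> Cx; have [_ cx _ _] := Cx.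
  have /finite_seqP[v xv] : finite_set (points x) by exists k.
  pose u := undup v.
  have uu : uniq u by exact: undup_uniq.
  have xu : points x = [set` u].
    by rewrite xv; apply/seteqP; split=> y /=; rewrite mem_undup.
  have su : size u = k by apply/(card_eq_seq uu xu).
  rewrite (_ : F x = [set` permutations u]).
    rewrite /counting asboolT; last exact: finite_seq.
    rewrite (_ : fset_set _ = [fset w in permutations u]%fset).
      by rewrite card_fseq undup_id ?permutations_uniq// size_permutations// su.
    apply/fsetP => w; rewrite in_fset_set; last exact: finite_seq.
    by rewrite inE/=; apply/idP/idP => [/set_mem|/mem_set].
  apply/seteqP; split=> w /=.
    rewrite mem_permutations => -[uw xw]; apply: uniq_perm => // y.
    have : is_true (y \in w) = is_true (y \in u) by rewrite -[LHS]/([set` w] y) -xw xu.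
    by move=> e; apply/idP/idP; rewrite e.
  rewrite mem_permutations => wu; split; first by rewrite (perm_uniq wu).
  by rewrite xu; apply/seteqP; split=> y /=; rewrite (perm_mem wu).
transitivity (\esum_(x in C) \esum_(u in F x) (1%E : \bar R)).
  rewrite esum_esum; last by move=> *; exact: lee01.
  rewrite counting_esum; symmetry.
  rewrite (@reindex_esum _ _ _ (isolated_injections r xi) (C `*`` F)
    (fun u => (conf_of_seq u, u)))//; split.
  - move=> u Iu; split; first exact: is_component_seq.
    by have [[_ uu _] _] := Iu; split.
  - by move=> u v _ _ [].
  - move=> [x u] [/= Cx [uu xu]]; exists u; first exact: (seq_is_component Cx).
    by congr pair; apply: conf_inj.
transitivity (\esum_(x in C) \sum_(j < k`!) (1%E : \bar R)).
  apply: eq_esum => x Cx; rewrite -counting_esum (cF _ Cx).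
  by rewrite sumEFin sumr_const card_ord.
rewrite esum_sum//.
by rewrite -counting_esum sumr_const card_ord mule_natl.
Qed.

End admissible.

Section admissible_measurable.
Context (R : realType) (d : nat).
Local Notation T := 'rV[R]_d.
Local Notation conf := (conf R d).
Variables (S : set T) (k : nat) (A : set conf).
Hypotheses (mS : measurable S) (mA : measurable A) (S0 : S 0).
Implicit Types (xi : conf) (s u : seq T) (r : R).

Lemma measurable_conf_of_seq n :
  measurable_fun setT (fun s : n.-tuple T => conf_of_seq s : conf).
Proof.
apply: measurable_conf_voidP => B mB.
rewrite (_ : [set _ | _] = \bigcap_(i in [set: 'I_n])
    ((fun s : n.-tuple T => tnth s i) @^-1` (~` B))).
  apply: fin_bigcap_measurable => // i _.
  rewrite -[X in measurable X]setTI; apply: measurable_tnth => //.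
  exact: measurableC.
apply/seteqP; split=> s /= h.
  move=> i _ /= Bi; suff : set0 (tnth s i) by [].
  by rewrite -h; split=> //=; exact: mem_tnth.
by apply/seteqP; split=> // x [/= /tnthP[i ->] Bi]; apply: (h i).
Qed.

Lemma measurable_dilate_conf r : measurable_fun setT (@dilate_conf R d r).
Proof.
apply: measurable_conf_voidP => B mB.
rewrite (_ : [set _ | _] = void_event ((fun x : T => r *: x) @^-1` B)).
  apply: measurable_void_event; rewrite -[X in measurable X]setTI.
  by apply: measurable_fun_rVZ.
apply/seteqP; split=> xi /= h; apply/seteqP; split=> // x.
  move=> [xix Bx]; suff : set0 (r *: x) by [].
  by rewrite -h; split=> //; exists x.
by move=> [[y xiy <-] By]; suff : set0 y by []; rewrite -h.
Qed.

Lemma measurable_dilate r : 0 < r -> measurable (dilate r S).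
Proof.
move=> r0; rewrite (_ : dilate r S = (fun x : T => r^-1 *: x) @^-1` S).
  by rewrite -[X in measurable X]setTI; apply: measurable_fun_rVZ.
by apply/funext => x; rewrite dilateE.
Qed.

Definition adj r n (s : n.-tuple T) (i j : 'I_n) : bool :=
  `[< dilate r S (tnth s i - tnth s j) >].

(** Passing to indices turns paths among points into paths of a Boolean relation on a finite type.
    Because of [S 0], equal entries of a tuple are adjacent, so repetitions do no harm. *)
Lemma connected_seqP r n (s : n.-tuple T) : 0 < r ->
  connected_seq S r s <-> forall i j, connect (adj r s) i j.
Proof.
move=> r0; have dS0 : dilate r S 0 by rewrite dilateE// scaler0.
split=> [conn i j|conn x y /= /tnthP[i ->] /tnthP[j ->]].
  suff H x y : clos_refl_trans T (edge (difference_graph (dilate r S) [set` s])) x y ->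
      x \in s -> y \in s /\ forall i j, x = tnth s i -> y = tnth s j -> connect (adj r s) i j.
    have [|] := H (tnth s i) (tnth s j) _ (mem_tnth _ _); last by move=> _; apply.
    by apply: conn; exact: mem_tnth.
  elim=> {x y}[x y [/= xs ys _ Sxy] _|x xs|x y z _ IH1 _ IH2 xs].
  - by split=> // i' j' xi yj; apply: connect1; apply/asboolP; rewrite -xi -yj.
  - split=> // i' j' xi xj; apply: connect1; apply/asboolP.
    by rewrite -xi -xj subrr.
  - have [ys H1] := IH1 xs; have [zs H2] := IH2 ys; split=> // i' j' xi zj.
    have /tnthP[l yl] := ys.
    exact: connect_trans (H1 _ _ xi yl) (H2 _ _ yl zj).
have /connectP[p] := conn i j; elim: p i => [|l p IH] i /= => [_ ->|/andP[il lp] jl].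
  exact: rt_refl.
apply: rt_trans (IH _ lp jl); have [->|il'] := pselect (tnth s i = tnth s l).
  exact: rt_refl.
by apply: rt_step; split=> //; [exact: mem_tnth|exact: mem_tnth|apply/asboolP].
Qed.

(** A path can be shortened so that it repeats no index; it then has at most [n] steps, each
    changing a coordinate by at most [r * th]. *)
Lemma connected_seq_bounded r n (s : n.-tuple T) (th : R) : 0 < r -> 0 <= th ->
  (forall y, S y -> forall j, `|y 0 j| <= th) -> connected_seq S r s ->
  forall x y, x \in s -> y \in s -> forall j, `|x 0 j - y 0 j| <= n%:R * (r * th).
Proof.
move=> r0 th0 Sth /(connected_seqP s r0) conn x y /tnthP[a ->] /tnthP[b ->] j.
have /connectP[p ap bp] := conn a b.
case/shortenP: ap bp => p' ap' up' _ bp'.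
have pn : (size p' <= n)%N.
  by have := max_card [in a :: p']; rewrite (card_uniqP up') card_ord; exact: ltnW.
apply: (@le_trans _ _ ((size p')%:R * (r * th))); last first.
  by rewrite ler_wpM2r ?ler_nat// mulr_ge0// ltW.
rewrite {b}bp' {up' pn conn}; elim: p' a ap' => [|c p' IH] a /=.
  by rewrite subrr normr0 mul0r.
move=> /andP[/asboolP ac cp'].
rewrite -[tnth s a 0 j - _](subrKA (tnth s c 0 j)) (le_trans (ler_normD _ _))//.
rewrite -natr1 mulrDl mul1r addrC lerD//; first exact: IH.
move: ac; rewrite dilateE// => /Sth/(_ j); rewrite !mxE normrM.
rewrite (@ger0_norm _ r^-1); last by rewrite invr_ge0 ltW.
by rewrite mulrC ler_pdivrMr// mulrC.
Qed.

(** Connectedness depends only on the adjacency matrix. There are finitely many matrices [b], and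
    having a given one is a finite conjunction of measurable conditions. *)
Lemma measurable_connected_seq r n : 0 < r ->
  measurable [set s : n.-tuple T | connected_seq S r s].
Proof.
move=> r0.
rewrite (_ : [set _ | _] = \bigcup_(b in [set b : {ffun 'I_n * 'I_n -> bool} |
     forall i j, connect (fun i j => b (i, j)) i j])
   \bigcap_(p in [set: 'I_n * 'I_n]) [set s : n.-tuple T | adj r s p.1 p.2 = b p]).
  apply: fin_bigcup_measurable => // b _; apply: fin_bigcap_measurable => // p _.
  have mp : measurable [set s : n.-tuple T | dilate r S (tnth s p.1 - tnth s p.2)].
    rewrite -[X in measurable X]setTI; apply: measurable_fun_rVB => //.
    - exact: measurable_tnth.
    - exact: measurable_tnth.
    - exact: measurable_dilate.
  case: (b p).
    rewrite (_ : [set _ | _] = [set s : n.-tuple T | dilate r S (tnth s p.1 - tnth s p.2)])//.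
    by apply/seteqP; split=> s /= /asboolP.
  rewrite (_ : [set _ | _] = ~` [set s : n.-tuple T | dilate r S (tnth s p.1 - tnth s p.2)]).
    exact: measurableC.
  by apply/seteqP; split=> s /=; rewrite /adj; [move/negbT/asboolPn|move=> h; apply/negbTE/asboolPn].
apply/seteqP; split=> s /=.
  move/(connected_seqP s r0) => conn; exists [ffun p => adj r s p.1 p.2].
    move=> /= i j; rewrite (@eq_connect _ _ (adj r s))// => a b.
    by rewrite ffunE.
  by move=> p _ /=; rewrite ffunE.
move=> [b conn sb]; apply/(connected_seqP s r0) => i j.
rewrite (@eq_connect _ _ (fun i j => b (i, j)))// => a c.
exact: (sb (a, c)).
Qed.

Lemma measurable_admissible r n : 0 < r ->
  measurable [set s : n.-tuple T | admissible S A r s].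
Proof.
move=> r0; apply: measurableI; last exact: measurable_connected_seq.
rewrite (_ : (fun s : n.-tuple T => _) =
    (fun s : n.-tuple T => dilate_conf r^-1 (conf_of_seq s)) @^-1` A).
  rewrite -[X in measurable X]setTI.
  exact: (measurableT_comp (measurable_dilate_conf r^-1) (@measurable_conf_of_seq n)).
by apply/funext => s; rewrite dilate_confE.
Qed.

(** As for [remove_point], the condition on all points of the configuration is rewritten as the
    vanishing of an integral against [pts]. *)
Lemma measurable_separated_from r n : 0 < r ->
  measurable [set p : n.-tuple T * conf | separated_from S r p.1 p.2].
Proof.
move=> r0.
pose E := [set q : (n.-tuple T * conf) * T | exists i, dilate r S (tnth q.1.1 i - q.2)].
have mE : measurable E.
  rewrite (_ : E = \bigcup_(i in [set: 'I_n])
    [set q : (n.-tuple T * conf) * T | dilate r S (tnth q.1.1 i - q.2)]).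
    apply: fin_bigcup_measurable => // i _.
    rewrite -[X in measurable X]setTI; apply: measurable_fun_rVB => //.
    - apply: (measurableT_comp (measurable_tnth i)); exact: measurableT_comp.
    - exact: measurable_dilate.
  by apply/seteqP; split=> q [i]; exists i.
pose f q : \bar R := (\1_E q)%:E.
have mf : measurable_fun setT f by exact/measurable_EFinP/measurable_indic.
have f0 q : (0 <= f q)%E by rewrite lee_fin.
rewrite (_ : [set _ | _] = [set p | \int[pts p.2]_x f (p, x) = 0]%E).
  rewrite -[X in measurable X]setTI.
  have := @measurable_integral_pts R d _ _ snd f measurable_snd mf f0.
  by move=> /(_ measurableT _ (emeasurable_set1 0%E)).
apply/seteqP; split=> -[s xi] /=; (rewrite integral_pts//; last
    exact: (measurableT_comp mf (pair1_measurable _))).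
  move=> v; apply: esum1 => y xiy; rewrite /f indicE.
  rewrite (_ : (_ \in _) = false)//; apply/negbTE/negP => /set_mem [/= i].
  by apply: v => //; exact: mem_tnth.
move=> h0 x z /= /tnthP[i ->] xiz Siz.
have : (f ((s, xi), z) <= \esum_(z in points xi) f (s, xi, z))%E.
  apply: esum_ge; exists [set z]; last by rewrite fsbig_set1.
  by split=> // _ ->.
by rewrite h0 /f indicE mem_set ?lee_fin ?ler10//; exists i.
Qed.

Lemma measurable_isolated_in r n : 0 < r ->
  measurable [set p : n.-tuple T * conf | isolated_in S A r p.1 p.2].
Proof.
move=> r0; apply: measurableI; last exact: measurable_separated_from.
rewrite -[X in measurable X]setTI.
have madm := @measurable_admissible r n r0.
exact: (@measurable_fst _ _ (n.-tuple T) conf measurableT _ madm).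
Qed.

End admissible_measurable.

Section cells.
Context (R : realType) (d : nat).
Local Notation T := 'rV[R]_d.
Local Notation conf := (conf R d).
Variables (S : set T) (k : nat) (A : set conf) (theta : R).
Hypotheses (d_gt0 : (0 < d)%N) (k_gt0 : (0 < k)%N).
Hypotheses (mS : measurable S) (mA : measurable A).
Hypotheses (ball_S : eball 0 1 `<=` S) (S_ball : S `<=` eball 0 theta).
Hypothesis theta_ge0 : 0 <= theta.
Implicit Types (xi : conf) (s u : seq T) (r : R) (i : nat) (z : 'rV[int]_d).

Lemma coord_le_enorm (x : T) j : `|x 0 j| <= enorm x.
Proof.
rewrite -sqrtr_sqr /enorm ler_wsqrtr// (bigD1 j)//= lerDl sumr_ge0// => i _.
exact: sqr_ge0.
Qed.

(** The constant [d] instead of its square root keeps the estimate elementary. It is the reason why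
    the cells below have side [r / d]. *)
Lemma enorm_le (x : T) (h : R) : 0 <= h -> (forall j, `|x 0 j| <= h) ->
  enorm x <= d%:R * h.
Proof.
move=> h0 xh; have dh0 : 0 <= d%:R * h by rewrite mulr_ge0.
rewrite /enorm -(ger0_norm dh0) -sqrtr_sqr ler_wsqrtr//.
apply: (@le_trans _ _ (\sum_(i < d) h ^+ 2)).
  apply: ler_sum => i _; rewrite -[leLHS]real_normK ?num_real//.
  by rewrite lerXn2r ?nnegrE.
rewrite sumr_const card_ord exprMn -[leLHS]mulr_natl.
by apply: ler_wpM2r; rewrite ?sqr_ge0// expr2 -natrM ler_nat leq_pmull.
Qed.

Lemma S_zero : S 0.
Proof.
apply: ball_S; rewrite /eball/= subr0.
by rewrite (le_trans (@enorm_le 0 0 _ _)) ?mulr0// => j; rewrite mxE normr0.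
Qed.

Lemma S_bounded (y : T) : S y -> forall j, `|y 0 j| <= theta.
Proof.
by move=> /S_ball; rewrite /eball/= subr0 => yth j; exact: le_trans (coord_le_enorm _ _) yth.
Qed.

Let hh r := r / d%:R.
Let hh_gt0 r : 0 < r -> 0 < hh r.
Proof. by move=> r0; rewrite divr_gt0// ltr0n. Qed.

Lemma gcell_adjacent r i (x y : T) : 0 < r ->
  gcell (hh r) i x -> gcell (hh r) i y -> dilate r S (x - y).
Proof.
move=> r0 xi yi; rewrite dilateE//; apply: ball_S; rewrite /eball/= subr0.
rewrite (le_trans (@enorm_le _ (d%:R^-1) _ _))//.
  move=> j; have := gcell_close (hh_gt0 r0) xi yi j; rewrite !mxE normrM.
  rewrite (@ger0_norm _ r^-1) ?invr_ge0 ?(ltW r0)// => /ltW xy.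
  by rewrite mulrC ler_pdivrMr// mulrC.
by rewrite divff// pnatr_eq0 -lt0n.
Qed.

Definition cell_injections r i xi : set (seq T) :=
  [set u | isolated_injections S k A r xi u /\ gcell (hh r) i (head 0 u)].

(* Two points in a common cell of side [r / d] are adjacent, so all tuples counted
   here list the same component. *)
Lemma counting_cell_injections r i xi : 0 < r ->
  (counting (cell_injections r i xi) <= (k`!%:R)%:E :> \bar R)%E.
Proof.
move=> r0; have [->|/set0P[v [[[sv uv vxi] [[_ cv] sepv]] vi]]] := eqVneq (cell_injections r i xi) set0.
  by rewrite counting_set0 lee_fin.
have headP u : size u = k -> head 0 u \in u.
  by case: u => [|x u] /= su; [move: k_gt0; rewrite -su|rewrite mem_head].
apply: (@le_trans _ _ (counting [set` permutations v])); last first.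
  rewrite /counting asboolT; last exact: finite_seq.
  rewrite (_ : fset_set _ = [fset w in permutations v]%fset).
    by rewrite card_fseq undup_id ?permutations_uniq// size_permutations// sv.
  apply/fsetP => w; rewrite in_fset_set; last exact: finite_seq.
  by rewrite inE/=; apply/idP/idP => [/set_mem|/mem_set].
apply: le_counting => u [[[su uu uxi] [[_ cu] _]] ui] /=.
have huv : head 0 u \in v.
  apply: contrapT => /negP huv.
  apply: (sepv (head 0 v) (head 0 u)); first exact: headP.
    by split=> //; apply: uxi; exact: headP.
  exact: gcell_adjacent vi ui.
suff uv' : {subset u <= v}.
  rewrite mem_permutations; apply: uniq_perm => // x.
  have svu : (size v <= size u)%N by rewrite su sv.
  by have [_ ->] := uniq_min_size uu uv' svu.
(* A path in [u] that starts in [v] stays in [v]: its first point outside would be adjacent to a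
   point of [v], against the isolation of [v]. *)
move=> x xu; have := cu (head 0 u) x (headP _ su) xu.
move=> cl; move: cl huv; elim=> {x xu}[a b [/= au bu ab Sab] av|a //|a b c _ IH1 _ IH2 av].
  apply: contrapT => /negP bv; apply: (sepv a b av _ Sab).
  by split=> //; exact: uxi.
by apply: IH2; apply: IH1.
Qed.

Lemma counting_isolated_cells r xi : 0 < r ->
  counting (isolated_injections S k A r xi) =
  (\sum_(i <oo) counting (cell_injections r i xi))%E :> \bar R.
Proof.
move=> r0; rewrite nneseries_esumT; last by move=> i; exact: counting_ge0.
rewrite counting_esum.
have -> : isolated_injections S k A r xi = \bigcup_i cell_injections r i xi.
  apply/seteqP; split=> [u Iu|u [i _ []]//].
  by exists (pickle (gindex (hh r) (head 0 u))).
rewrite esum_bigcupT//; first by apply: eq_esum => i _; rewrite counting_esum.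
by move=> i j _ _ [u [[_ <-] [_ <-]]].
Qed.

(** A list reaches at most [k * r * theta] from its head, and a point spoiling its isolation at most
    [r * theta] further. In units of the side [r / d] this is [(k + 1) * theta * d]. One unit is
    added because truncation rounds down, another because floors may differ by one more than their
    arguments. *)
Let reach : int := Posz (Num.truncn ((k.+1)%:R * theta * d%:R)).+2.

Definition halo r i : set T :=
  [set y | exists2 z : 'rV[int]_d, pickle z = i &
    forall j, `|gindex (hh r) y 0 j - z 0 j| <= reach].

Lemma measurable_halo r i : 0 < r -> measurable (halo r i).
Proof.
move=> r0; rewrite (_ : halo r i = \bigcup_(l in [set l | exists z z' : 'rV[int]_d,
    [/\ pickle z = i, pickle z' = l & forall j, `|z' 0 j - z 0 j| <= reach]]) gcell (hh r) l).
  by apply: bigcup_measurable => l _; apply: measurable_gcell; exact: hh_gt0.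
apply/seteqP; split=> y.
  by move=> [z zi zy]; exists (pickle (gindex (hh r) y)) => //; exists z, (gindex (hh r) y).
move=> [l [z [z' [zi zl zz]]] yl]; exists z => // j.
by have -> : gindex (hh r) y = z' by apply: (pcan_inj pickleK); rewrite zl.
Qed.

Lemma halo_close r i (x y : T) : 0 < r -> gcell (hh r) i x ->
  (forall j, `|x 0 j - y 0 j| <= (k.+1)%:R * (r * theta)) -> halo r i y.
Proof.
move=> r0 xi xy; exists (gindex (hh r) x) => // j; rewrite !mxE.
have h0 := hh_gt0 r0.
set a := x 0 j / hh r; set b := y 0 j / hh r.
have ab : `|a - b| <= (k.+1)%:R * theta * d%:R.
  rewrite /a /b -mulrBl normrM (@ger0_norm _ (hh r)^-1) ?invr_ge0 ?(ltW h0)//.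
  rewrite ler_pdivrMr// (le_trans (xy j))// /hh.
  have d0 : d%:R != 0 :> R by rewrite pnatr_eq0 -lt0n.
  by rewrite le_eqVlt; apply/orP; left; apply/eqP; field.
have /andP[a1 a2] := floor_itv a; have /andP[b1 b2] := floor_itv b.
have t1 := truncnS_gt ((k.+1)%:R * theta * d%:R).
rewrite -(ler_int R) intr_norm intrB /reach.
have -> : ((Posz (Num.truncn ((k.+1)%:R * theta * d%:R)).+2)%:~R : R) =
    (Num.truncn ((k.+1)%:R * theta * d%:R)).+1%:R + 1 by rewrite natr1.
rewrite intrD in a2; rewrite intrD in b2.
move: ab; rewrite !ler_norml => /andP[ab1 ab2]; apply/andP; split; lra.
Qed.

(** Both the points of a list and the points that could destroy its isolation lie in the halo of the
    cell of its head, by the choice of [reach]. This makes cell contributions functions of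
    windows. *)
Lemma cell_injections_halo r i xi : 0 < r ->
  cell_injections r i (inter_conf (halo r i) xi) = cell_injections r i xi.
Proof.
move=> r0.
have rth : 0 <= r * theta by rewrite mulr_ge0// ltW.
have close_head u x : size u = k -> connected_seq S r u -> gcell (hh r) i (head 0 u) ->
    x \in u -> forall j, `|head 0 u 0 j - x 0 j| <= k%:R * (r * theta).
  move=> su cu ui xu j; rewrite -su.
  apply: (@connected_seq_bounded _ _ S S_zero r _ (in_tuple u)) => //.
    exact: S_bounded.
  by case: u su {cu ui xu} => [|a u] /= su; [move: k_gt0; rewrite -su|rewrite mem_head].
apply/seteqP; split=> u [[[su uu uxi] [[Au cu] sep]] ui]; split=> //; split=> //.
- by split=> // x /uxi[].
- split=> // x z xu [zxi zu] Sxz; apply: (sep x z xu _ Sxz).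
  split=> //; split=> //; apply: (halo_close r0 ui) => j.
  rewrite -[_ - z 0 j](subrKA (x 0 j)) (le_trans (ler_normD _ _))//.
  rewrite -natr1 mulrDl mul1r; apply: lerD; first exact: (close_head _ _ su cu ui xu).
  move: Sxz; rewrite dilateE// => /S_bounded/(_ j); rewrite !mxE normrM.
  rewrite (@ger0_norm _ r^-1) ?invr_ge0 ?(ltW r0)//.
  by rewrite mulrC ler_pdivrMr// mulrC.
- split=> // x xu; split; first exact: uxi.
  apply: (halo_close r0 ui) => j; rewrite (le_trans (close_head _ _ su cu ui xu j))//.
  by rewrite ler_wpM2r// ler_nat.
- by split=> // x z xu [[zxi _] zu]; apply: sep.
Qed.

(** Cells with intersecting halos have indices differing by at most [2 * reach] in every coordinate,
    so residues modulo [period.+1] tell them apart. Numbers that code no cell have an empty halo,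
    and their colour is immaterial. *)
Definition period : nat := absz (reach + reach).

Definition colour i : {ffun 'I_d -> 'I_period.+1} :=
  if (unpickle i : option 'rV[int]_d) is Some z
  then [ffun j => inord (absz (modz (z 0 j) (Posz period.+1)))]
  else [ffun=> ord0].

Lemma halo_disjoint r i j : colour i = colour j -> i != j ->
  halo r i `&` halo r j = set0.
Proof.
move=> cij ij; apply/seteqP; split=> // y [[z zi zy] [z' zj zy']].
case/eqP: ij; rewrite -zi -zj; congr pickle; apply/rowP => l.
have L0 : (Posz period.+1) != 0 by [].
have zz : modz (z 0 l) (Posz period.+1) = modz (z' 0 l) (Posz period.+1).
  move: cij; rewrite -zi -zj /colour !pickleK => /ffunP/(_ l); rewrite !ffunE.
  have lt0 (a : int) : (absz (modz a (Posz period.+1)) < period.+1)%N.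
    have := ltz_pmod a (isT : 0 < Posz period.+1).
    by have := modz_ge0 a L0; lia.
  move=> /(congr1 val); rewrite /= !inordK//.
  by have := modz_ge0 (z 0 l) L0; have := modz_ge0 (z' 0 l) L0; lia.
have zE := divz_eq (z 0 l) (Posz period.+1).
have zE' := divz_eq (z' 0 l) (Posz period.+1).
have := zy l; have := zy' l; move: zE zE' zz; rewrite /period /reach.
set N := Num.truncn _; set q := divz _ _; set q' := divz _ _.
set a := modz _ _; set a' := modz _ _; set g := gindex _ _ _ _.
have -> : Posz `|Posz N.+2 + Posz N.+2|.+1 = 2 * Posz N + 5 by lia.
(* The two coordinates have equal remainders and differ by less than the modulus, so their quotients
   agree. *)
move=> -> -> -> h1 h2; have : q = q' by nia.
by move=> ->.
Qed.

End cells.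

Section indic.
Context (R : pzRingType) (X Y Z : Type).

Lemma eq_indicP (A : set X) (B : set Y) x y : (A x <-> B y) ->
  \1_A x = \1_B y :> R.
Proof.
move=> AB; rewrite !indicE; suff -> : (x \in A) = (y \in B) by [].
by apply/idP/idP => /set_mem/AB /mem_set.
Qed.

Lemma indic_mulP (A : set X) (B : set Y) (C : set Z) x y z :
  (C z <-> A x /\ B y) -> \1_C z = \1_A x * \1_B y :> R.
Proof.
move=> CAB; rewrite !indicE -natrM mulnb.
suff -> : (z \in C) = (x \in A) && (y \in B) by [].
apply/idP/andP => [/set_mem/CAB[Ax By]|[/set_mem Ax /set_mem By]].
  by split; apply/mem_set.
by apply/mem_set/CAB.
Qed.

End indic.

(** * The mean number of isolated lists *)

Section mean_count.
Context (R : realType) (d : nat).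
Local Notation T := 'rV[R]_d.
Local Notation conf := (conf R d).
Variables (S : set T) (k : nat) (A : set conf) (theta : R).
Hypotheses (mS : measurable S) (mA : measurable A) (S0 : S 0).
Hypothesis S_bdd : forall y, S y -> forall j, `|y 0 j| <= theta.
Implicit Types (xi : conf) (s u : seq T) (r : R) (Q : set T).

(** The constraint [Q] on the head serves two purposes: the whole space gives the mean of all
    isolated lists, a cell gives measurability of the contribution of that cell. *)
Definition isolated_weight Q r u xi : \bar R :=
  (\1_[set v | isolated_in S A r v xi /\ Q (head 0 v)] u)%:E.

Lemma isolated_weight_ge0 Q r u xi : (0 <= isolated_weight Q r u xi)%E.
Proof. by rewrite lee_fin. Qed.

Lemma measurable_isolated_weight Q r n : 0 < r -> measurable Q ->
  seq_measurable n (isolated_weight Q r).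
Proof.
move=> r0 mQ; pose E := [set p : n.-tuple T * conf | isolated_in S A r p.1 p.2 /\
  Q (head 0 (p.1 : seq T))].
have mE : measurable E.
  apply: measurableI; first exact: measurable_isolated_in.
  have mh : measurable_fun setT (fun s : n.-tuple T => head 0 (s : seq T)).
    case: n {E} => [|n].
      rewrite (_ : (fun _ => _) = cst 0)//.
      by apply/funext => s; rewrite (tuple0 s).
    rewrite (_ : (fun _ => _) = fun s : n.+1.-tuple T => tnth s ord0).
      exact: measurable_tnth.
    by apply/funext => s; rewrite (tnth_nth 0) nth0.
  have mh1 : measurable_fun setT (fun p : n.-tuple T * conf => head 0 (p.1 : seq T)).
    exact: (measurableT_comp mh).
  by rewrite -[X in measurable X]setTI; exact: mh1.
rewrite /seq_measurable (_ : (fun _ => _) = EFin \o \1_E); last first.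
  by apply/funext => -[s xi] /=; rewrite /isolated_weight; congr EFin; exact: eq_indicP.
exact/measurable_EFinP/measurable_indic.
Qed.

Lemma iter_isolated_weight Q r xi : 0 < r -> measurable Q ->
  iter k (@point_sum R d) (isolated_weight Q r) [::] xi =
  counting [set u | isolated_injections S k A r xi u /\ Q (head 0 u)].
Proof.
move=> r0 mQ; rewrite iter_point_sumE; last 2 first.
- by move=> s xi'; exact: isolated_weight_ge0.
- by move=> n; exact: measurable_isolated_weight.
pose G := [set u | isolated_in S A r u (remove_seq u xi) /\ Q (head 0 u)].
transitivity (\esum_(u in injections k xi) if u \in G then 1%E else 0%E : \bar R).
  apply: eq_esum => u _; rewrite cats0 /isolated_weight indicE.
  have [uG|uG] := boolP (u \in G).
    by rewrite mem_set//; exact: set_mem uG.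
  rewrite (_ : (_ \in _) = false)//; apply/negbTE; apply: contra uG => /set_mem uG.
  exact/mem_set.
rewrite -esum_mkcondr -counting_esum; congr counting.
apply/seteqP; split=> u; first by move=> [uk [uI uQ]]; split; [split|].
by move=> [[uk uI] uQ]; split.
Qed.

Definition zone r s : set T := [set z | exists2 x, x \in s & dilate r S (x - z)].

Lemma measurable_zone r s : 0 < r -> measurable (zone r s).
Proof.
move=> r0; rewrite (_ : zone r s = \bigcup_(x in [set` s]) [set z | dilate r S (x - z)]).
  apply: fin_bigcup_measurable => [|x _]; first exact: finite_seq.
  rewrite -[X in measurable X]setTI; apply: measurable_fun_rVB => //.
  exact: measurable_dilate.
by apply/seteqP; split=> z [x]; exists x.
Qed.

Lemma bounded_zone r s : 0 < r -> bounded_set (zone r s).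
Proof.
move=> r0; apply/bounded_rVP; exists (r * `|theta| + \sum_(x <- s) `|x|) => z [x xs].
have s0 : 0 <= \sum_(x <- s) `|x| by apply: sumr_ge0.
have rt0 : 0 <= r * `|theta| by rewrite mulr_ge0// ltW.
rewrite dilateE// => /S_bdd xz; apply: norm_rV_le; first by rewrite addr_ge0.
move=> j; have := xz j; rewrite !mxE normrM (@ger0_norm _ r^-1) ?invr_ge0 ?(ltW r0)//.
rewrite mulrC ler_pdivrMr// => xzj.
rewrite -[z 0 j](subrK (x 0 j)) (le_trans (ler_normD _ _))// lerD//.
  by rewrite distrC (le_trans xzj)// mulrC ler_wpM2l ?ler_norm// ltW.
rewrite (le_trans (coord_le_norm _ _))// (big_rem x)//= lerDl.
by apply: sumr_ge0.
Qed.

Context (dO : measure_display) (Omega : measurableType dO).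
Variables (P : probability Omega R) (nu : {sigma_finite_measure set T -> \bar R}).
Variable eta : Omega -> conf.
Hypothesis eta_poisson : poisson_process P nu eta.
Hypothesis nu_lf : forall B : set T, measurable B -> bounded_set B -> (nu B < +oo)%E.

(** In the Mecke integral the tuple is deterministic and the process is unchanged, so isolation
    means that [zone r s] is void. This has probability [exp(- nu (zone r s))], as the zone is
    bounded. *)
Lemma mean_isolated r : 0 < r ->
  (\int[P]_w counting (isolated_injections S k A r (eta w)) =
   \int[tuple_measure nu k]_s
     ((\1_[set u : seq T | admissible S A r u] (s : seq T))%:E * (expR (- fine (nu (zone r s))))%:E))%E.
Proof.
move=> r0.
transitivity (\int[P]_w iter k (@point_sum R d) (isolated_weight setT r) [::] (eta w))%E.
  apply: eq_integral => w _; rewrite iter_isolated_weight//; congr counting.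
  by apply/seteqP; split=> u => [uI|[]//]; split.
rewrite (mean_iter_point_sum eta_poisson nu_lf)//; last 2 first.
- by move=> s xi; exact: isolated_weight_ge0.
- exact: measurable_isolated_weight.
apply: eq_integral => s _.
transitivity (\int[P]_w ((\1_[set u : seq T | admissible S A r u] (s : seq T))%:E *
   (\1_(eta @^-1` void_event (zone r s)) w)%:E))%E.
  apply: eq_integral => w _; rewrite /isolated_weight -EFinM; congr EFin.
  apply: indic_mulP; split=> [[[sA sep] _]|[sA sep]].
    split=> //; apply/seteqP; split=> // z [zw [x xs Sxz]].
    exact: (sep x z xs zw Sxz).
  split=> //; split=> // x z xs zw Sxz.
  suff : set0 z by [].
  by rewrite -sep; split=> //; exists x.
have mV : measurable (eta @^-1` void_event (zone r s)).
  rewrite -[X in measurable X]setTI; apply: (poisson_measurable eta_poisson) => //.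
  by apply: measurable_void_event; exact: measurable_zone.
rewrite ge0_integralZl//; last by exact/measurable_EFinP/measurable_indic.
rewrite integral_indic// setIT; congr (_ * _)%E.
apply: (poisson_void eta_poisson); first exact: measurable_zone.
by apply: nu_lf; [exact: measurable_zone|exact: bounded_zone].
Qed.

Lemma measurable_counting_isolated r Q : 0 < r -> measurable Q ->
  measurable_fun setT (fun xi => counting
    [set u | isolated_injections S k A r xi u /\ Q (head 0 u)] : \bar R).
Proof.
move=> r0 mQ; under eq_fun do rewrite -iter_isolated_weight//.
have H f : (forall s xi, 0 <= f s xi)%E -> (forall n, seq_measurable n f) ->
    forall n, seq_measurable n (iter k (@point_sum R d) f).
  move=> f0; elim: k f f0 => [//|j IH] f f0 mf n'; rewrite iterSr; apply: IH.
    exact: point_sum_ge0.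
  by move=> n''; exact: measurable_point_sum.
have m0 : seq_measurable 0 (iter k (@point_sum R d) (isolated_weight Q r)).
  apply: H; first by move=> s xi; exact: isolated_weight_ge0.
  by move=> n; exact: measurable_isolated_weight.
exact: (measurableT_comp m0 (pair1_measurable [tuple])).
Qed.

End mean_count.

(** * Chernoff bounds for coloured sums *)

Section exp_bounds.
Context (R : realType).
Implicit Types (s x : R).

Lemma expR_chord s x : 0 <= x <= 1 -> expR (s * x) <= (1 - x) + expR s * x.
Proof.
move=> /andP[x0 x1].
have := @convex_expR R (Itv01 x0 x1) s 0.
rewrite !convRE /= expR0 !mulr1 mulr0.
by rewrite addr0 mulrC => /le_trans; apply; rewrite addrC [x * _]mulrC.
Qed.

(** From [(1 - s) * exp s <= 1] and [(1 - s) * (1 + s + 2 * s ^ 2) = 1 + s ^ 2 * (1 - 2 * s)].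
    Negative [s] are included, as needed for lower tails. *)
Lemma expR_quadratic s : s <= 2^-1 -> expR s <= 1 + s + 2 * s ^+ 2.
Proof.
move=> s2; have s1 : 0 < 1 - s by lra.
have : (1 - s) * expR s <= 1.
  have := expR_ge1Dx (- s); rewrite expRN => h.
  by rewrite -ler_pdivlMr ?expR_gt0// div1r.
rewrite -ler_pdivlMl// => /le_trans; apply.
rewrite mulr1 -div1r ler_pdivrMr//.
have s20 : 0 <= s ^+ 2 by exact: sqr_ge0.
nra.
Qed.

(* By convexity the colours need not be independent of each other. *)
Lemma expR_sum_le (C : finType) (a : C -> R) : (0 < #|C|)%N ->
  expR (\sum_c a c) <= \sum_c expR (#|C|%:R * a c).
Proof.
move=> /card_gt0P[c0 _].
have [c _ cmax] := @arg_maxP _ _ C c0 xpredT a isT.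
apply: (@le_trans _ _ (expR (#|C|%:R * a c))); last first.
  by rewrite (bigD1 c)//= lerDl sumr_ge0// => i _; exact: expR_ge0.
rewrite ler_expR mulr_natl -sumr_const.
by apply: ler_sum => i _; exact: cmax.
Qed.

End exp_bounds.

Section chernoff_rate.
Context (R : realType).

(* The step [s] is the largest one allowing [expR_quadratic] at [s * n], subject to
   the quadratic term being at most half of the linear gain [s * delta]. *)
Definition chernoff_step (n : nat) (delta C0 : R) : R :=
  Num.min (2^-1 / n%:R) (delta / (4 * C0 * n%:R ^+ 2)).

Definition chernoff_rate (n : nat) (delta C0 : R) : R :=
  chernoff_step n delta C0 * delta / 2.

Lemma chernoff_step_gt0 n (delta C0 : R) : (0 < n)%N -> 0 < delta -> 0 < C0 ->
  0 < chernoff_step n delta C0.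
Proof.
move=> n0 d0 C0_; have n0R : 0 < n%:R :> R by rewrite ltr0n.
by rewrite lt_min !divr_gt0// !mulr_gt0.
Qed.

Lemma chernoff_rate_gt0 n (delta C0 : R) : (0 < n)%N -> 0 < delta -> 0 < C0 ->
  0 < chernoff_rate n delta C0.
Proof. by move=> n0 d0 C0_; rewrite !mulr_gt0// chernoff_step_gt0. Qed.

Lemma chernoff_step_le n (delta C0 : R) : (0 < n)%N ->
  chernoff_step n delta C0 * n%:R <= 2^-1.
Proof. by move=> n0; rewrite -ler_pdivlMr ?ltr0n// ge_min lexx. Qed.

Lemma chernoff_step_quad n (delta C0 : R) : (0 < n)%N -> 0 < delta -> 0 < C0 ->
  2 * (chernoff_step n delta C0 * n%:R) ^+ 2 * C0 - chernoff_step n delta C0 * delta <=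
  - chernoff_rate n delta C0.
Proof.
move=> n0 d0 C0_; rewrite /chernoff_rate; set s := chernoff_step _ _ _.
have s0 : 0 < s by exact: chernoff_step_gt0.
have n0R : 0 < n%:R :> R by rewrite ltr0n.
have : s <= delta / (4 * C0 * n%:R ^+ 2) by rewrite ge_min lexx orbT.
rewrite ler_pdivlMr; last by rewrite !mulr_gt0.
by move=> /(ler_wpM2l (ltW s0)); rewrite exprMn; nra.
Qed.

End chernoff_rate.

Section chernoff.
Context (R : realType) (dO : measure_display) (Omega : measurableType dO).
Variables (P : probability Omega R) (X : nat -> Omega -> R) (C : finType) (col : nat -> C).
Hypothesis C_gt0 : (0 < #|C|)%N.
Hypothesis mX : forall i, measurable_fun setT (X i).
Hypothesis X01 : forall i w, 0 <= X i w <= 1.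
Let coloured c m := [seq i <- iota 0 m | col i == c].
Hypothesis indep : forall (s : R) c m,
  (\int[P]_w (\prod_(i <- coloured c m) expR (s * X i w))%:E =
   \prod_(i <- coloured c m) \int[P]_w (expR (s * X i w))%:E)%E.

Let e i : R := fine (\int[P]_w (X i w)%:E).

Let X0 i w : 0 <= X i w. Proof. by have /andP[] := X01 i w. Qed.
Let X1 i w : X i w <= 1. Proof. by have /andP[] := X01 i w. Qed.

Let int1 : (\int[P]__ 1 = 1)%E.
Proof. by rewrite (integral_cst P measurableT 1%E) mul1e; exact: probability_setT. Qed.

Let eE i : (\int[P]_w (X i w)%:E = (e i)%:E)%E.
Proof.
rewrite /e fineK// ge0_fin_numE; last by apply: integral_ge0 => w _; rewrite lee_fin.
rewrite (@le_lt_trans _ _ (\int[P]__ 1)%E)//; last by rewrite int1 ltry.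
by apply: ge0_le_integral => //; [move=> w _; rewrite lee_fin|exact/measurable_EFinP|move=> w _; rewrite lee_fin].
Qed.

Let e_ge0 i : 0 <= e i.
Proof. by rewrite fine_ge0// integral_ge0// => w _; rewrite lee_fin. Qed.

(** The chord bound on [[0, 1]] makes the exponential linear in [X i], so the moment is controlled
    by the mean [e i] alone. *)
Let moment s i : (\int[P]_w (expR (s * X i w))%:E <= (expR ((expR s - 1) * e i))%:E)%E.
Proof.
apply: (@le_trans _ _ (\int[P]_w ((1 - X i w)%:E + (expR s)%:E * (X i w)%:E))%E).
  apply: ge0_le_integral => //.
  - apply/measurable_EFinP; apply: measurableT_comp => //; exact: measurable_funM.
  - apply: emeasurable_funD.
      by apply/measurable_EFinP; exact: measurable_funB.
    by apply: emeasurable_funM => //; exact/measurable_EFinP.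
  - by move=> w _; rewrite -EFinM -EFinD lee_fin; exact: expR_chord.
rewrite ge0_integralD//; last 4 first.
- by move=> w _; rewrite lee_fin subr_ge0.
- by apply/measurable_EFinP; exact: measurable_funB.
- by move=> w _; rewrite -EFinM lee_fin mulr_ge0// expR_ge0.
- by apply: emeasurable_funM => //; exact/measurable_EFinP.
rewrite ge0_integralZl//; last 2 first.
- exact/measurable_EFinP.
- by move=> w _; rewrite lee_fin.
have -> : (\int[P]_w (1 - X i w)%:E = (1 - e i)%:E)%E.
  have : (\int[P]_w ((1 - X i w)%:E + (X i w)%:E) = 1)%E.
    by under eq_integral do rewrite -EFinD subrK.
  rewrite ge0_integralD//; last 4 first.
  - by move=> w _; rewrite lee_fin subr_ge0.
  - by apply/measurable_EFinP; exact: measurable_funB.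
  - by move=> w _; rewrite lee_fin.
  - exact/measurable_EFinP.
  rewrite eE => h; rewrite EFinB -h addeK//.
rewrite eE -EFinM -EFinD lee_fin (le_trans _ (expR_ge1Dx _))//.
by rewrite le_eqVlt; apply/orP; left; apply/eqP; ring.
Qed.

Let S_ c m w := \sum_(i <- coloured c m) (X i w - e i).

Let mS_ c m : measurable_fun setT (S_ c m).
Proof. by apply: measurable_sum => i; apply: measurable_funB. Qed.

(** Centring cancels the linear term and leaves [exp s - 1 - s <= 2 * s ^ 2]. The sum of means is
    enlarged from one colour to all indices, for a bound uniform in the colour. *)
Let colour_moment s c m : s <= 2^-1 ->
  (\int[P]_w (expR (s * S_ c m w))%:E <=
   (expR (2 * s ^+ 2 * \sum_(i < m) e i))%:E)%E.
Proof.
move=> s2.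
have SE w : expR (s * S_ c m w) =
    expR (- (s * \sum_(i <- coloured c m) e i)) *
    \prod_(i <- coloured c m) expR (s * X i w).
  by rewrite /S_ -expR_sum -expRD sumrB mulrBr mulr_sumr addrC.
under eq_integral do rewrite SE EFinM.
rewrite ge0_integralZl//; last 2 first.
- apply/measurable_EFinP; apply: measurable_prod => i _.
  by apply: measurableT_comp => //; exact: measurable_funM.
- by move=> w _; rewrite lee_fin prodr_ge0// => i _; exact: expR_ge0.
rewrite indep.
apply: (@le_trans _ _ ((expR (- (s * \sum_(i <- coloured c m) e i)))%:E *
    (\prod_(i <- coloured c m) expR ((expR s - 1) * e i))%:E)%E).
  apply: lee_wpmul2l; first by rewrite lee_fin expR_ge0.
  rewrite -prodEFin; elim: (coloured c m) => [|i r IH]; first by rewrite !big_nil.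
  rewrite !big_cons; apply: lee_pmul => //.
    by apply: integral_ge0 => w _; rewrite lee_fin expR_ge0.
  elim/big_ind : _ => //; first by move=> *; exact: mule_ge0.
  by move=> j _; apply: integral_ge0 => w _; rewrite lee_fin expR_ge0.
rewrite -EFinM lee_fin -expR_sum -expRD ler_expR -mulr_sumr -mulNr -mulrDl.
apply: (@le_trans _ _ (2 * s ^+ 2 * \sum_(i <- coloured c m) e i)).
  apply: ler_wpM2r; first by rewrite sumr_ge0.
  by have := expR_quadratic s2; lra.
apply: ler_wpM2l; first by rewrite mulr_ge0// sqr_ge0.
rewrite /coloured big_filter -[m in leRHS]card_ord -(big_mkord xpredT e) /index_iota subn0.
by rewrite [leRHS](bigID (fun i => col i == c))/= card_ord lerDl sumr_ge0.
Qed.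

Let sumS m w : \sum_c S_ c m w = \sum_(i < m) (X i w - e i).
Proof.
rewrite -(big_mkord xpredT (fun i => X i w - e i)) /index_iota subn0.
rewrite (partition_big col xpredT)//=.
by apply: eq_bigr => c _; rewrite /S_ big_filter.
Qed.

(** Markov's inequality for the exponential, with the sign of [s] selecting the upper or the lower
    tail. Combining colours by convexity multiplies the exponent by [#|C|], hence the constraint on
    [s]. *)
Let tail (s eta : R) m : `|s| * #|C|%:R <= 2^-1 ->
  (P [set w | (`|s| * eta <= s * \sum_(i < m) (X i w - e i))%R] <=
   (#|C|%:R * expR (2 * (s * #|C|%:R) ^+ 2 * (\sum_(i < m) e i) - `|s| * eta)%R)%:E)%E.
Proof.
move=> sC; set E := [set _ | _].
have mD : measurable_fun setT (fun w => s * \sum_(i < m) (X i w - e i)).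
  apply: measurable_funM => //; apply: measurable_sum => i.
  exact: measurable_funB.
have mE : measurable E.
  rewrite -[E]setTI (_ : E = (fun w => s * \sum_(i < m) (X i w - e i)) @^-1` `[`|s| * eta, +oo[%classic).
    exact: mD.
  by apply/seteqP; split=> w /=; rewrite in_itv/= andbT.
have sC' : #|C|%:R * s <= 2^-1.
  by rewrite (le_trans _ sC)// mulrC ler_wpM2r// ler_norm.
rewrite addrC expRD mulrCA EFinM -lee_pdivrMl ?expR_gt0// -expRN opprK.
rewrite -[X in (_ * P X <= _)%E]setIT -integral_indic//.
rewrite -ge0_integralZl//; last first.
  exact/measurable_EFinP/measurable_indic.
apply: (@le_trans _ _ (\int[P]_w \sum_c (expR (#|C|%:R * s * S_ c m w))%:E)%E).
  apply: ge0_le_integral => //.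
  - by apply: emeasurable_funM => //; apply/measurable_EFinP/measurable_indic.
  - apply: emeasurable_sum => c; apply/measurable_EFinP; apply: measurableT_comp => //.
    exact: measurable_funM.
  - move=> w _; rewrite -EFinM sumEFin lee_fin indicE.
    have [/set_mem wE|_] := boolP (w \in E); last first.
      by rewrite mulr0 sumr_ge0// => c _; exact: expR_ge0.
    rewrite mulr1 (@le_trans _ _ (expR (\sum_c s * S_ c m w)))//.
      by rewrite ler_expR -mulr_sumr sumS.
    rewrite (le_trans (expR_sum_le _ C_gt0))//.
    by apply: ler_sum => c _; rewrite mulrA.
rewrite ge0_integral_sum//; last first.
  move=> c; apply/measurable_EFinP; apply: measurableT_comp => //.
  exact: measurable_funM.
apply: (@le_trans _ _ (\sum_(c : C) (expR (2 * (s * #|C|%:R) ^+ 2 * \sum_(i < m) e i))%:E)%E).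
  by apply: lee_sum => c _; rewrite [s * _]mulrC; exact: colour_moment.
by rewrite sumEFin lee_fin sumr_const -[leLHS]mulr_natl.
Qed.

Section deviation.
Variables (delta C0 N : R).
Hypotheses (delta_gt0 : 0 < delta) (C0_gt0 : 0 < C0) (N_gt0 : 0 < N).
Let kappa := chernoff_rate #|C| delta C0.

Let finite_deviation (b : bool) m : \sum_(i < m) e i <= C0 * N ->
  (P [set w | (delta * N <= (-1) ^+ b * \sum_(i < m) (X i w - e i))%R] <=
   (#|C|%:R * expR (- (kappa * N))%R)%:E)%E.
Proof.
move=> eN; set s := chernoff_step #|C| delta C0.
have s0 : 0 < s by exact: chernoff_step_gt0.
have ns : `|s * (-1) ^+ b| = s by rewrite normrM normrX normrN1 expr1n mulr1 gtr0_norm.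
have := @tail (s * (-1) ^+ b) (delta * N) m.
rewrite ns => /(_ (chernoff_step_le _ _ C_gt0)).
rewrite (_ : [set w | _] = [set w | delta * N <= (-1) ^+ b * \sum_(i < m) (X i w - e i)]).
  move=> /le_trans; apply; rewrite lee_fin ler_wpM2l// ler_expR.
  have := chernoff_step_quad C_gt0 delta_gt0 C0_gt0; rewrite -/s -/kappa /= => h.
  rewrite [s * _ * _]mulrAC exprMn sqrr_sign mulr1.
  apply: (@le_trans _ _ (N * (2 * (s * #|C|%:R) ^+ 2 * C0 - s * delta))); last first.
    by rewrite [leLHS]mulrC -[leRHS]mulNr ler_pM2r.
  have : 0 <= 2 * (s * #|C|%:R) ^+ 2 by rewrite mulr_ge0// sqr_ge0.
  move=> /ler_wpM2l /(_ _ _ eN); set q := 2 * _; lra.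
by apply/seteqP; split=> w /=; rewrite -[_ * _ * \sum_(_ < _) _]mulrA ler_pM2l.
Qed.

Let F w : \bar R := (\sum_(i <oo) (X i w)%:E)%E.

Let mF : measurable_fun setT F.
Proof.
apply: ge0_emeasurable_sum => // i; first by move=> w _ _; rewrite lee_fin.
by move=> _; exact/measurable_EFinP.
Qed.

(** The bounds for finite sums are passed to the series. In the lower tail one [delta * N] is spent
    on truncating the series, hence the factor 2. *)
Lemma deviation (mean : R) : (\int[P]_w F w = mean%:E)%E -> mean <= C0 * N ->
  measurable [set w | ((mean + 2 * delta * N)%:E < F w \/ F w < (mean - 2 * delta * N)%:E)%E] /\
  (P [set w | ((mean + 2 * delta * N)%R%:E < F w \/ F w < (mean - 2 * delta * N)%R%:E)%E] <=
   (#|C|%:R * expR (- (kappa * N)) + #|C|%:R * expR (- (kappa * N)))%R%:E)%E.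
Proof.
move=> Fmean meanN.
have meanE : mean%:E = (\sum_(i <oo) (e i)%:E)%E.
  rewrite -Fmean integral_nneseries//.
  - by apply: eq_eseriesr => i _; rewrite eE.
  - by move=> i; exact/measurable_EFinP.
  - by move=> i w _; rewrite lee_fin.
have e_mean m : \sum_(i < m) e i <= mean.
  rewrite -lee_fin meanE -sumEFin -(big_mkord xpredT (fun i => (e i)%:E)).
  by apply: nneseries_lim_ge => i _; rewrite lee_fin.
(* A finite [m1] already carries the mean up to [delta * N]. Since partial sums are below [F], a
   small value of [F] forces a deviation of this partial sum. *)
have [m1 em1] : exists m, mean - delta * N <= \sum_(i < m) e i.
  apply: contrapT => no; suff : mean <= mean - delta * N.
    by apply/negP; rewrite -ltNge ltrBlDr ltrDl mulr_gt0.
  rewrite -lee_fin {1}meanE; apply: lime_le.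
    by apply: is_cvg_nneseries => i _ _; rewrite lee_fin.
  apply: nearW => m; rewrite big_mkord sumEFin lee_fin leNgt; apply/negP => mm.
  by apply: no; exists m; exact: ltW.
have sumB m w : \sum_(i < m) (X i w - e i) = \sum_(i < m) X i w - \sum_(i < m) e i.
  by rewrite sumrB.
have F_ge m w : ((\sum_(i < m) X i w)%:E <= F w)%E.
  rewrite -sumEFin -(big_mkord xpredT (fun i => (X i w)%:E)).
  by apply: nneseries_lim_ge => i _; rewrite lee_fin.
have mU : measurable [set w | ((mean + 2 * delta * N)%R%:E < F w)%E].
  rewrite -[X in measurable X]setTI; exact: emeasurable_fun_o_infty.
have mL : measurable [set w | (F w < (mean - 2 * delta * N)%R%:E)%E].
  rewrite -[X in measurable X]setTI; exact: emeasurable_fun_infty_o.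
split; first exact: measurableU.
have PUL := @measureU2 _ _ _ P _ _ mU mL.
rewrite [leRHS]EFinD; apply: (le_trans PUL); apply: leeD.
  (* A series of nonnegative terms exceeds a level exactly when some partial sum does. These events
     increase with [m], so the finite bound survives by continuity of [P]. *)
  pose G m := [set w | mean + 2 * delta * N < \sum_(i < m) X i w].
  have mG m : measurable (G m).
    rewrite -[G m]setTI (_ : G m = (fun w => \sum_(i < m) X i w) @^-1` `]mean + 2 * delta * N, +oo[%classic).
      by apply: measurable_sum.
    by apply/seteqP; split=> w /=; rewrite in_itv/= andbT.
  have UG : [set w | ((mean + 2 * delta * N)%R%:E < F w)%E] = \bigcup_m G m.
    apply/seteqP; split=> [w /= wF|w [m _ /= wm]]; last first.
      by rewrite (lt_le_trans _ (F_ge m w))// lte_fin.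
    apply: contrapT => no; move: wF; apply/negP; rewrite -leNgt.
    apply: lime_le; first by apply: is_cvg_nneseries => i _ _; rewrite lee_fin.
    apply: nearW => m; rewrite big_mkord sumEFin lee_fin leNgt; apply/negP => mm.
    by apply: no; exists m.
  rewrite UG.
  have Gnd : {homo G : n m / (n <= m)%N >-> (n <= m)%O}.
    move=> a b ab; apply/subsetPset => w; rewrite /G /= => /lt_le_trans; apply.
    rewrite -!(big_mkord xpredT (fun i => X i w)) (big_cat_nat (leq0n a) ab)//= lerDl.
    by rewrite sumr_ge0.
  have Pcvg : P (G m) @[m --> \oo] --> P (\bigcup_m G m).
    by apply: nondecreasing_cvg_mu => //; exact: bigcupT_measurable.
  suff : (P (\bigcup_m G m) <= (#|C|%:R * expR (- (kappa * N)))%:E)%E by [].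
  rewrite -(cvg_lim _ Pcvg)//; apply: lime_le; first by apply/cvg_ex; eexists; exact: Pcvg.
  apply: nearW => m /=; apply: le_trans (@finite_deviation false m _); last first.
    exact: le_trans (e_mean m) meanN.
  apply: le_measure; rewrite ?inE//.
    rewrite -[X in measurable X]setTI (_ : [set _ | _] = (fun w => \sum_(i < m) (X i w - e i)) @^-1` `[delta * N, +oo[%classic).
      by apply: measurable_sum => // i; exact: measurable_funB.
    by apply/seteqP; split=> w /=; rewrite in_itv/= andbT expr0 mul1r.
  move=> w /= wm; rewrite expr0 mul1r sumB.
  have := e_mean m; have : 0 < delta * N by rewrite mulr_gt0.
  by move: wm; rewrite /G /= -mulrA; lra.
apply: le_trans (@finite_deviation true m1 _); last exact: le_trans (e_mean m1) meanN.
apply: le_measure; rewrite ?inE//.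
  rewrite -[X in measurable X]setTI (_ : [set _ | _] = (fun w => \sum_(i < m1) (X i w - e i)) @^-1` `]-oo, - (delta * N)]%classic).
    by apply: measurable_sum => // i; exact: measurable_funB.
  by apply/seteqP; split=> w /=; rewrite in_itv/= expr1 mulN1r lerNr.
move=> w /= wm; rewrite expr1 mulN1r sumB.
have := le_lt_trans (F_ge m1 w) wm; rewrite lte_fin.
move: em1; rewrite -mulrA; lra.
Qed.

End deviation.

End chernoff.

(** * Concentration of the component count *)

Section component_deviation.
Context (R : realType) (d : nat).
Local Notation T := 'rV[R]_d.
Local Notation conf := (conf R d).
Variables (S : set T) (k : nat) (A : set conf) (theta : R).
Hypotheses (d_gt0 : (0 < d)%N) (k_gt0 : (0 < k)%N).
Hypotheses (mS : measurable S) (mA : measurable A).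
Hypotheses (ball_S : eball 0 1 `<=` S) (S_ball : S `<=` eball 0 theta).
Hypothesis theta_ge0 : 0 <= theta.
Context (dO : measure_display) (Omega : measurableType dO).
Variables (P : probability Omega R) (nu : {measure set T -> \bar R}).
Variable eta : Omega -> conf.
Hypothesis eta_poisson : poisson_process P nu eta.
Variable r : R.
Hypothesis r_gt0 : 0 < r.

Let S0 : S 0. Proof. exact: S_zero. Qed.
Let meta := poisson_measurable eta_poisson.
Let fact_gt0R : 0 < k`!%:R :> R. Proof. by rewrite ltr0n fact_gt0. Qed.

(** A component is spread over the cells of its points: each cell receives the fraction of the [k!]
    orderings whose head lies in it. The shares therefore add up to the component count. *)
Let share i (xi : conf) : R :=
  fine (counting (cell_injections S k A r i xi) : \bar R) / k`!%:R.

Let mshare i : measurable_fun setT (share i).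
Proof.
apply: measurable_funM => //; apply: (measurableT_comp (fine_measurable measurableT)) => //.
apply: (measurable_counting_isolated k mS mA S0 r_gt0); apply: measurable_gcell.
by rewrite divr_gt0// ltr0n.
Qed.

Let share_fin i xi :
  (counting (cell_injections S k A r i xi) : \bar R) \is a fin_num.
Proof.
rewrite ge0_fin_numE ?counting_ge0//.
apply: le_lt_trans (ltry k`!%:R).
exact: (counting_cell_injections A d_gt0 k_gt0 ball_S i xi r_gt0).
Qed.

Let share01 i xi : 0 <= share i xi <= 1.
Proof.
rewrite divr_ge0 ?fine_ge0 ?counting_ge0//= ler_pdivrMr// mul1r -lee_fin fineK//.
exact: (counting_cell_injections A d_gt0 k_gt0 ball_S i xi r_gt0).
Qed.

Let sum_share xi : (\sum_(i <oo) (share i xi)%:E = component_count k S A r xi)%E.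
Proof.
under eq_eseriesr => i _ do rewrite /share mulrC EFinM fineK//.
rewrite nneseriesZl; last by move=> i _; exact: counting_ge0.
rewrite -(counting_isolated_cells S k A xi r_gt0) counting_isolated_injections//.
by rewrite muleA -EFinM mulVf ?mul1e ?gt_eqF.
Qed.

Lemma measurable_component_count :
  measurable_fun setT (fun w => component_count k S A r (eta w) : \bar R).
Proof.
under eq_fun do rewrite -sum_share.
apply: ge0_emeasurable_sum => // [i w _ _|i _].
  by rewrite lee_fin; have /andP[] := share01 i (eta w).
by apply/measurable_EFinP; exact: (measurableT_comp (mshare i) meta).
Qed.

Definition nb_colours : nat := #|{ffun 'I_d -> 'I_(period d k theta).+1}|.

Lemma nb_colours_gt0 : (0 < nb_colours)%N.
Proof. by apply/card_gt0P; exists [ffun=> ord0]. Qed.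

Lemma component_deviation (delta C0 N mean : R) : 0 < delta -> 0 < C0 -> 0 < N ->
  (\int[P]_w component_count k S A r (eta w) = mean%:E)%E -> mean <= C0 * N ->
  exists B : set Omega, [/\ measurable B,
    (P B <= (2 * nb_colours%:R * expR (- (chernoff_rate nb_colours delta C0 * N)))%:E)%E &
    forall w, ~ B w -> ((mean - 2 * delta * N)%:E <= component_count k S A r (eta w)
                        <= (mean + 2 * delta * N)%:E)%E].
Proof.
move=> de0 C00 N0 meanE meanN.
have mX i : measurable_fun setT (fun w => share i (eta w)).
  exact: (measurableT_comp (mshare i) meta).
have [||] := @deviation R dO Omega P (fun i w => share i (eta w))
  {ffun 'I_d -> 'I_(period d k theta).+1} (colour d k theta) nb_colours_gt0 mX
  (fun i w => share01 i (eta w)) _ delta C0 N de0 C00 N0 mean _ meanN.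
- move=> s c m.
  pose h i xi := expR (s * share i xi).
  have hE i w : h i (window eta (@halo R d k theta r i) w) = h i (eta w).
    by rewrite /h /share /window cell_injections_halo.
  have := @window_expectation_prod R d dO Omega P nu eta eta_poisson _
    [seq i <- iota 0 m | colour d k theta i == c] (@halo R d k theta r) h.
  move=> H; transitivity (\int[P]_w (\prod_(i <- [seq i <- iota 0 m | colour d k theta i == c])
      h i (window eta (@halo R d k theta r i) w))%R%:E)%E.
    by apply: eq_integral => w _; congr EFin; apply: eq_bigr => i _; rewrite hE.
  etransitivity; first apply: H.
  + by rewrite filter_uniq// iota_uniq.
  + by move=> i; exact: measurable_halo.
  + move=> i j; rewrite !mem_filter => /andP[/eqP ic _] /andP[/eqP jc _] ij.
    by apply: halo_disjoint => //; rewrite ic jc.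
  + by move=> i; apply: measurableT_comp => //; apply: measurable_funM.
  + by move=> i xi; exact: expR_ge0.
  by apply: eq_bigr => i _; apply: eq_integral => w _; rewrite hE.
- by under eq_integral do rewrite sum_share.
move=> mB PB; eexists; split; [exact: mB| |].
  by rewrite (le_trans PB)// lee_fin -mulrDl [2 * _]mulrDl !mul1r.
move=> w nB; rewrite -sum_share !leNgt; apply/andP; split; apply/negP => h; apply: nB.
  by right.
by left.
Qed.

End component_deviation.

(** * From deviation bounds to almost sure convergence *)

Section borel_cantelli.
Context (R : realType) (dO : measure_display) (Omega : measurableType dO).
Variable P : probability Omega R.

Lemma borel_cantelli (B : nat -> set Omega) (K : R) : (forall t, measurable (B t)) ->
  B 0%N = set0 -> (forall t, (P (B t.+1) <= (K / t.+1%:R ^+ 2)%:E)%E) ->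
  {ae P, forall w, \forall t \near \oo, ~ B t w}.
Proof.
move=> mB B0 BK.
have K0 : 0 <= K.
  have := le_trans (measure_ge0 P (B 1%N)) (BK 0%N).
  by rewrite lee_fin expr1n divr1.
have PB : P (lim_sup_set B) = 0%E.
  apply: lim_sup_set_cvg0 => //.
  apply: (@le_lt_trans _ _ (2 * K)%:E); last exact: ltry.
  apply: lime_le; first by apply: is_cvg_nneseries => n _ _; exact: measure_ge0.
  apply: nearW => -[|n]; first by rewrite big_geq// lee_fin mulr_ge0.
  (* Partial sums are bounded by telescoping, using [1 / (n+1) ^ 2 <= 2 * (1 / (n+1) - 1 / (n+2))].
     The empty event at index 0 starts the induction. *)
  apply: (@le_trans _ _ (2 * K * (1 - n.+1%:R^-1))%:E); last first.
    by rewrite lee_fin ler_piMr ?mulr_ge0// gerBl invr_ge0.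
  elim: n => [|n IH]; first by rewrite big_nat1 B0 measure0 invr1 subrr mulr0.
  rewrite big_nat_recr//=; apply: (le_trans (leeD IH (BK n))).
  rewrite -EFinD lee_fin.
  rewrite -lerBrDl -mulrBr opprB addrC addrA subrK -mulrA mulrCA ler_wpM2l//.
  have n1 : 0 < n.+1%:R :> R by rewrite ltr0n.
  have n2 : 0 < n.+2%:R :> R by rewrite ltr0n.
  have n2E : n.+2%:R = n.+1%:R + 1 :> R by rewrite -natr1.
  have n11 : 1 <= n.+1%:R :> R by rewrite ler1n.
  rewrite -subr_ge0.
  have -> : 2 * (n.+1%:R^-1 - n.+2%:R^-1) - (n.+1%:R ^+ 2)^-1 =
      (n.+1%:R - 1) / (n.+1%:R ^+ 2 * n.+2%:R) :> R.
    rewrite n2E; field; rewrite gt_eqF//=; move: n1; rewrite -natr1; lra.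
  by rewrite divr_ge0 ?subr_ge0// mulr_ge0 ?exprn_ge0 ?ltW.
exists (lim_sup_set B); split => //.
  by apply: bigcap_measurable => // n _; exact: bigcup_measurable.
move=> w /= nw n _; apply: contrapT => nB; apply: nw.
exists n => // t /= nt Bt; apply: nB.
by exists t.
Qed.

Lemma expR_ge_ln (t : nat) (x : R) : 2 * ln t.+1%:R <= x -> expR (- x) <= (t.+1%:R ^+ 2)^-1.
Proof.
move=> tx; rewrite -[leRHS]lnK; last by rewrite posrE invr_gt0 exprn_gt0// ltr0n.
rewrite ler_expR lnV ?posrE ?exprn_gt0//.
by rewrite lerN2 lnXn// -[_ *+ 2]mulr_natl.
Qed.

(** However small [kappa delta] is, eventually [kappa delta * N t >= 2 * ln t], so the exceptional
    probabilities are at most [K / t ^ 2]. Countably many values of [delta] suffice, which leaves a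
    single null set. *)
Lemma ae_ratio_cvg (F : nat -> Omega -> \bar R) (mean N : nat -> R) (L K : R)
    (kappa : R -> R) : 0 <= K -> (forall delta, 0 < delta -> 0 < kappa delta) ->
  N t / ln t%:R @[t --> \oo] --> +oo ->
  mean t / N t @[t --> \oo] --> L ->
  (forall delta, 0 < delta -> \forall t \near \oo, 0 < N t -> exists B : set Omega,
    [/\ measurable B, (P B <= (K * expR (- (kappa delta * N t)))%:E)%E &
    forall w, ~ B w -> ((mean t - delta * N t)%:E <= F t w <=
                        (mean t + delta * N t)%:E)%E]) ->
  {ae P, forall w, (F t w * ((N t)^-1)%:E)%E @[t --> \oo] --> L%:E}.
Proof.
move=> K0 ka0 NL ML dev.
have NM (a : R) : 0 < a -> \forall t \near \oo, 0 < N t /\ 2 * ln t%:R <= a * N t.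
  move=> a0; move/cvgryPge : NL => /(_ (2 / a)); apply: filterS2 (nbhs_infty_gt 1) => t t1.
  have l0 : 0 < ln t%:R :> R by rewrite ln_gt0// ltr1n.
  rewrite ler_pdivlMr// => h; split.
    by rewrite (lt_le_trans _ h)// mulr_gt0// divr_gt0.
  by move: h; rewrite mulrAC ler_pdivrMr// [N t * a]mulrC.
pose e (j : nat) : R := j.+1%:R^-1.
have e0 j : 0 < e j by rewrite invr_gt0.
have H j : {ae P, forall w, \forall t \near \oo,
    0 < N t /\ ((mean t - e j * N t)%:E <= F t w <= (mean t + e j * N t)%:E)%E}.
  (* The estimates hold only for large [t]. At other indices the exceptional event is replaced by
     the empty set, so that the summable bound holds for every index. *)
  pose good t := [/\ (0 < t)%N, 0 < N t, 2 * ln t%:R <= kappa (e j) * N t &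
    (0 < N t -> exists B : set Omega,
    [/\ measurable B, (P B <= (K * expR (- (kappa (e j) * N t)))%:E)%E &
    forall w, ~ B w -> ((mean t - e j * N t)%:E <= F t w <=
                        (mean t + e j * N t)%:E)%E])].
  have good_near : \forall t \near \oo, good t.
    near=> t.
    have [N0 N1] : 0 < N t /\ 2 * ln t%:R <= kappa (e j) * N t.
      by near: t; apply: NM; exact: ka0.
    split => //; first by near: t; exact: nbhs_infty_gt.
    by near: t; exact: dev.
  have /choice[B BP] : forall t, exists B : set Omega, [/\ measurable B,
      ~ good t -> B = set0, good t -> (P B <= (K / t%:R ^+ 2)%:E)%E &
      good t -> forall w, ~ B w -> ((mean t - e j * N t)%:E <= F t w <=
                        (mean t + e j * N t)%:E)%E].
    move=> t; have [g|ng] := pselect (good t); last by exists set0.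
    have [t0 N0 N1 /(_ N0)[B [mB PB BF]]] := g; exists B; split => // _.
    rewrite (le_trans PB)// lee_fin ler_wpM2l//.
    by case: t t0 N1 {N0 PB BF g} => // t _; exact: expR_ge_ln.
  have mB t : measurable (B t) by have [] := BP t.
  apply: filterS (@borel_cantelli B K mB _ _).
  - move=> w; apply: filterS2 good_near => t gt nB.
    by have [_ _ _ /(_ gt _ nB)] := BP t; have [_ N0 _ _] := gt.
  - by have [_ h _ _] := BP 0%N; apply: h => -[].
  - move=> t; have [gt|ngt] := pselect (good t.+1).
      by have [_ _ /(_ gt)] := BP t.+1.
    have [_ /(_ ngt)-> _ _] := BP t.+1.
    by rewrite measure0 lee_fin divr_ge0// exprn_ge0.
have Hall : {ae P, forall w, forall j, \forall t \near \oo,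
    0 < N t /\ ((mean t - e j * N t)%:E <= F t w <= (mean t + e j * N t)%:E)%E}.
  exact: ae_foralln.
apply: filterS Hall => w Hw.
have Ffin : \forall t \near \oo, (F t w * ((N t)^-1)%:E)%E \is a fin_num.
  apply: filterS (Hw 0%N) => t [N0 /andP[F1 F2]].
  rewrite fin_numM// fin_numElt (lt_le_trans (ltNyr _) F1)/=.
  exact: le_lt_trans F2 (ltry _).
apply/fine_cvgP; split => //; apply/cvgrPdist_le => eps eps0.
have /cvgrPdist_le /(_ (eps / 2)) := ML; rewrite divr_gt0// => /(_ isT) ML'.
have [j ej] : exists j, e j <= eps / 2.
  exists (Num.truncn (2 / eps)); rewrite /e invf_ple ?posrE ?divr_gt0//.
  by rewrite invf_div ltW// truncnS_gt.
apply: filterS3 Ffin (Hw j) ML' => t Ft [N0 /andP[F1 F2]] Lt.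
have Ff : F t w \is a fin_num.
  by rewrite fin_numElt (lt_le_trans (ltNyr _) F1)/= (le_lt_trans F2 (ltry _)).
move: F1 F2; rewrite -{1 2}(fineK Ff) !lee_fin /= fineM// => F1 F2.
move: (fine (F t w)) F1 F2 => f F1 F2 /=.
have -> : L - f / N t = (L - mean t / N t) + (mean t - f) / N t.
  by rewrite mulrBl addrA subrK.
rewrite (le_trans (ler_normD _ _))// [leRHS](_ : _ = eps / 2 + eps / 2); last by field.
apply: lerD => //; rewrite normrM normfV (gtr0_norm N0) ler_pdivrMr//.
apply: (@le_trans _ _ (e j * N t)); last by rewrite ler_wpM2r// ltW.
by rewrite ler_norml; apply/andP; split; lra.
Unshelve. all: by end_near.
Qed.
End borel_cantelli.

(** * Changes of variables *)

Section weighted_image.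
Context dY dZ (Y : measurableType dY) (Z : measurableType dZ) (R : realType).
Variables (m : {measure set Y -> \bar R}) (nu : {measure set Z -> \bar R}).
Variables (w : Y -> R) (phi : Y -> Z).
Hypotheses (mw : measurable_fun setT w) (w0 : forall y, 0 <= w y).
Hypothesis mphi : measurable_fun setT phi.
Hypothesis nuE : forall B, measurable B ->
  (nu B = \int[m]_y ((w y)%:E * (\1_B (phi y))%:E))%E.

Let ka y : {measure set Z -> \bar R} := mscale (NngNum (w0 y)) (dirac (phi y)).

Let mka U : measurable U -> measurable_fun setT (fun y => ka y U).
Proof.
move=> mU; rewrite /ka /= /mscale /= /dirac.
apply: emeasurable_funM; first exact/measurable_EFinP.
by apply/measurable_EFinP; exact: measurableT_comp.
Qed.

(** The family [w y] times the Dirac mass at [phi y] has mixture [nu], so changes of variables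
    reduce to an identity on sets. *)
Lemma integral_weighted_image (f : Z -> \bar R) : measurable_fun setT f ->
  (forall z, (0 <= f z)%E) ->
  (\int[nu]_z f z = \int[m]_y ((w y)%:E * f (phi y)))%E.
Proof.
move=> mf f0; transitivity (\int[mixture_measure m mka]_z f z)%E.
  by apply: eq_measure_integral => B mB _; exact: nuE.
rewrite integral_mixture//; apply: eq_integral => y _.
by rewrite ge0_integral_mscale//= integral_dirac// diracT mul1e.
Qed.

End weighted_image.

Section tuple_integral.
Context (R : realType).
Local Open Scope ereal_scope.

Lemma measurable_cons_section d (T : measurableType d) n (F : n.+1.-tuple T -> \bar R) x :
  measurable_fun setT F -> measurable_fun setT (fun s => F (tcons (x, s))).
Proof.
move=> mF; apply: (measurableT_comp mF).
apply: (measurableT_comp (@measurable_tcons _ T n)); exact: measurable_fun_pair.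
Qed.

Lemma integral_tupleS d (T : measurableType d) (mu : {sigma_finite_measure set T -> \bar R}) n
    (F : n.+1.-tuple T -> \bar R) : measurable_fun setT F -> (forall s, 0 <= F s) ->
  \int[tuple_measure mu n.+1]_s F s =
  \int[mu]_x \int[tuple_measure mu n]_s F (tcons (x, s)).
Proof.
move=> mF F0; rewrite [LHS]/= /tuple_step ge0_integral_pushforward//.
rewrite preimage_setT fubini_tonelli1//; last by move=> p /=.
by apply: (measurableT_comp mF); exact: measurable_tcons.
Qed.

Lemma measurable_integral_tcons d (T : measurableType d)
    (mu : {sigma_finite_measure set T -> \bar R}) n (F : n.+1.-tuple T -> \bar R) :
  measurable_fun setT F -> (forall s, 0 <= F s) ->
  measurable_fun setT (fun x => \int[tuple_measure mu n]_s F (tcons (x, s))).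
Proof.
move=> mF F0.
apply: (@measurable_fun_fubini_tonelli_F _ _ T _ R (tuple_measure mu n) (F \o @tcons _ T n)).
  by apply: (measurableT_comp mF); exact: measurable_tcons.
by move=> p /=.
Qed.

Lemma tuple_measure_box d (T : measurableType d) (mu : {sigma_finite_measure set T -> \bar R})
    n (B : set T) : measurable B ->
  tuple_measure mu n [set s | forall i, B (tnth s i)] = \prod_(i < n) mu B.
Proof.
move=> mB; elim: n => [|n IH].
  by rewrite /= big_ord0 diracE mem_set// => -[].
rewrite big_ord_recl -IH /= /tuple_step /pushforward.
rewrite (_ : _ @^-1` _ = B `*` [set s : n.-tuple T | forall i, B (tnth s i)]); last first.
  apply/seteqP; split=> [[x s] /= h|[x s] /= [Bx h] i].
    by split; [have := h ord0; rewrite tnth0|move=> i; have := h (lift ord0 i); rewrite tnthS].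
  by case: (unliftP ord0 i) => [j ->|->]; rewrite ?tnthS ?tnth0.
rewrite product_measure1E//.
rewrite (_ : [set s | _] = \bigcap_(i in [set: 'I_n]) ((fun s => tnth s i) @^-1` B)).
  apply: fin_bigcap_measurable => // i _.
  by rewrite -[X in measurable X]setTI; exact: measurable_tnth.
by apply/seteqP; split=> s h i; [move=> _; exact: h|exact: (h i I)].
Qed.

Section transport.
Context dY dZ (Y : measurableType dY) (Z : measurableType dZ).
Variables (mu : {sigma_finite_measure set Y -> \bar R}).
Variables (nu : {sigma_finite_measure set Z -> \bar R}).

(* [phi] may depend on the coordinate: this covers affine maps of ['rV[R]_d] (a shift
   per coordinate) as well as maps acting on each point of a tuple. *)
Definition tuple_map n (phi : nat -> Y -> Z) (y : n.-tuple Y) : n.-tuple Z :=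
  [tuple phi i (tnth y i) | i < n].

Lemma measurable_tuple_map n phi : (forall i, measurable_fun setT (phi i)) ->
  measurable_fun setT (@tuple_map n phi).
Proof.
move=> mphi; apply/measurable_fun_tnthP => i.
rewrite (_ : _ \o _ = fun y => phi i (tnth y i)); last first.
  by apply/funext => y /=; rewrite tnth_mktuple.
by apply: measurableT_comp => //; exact: measurable_tnth.
Qed.

Lemma measurable_tuple_prod n (w : nat -> Y -> R) : (forall i, measurable_fun setT (w i)) ->
  measurable_fun setT (fun y : n.-tuple Y => (\prod_(i < n) w i (tnth y i))%R).
Proof.
move=> mw; apply: measurable_prod => i _.
by apply: measurableT_comp => //; exact: measurable_tnth.
Qed.

(** Tonelli peels off one coordinate at a time, so a one-variable substitution rule lifts to
    products without any Jacobian determinant. *)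
Lemma integral_tuple_transport n (w : nat -> Y -> R) (phi : nat -> Y -> Z) :
  (forall i, measurable_fun setT (w i)) -> (forall i y, (0 <= w i y)%R) ->
  (forall i, measurable_fun setT (phi i)) ->
  (forall i f, measurable_fun setT f -> (forall z, 0 <= f z) ->
    \int[nu]_z f z = \int[mu]_y ((w i y)%:E * f (phi i y))) ->
  forall F : n.-tuple Z -> \bar R, measurable_fun setT F -> (forall s, 0 <= F s) ->
  \int[tuple_measure nu n]_s F s =
  \int[tuple_measure mu n]_y ((\prod_(i < n) w i (tnth y i))%:E * F (tuple_map phi y)).
Proof.
elim: n w phi => [|n IH] w phi mw w0 mphi H F mF F0.
  have m0 dX (X : measurableType dX) (f : 0.-tuple X -> \bar R) : measurable_fun setT f.
    move=> _ B mB; rewrite setTI.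
    have [fB|nfB] := pselect (B (f [tuple])).
      rewrite (_ : _ @^-1` _ = setT)//; apply/seteqP; split => // s _.
      by rewrite /preimage/= tuple0.
    rewrite (_ : _ @^-1` _ = set0)//; apply/seteqP; split => // s.
    by rewrite /preimage/= tuple0.
  rewrite /= [LHS]integral_dirac//.
  rewrite [RHS]integral_dirac//; last exact: m0.
  rewrite !diracT !mul1e big_ord0 mul1e.
  by congr F; rewrite [RHS]tuple0.
have mG : measurable_fun setT (fun y : n.+1.-tuple Y =>
    (\prod_(i < n.+1) w i (tnth y i))%:E * F (tuple_map phi y)).
  apply: emeasurable_funM; first by apply/measurable_EFinP; exact: measurable_tuple_prod.
  by apply: measurableT_comp => //; exact: measurable_tuple_map.
have w_ge0 m (u : nat -> Y -> R) (y : m.-tuple Y) : (forall i y, 0 <= u i y)%R ->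
    0 <= (\prod_(i < m) u i (tnth y i))%:E.
  by move=> u0; rewrite lee_fin prodr_ge0.
rewrite !integral_tupleS//; last by move=> s; rewrite mule_ge0// w_ge0.
rewrite (H 0%N); last 2 first.
- exact: measurable_integral_tcons.
- by move=> z; exact: integral_ge0.
apply: eq_integral => y _.
rewrite (IH (fun i => w i.+1) (fun i => phi i.+1))//; last 2 first.
- by move=> i; exact: H.
- exact: measurable_cons_section.
rewrite -ge0_integralZl//; last 3 first.
- apply: emeasurable_funM; first by apply/measurable_EFinP; exact: (@measurable_tuple_prod n (fun i => w i.+1)).
  apply: (measurableT_comp (measurable_cons_section _ mF)).
  exact: measurable_tuple_map.
- by move=> s _; rewrite mule_ge0// (w_ge0 n (fun i => w i.+1)).
- by rewrite lee_fin.
apply: eq_integral => s _.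
rewrite muleA -EFinM big_ord_recl tnth0; congr (_ * _)%E.
  by congr ((_ * _)%:E); apply: eq_bigr => i _; rewrite tnthS.
congr F; apply: eq_from_tnth => i; rewrite tnth_mktuple.
by case: (unliftP ord0 i) => [j ->|->]; rewrite ?tnthS ?tnth0// tnth_mktuple.
Qed.

End transport.
End tuple_integral.

Lemma ler_powRN (R : realType) (p x y : R) : 0 <= p -> 0 < x -> x <= y ->
  y `^ (- p) <= x `^ (- p).
Proof.
move=> p0 x0 xy; have y0 := lt_le_trans x0 xy.
rewrite !powRN lef_pV2 ?posrE ?powR_gt0//.
by apply: ge0_ler_powR => //; rewrite nnegrE ltW.
Qed.

Section lebesgue_line.
Context (R : realType).
Local Notation leb := (@lebesgue_measure R).

Lemma integral_lebesgue_affine (x r : R) (f : R -> \bar R) : 0 < r ->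
  measurable_fun setT f -> (forall z, (0 <= f z)%E) ->
  (\int[leb]_z f z = \int[leb]_y (r%:E * f (x + r * (y : R))%R))%E.
Proof.
move=> r0 mf f0.
have mphi : measurable_fun setT (fun y : R => x + r * y).
  by apply: measurable_funD => //; exact: measurable_funM.
apply: (@integral_weighted_image _ _ _ _ R leb leb (cst r) (fun y => x + r * y)) => //.
  by move=> y; exact: ltW.
move=> B mB /=.
rewrite ge0_integralZl//; last 2 first.
- by apply/measurable_EFinP; apply: measurableT_comp.
- by rewrite lee_fin ltW.
have r0' : 0 <= r by exact: ltW.
have mphi' : @measurable_fun _ _ (measurableTypeR R) (measurableTypeR R) setT
  (fun y : R => x + r * y) := mphi.
(* The rescaled image of Lebesgue measure, identified with Lebesgue measure by its values on
   half-open intervals. *)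
pose M : {measure set (measurableTypeR R) -> \bar R} :=
  mscale (NngNum r0') (image_measure leb mphi').
have -> : (\int[leb]_y (\1_B (x + r * (y : R))%R)%:E = leb ((fun y : R => x + r * y)%R @^-1` B))%E.
  rewrite -[X in leb X]setIT -integral_indic//.
  by rewrite -[X in measurable X]setTI; exact: mphi.
transitivity (M B) => //.
apply: lebesgue_measure_unique => // _ [[a b]] /= _ <-.
rewrite /M /= /mscale /= (image_measureE _ mphi').
rewrite [(fun _ : R => _) @^-1` _](_ : _ = `](a - x) / r, (b - x) / r]%classic); last first.
  apply/seteqP; split=> y /=; rewrite !in_itv/= ltr_pdivrMr// ler_pdivlMr//
    ltrBlDr lerBrDr [y * r]mulrC [_ + x]addrC //.
rewrite [X in (_ * X)%E](lebesgue_measure_itv `](a - x) / r, (b - x) / r]) lebesgue_measure_itv/= !lte_fin.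
rewrite ltr_pM2r ?invr_gt0// ltrD2r.
case: ifPn => _; last by rewrite mule0.
by rewrite -!EFinD -EFinM -mulrBl mulrCA divff ?gt_eqF// mulr1 opprB addrA subrK.
Qed.

End lebesgue_line.

Section lebesgue_space.
Context (R : realType) (d : nat).
Local Notation T := 'rV[R]_d.
Local Notation leb := (@lebesgue_rV R d).
Local Notation leb1 := (@lebesgue_measure R).

Lemma integral_lebesgue_rV (f : T -> \bar R) : measurable_fun setT f ->
  (forall z, (0 <= f z)%E) ->
  (\int[leb]_z f z = \int[tuple_measure leb1 d]_s f (row_of_tuple s))%E.
Proof. by move=> mf f0; rewrite /lebesgue_rV ge0_integral_pushforward. Qed.

Lemma lebesgue_rV_affine (x : T) (r : R) (f : T -> \bar R) : 0 < r ->
  measurable_fun setT f -> (forall z, (0 <= f z)%E) ->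
  (\int[leb]_z f z = \int[leb]_y ((r ^+ d)%:E * f (x + r *: y)%R))%E.
Proof.
move=> r0 mf f0.
have mg : measurable_fun setT (fun y : T => f (x + r *: y)).
  apply: measurableT_comp => //; apply: measurable_fun_rVD => //.
  exact: measurable_fun_rVZ.
rewrite !integral_lebesgue_rV//; last 2 first.
- exact: measurable_funeM.
- by move=> z; rewrite mule_ge0// lee_fin exprn_ge0 ?ltW.
pose phi i (y : measurableTypeR R) : measurableTypeR R := nth 0 (tuple_of_row x) i + r * y.
have mphi i : measurable_fun setT (phi i).
  by apply: measurable_funD => //; exact: measurable_funM.
rewrite (@integral_tuple_transport R _ _ _ _ leb1 leb1 d (fun _ _ => r) phi)//.
- apply: eq_integral => s _; rewrite prodr_const card_ord; congr (_ * f _)%E.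
  apply/rowP => i; rewrite !mxE tnth_mktuple /phi; congr (_ + _).
  by rewrite -tnth_nth tnth_mktuple.
- by move=> _ _; exact: ltW.
- move=> i f1 mf1 f10; exact: integral_lebesgue_affine.
- apply: measurableT_comp => //; exact: measurable_row_of_tuple.
Qed.

Lemma lebesgue_box (B : set R) : measurable B ->
  leb [set x : T | forall j, B (x 0 j)] = (\prod_(i < d) leb1 B)%E.
Proof.
move=> mB; rewrite -(tuple_measure_box leb1)// /lebesgue_rV /pushforward.
congr (tuple_measure _ _ _); apply/seteqP; split=> s /= h i; have := h i;
  by rewrite mxE.
Qed.

Definition cube (M : R) : set T := [set x | forall j, `|x 0 j| <= M].

Lemma cubeE M : cube M = [set x : T | forall j, `[- M, M]%classic (x 0 j)].
Proof.
by apply/seteqP; split=> x h j; have := h j; rewrite /= in_itv/= ler_norml.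
Qed.

Lemma measurable_cube M : measurable (cube M).
Proof.
rewrite cubeE (_ : [set x | _] = \bigcap_(j in [set: 'I_d])
    ((fun x : T => x 0 j) @^-1` `[- M, M]%classic)).
  apply: fin_bigcap_measurable => // j _.
  by rewrite -[X in measurable X]setTI; exact: measurable_coord.
by apply/seteqP; split=> s h i; [move=> _; exact: h|exact: (h i I)].
Qed.

Lemma lebesgue_cube M : 0 <= M -> leb (cube M) = ((M + M) ^+ d)%:E.
Proof.
move=> M0; rewrite cubeE lebesgue_box//.
have -> : leb1 `[- M, M]%classic = (M + M)%:E.
  rewrite lebesgue_measure_itv/= lte_fin; case: ltP => [_|h].
    by rewrite -EFinD opprK.
  by rewrite (_ : M = 0) ?addr0//; lra.
by rewrite prodEFin prodr_const card_ord.
Qed.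

Lemma lebesgue_bounded (B : set T) : measurable B -> bounded_set B -> (leb B < +oo)%E.
Proof.
move=> mB /bounded_rVP[M BM].
apply: (@le_lt_trans _ _ (leb (cube (Num.max M 0)))).
  apply: le_measure; rewrite ?inE//; first exact: measurable_cube.
  move=> x Bx j; rewrite le_max (le_trans (coord_le_norm x j))//; exact: BM.
by rewrite lebesgue_cube ?ltry// le_max lexx orbT.
Qed.

Lemma lebesgue_point (x : T) : (0 < d)%N -> leb [set x] = 0%E.
Proof.
move=> d0.
suff : (leb [set x] <= 0)%E by move=> h; apply/eqP; rewrite eq_le h measure_ge0.
have mx := measurable_set1_rV x.
rewrite -[X in leb X]setIT -integral_indic// (@lebesgue_rV_affine x 1)//; last first.
  exact/measurable_EFinP.
rewrite (_ : (fun y : T => _) = fun y => (\1_(cube 0) y)%:E).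
  rewrite integral_indic//; last exact: measurable_cube.
  rewrite setIT; apply: (@le_trans _ _ (leb (cube 0))) => //.
  by rewrite lebesgue_cube// addr0 expr0n gt_eqF.
apply/funext => y; rewrite expr1n mul1e scale1r; congr EFin.
apply: eq_indicP; split=> /= [h j|h].
  have -> : y = 0 by apply: (@addrI _ x); rewrite addr0.
  by rewrite mxE normr0.
rewrite (_ : y = 0) ?addr0//; apply/rowP => j; rewrite mxE.
by apply/eqP; rewrite -normr_le0; exact: h.
Qed.

Lemma measurable_enorm : measurable_fun setT (@enorm R d).
Proof.
apply: measurableT_comp; first exact: (continuous_measurable_fun (@sqrt_continuous R)).
apply: measurable_sum => j; apply: measurable_funX; exact: measurable_coord.
Qed.

Lemma measurable_norm_rV : measurable_fun setT (fun x : T => `|x|).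
Proof.
apply: (measurability _ (RGenOpens.measurableE R)) => _ [_ [a [b ->]] <-].
rewrite setTI; apply: sub_sigma_algebra.
by have /continuousP := @norm_continuous R T; apply; exact: interval_open.
Qed.

Lemma measurable_eball (x : T) (r : R) : measurable (eball x r).
Proof.
have m : measurable_fun setT (fun y : T => enorm (y - x)).
  by apply: (measurableT_comp measurable_enorm); exact: measurable_fun_rVB.
rewrite (_ : eball x r = setT `&` (fun y : T => enorm (y - x)) @^-1` `]-oo, r]%classic).
  exact: m.
by rewrite setTI; apply/seteqP; split=> y /=; rewrite in_itv.
Qed.

Lemma lebesgue_ball_gt0 : (0 < d)%N -> (0 < leb (eball 0 1))%E.
Proof.
move=> d0; have d0' : 0 < d%:R :> R by rewrite ltr0n.
have i0 : 0 < d%:R^-1 :> R by rewrite invr_gt0.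
apply: (@lt_le_trans _ _ (leb (cube d%:R^-1))).
  by rewrite lebesgue_cube ?ltW// lte_fin exprn_gt0// addr_gt0.
apply: le_measure; rewrite ?inE//; first exact: measurable_cube.
  exact: measurable_eball.
move=> x xd; rewrite /eball/= subr0 -(divff (lt0r_neq0 d0')).
by apply: enorm_le; rewrite ?ltW.
Qed.

(* Dyadic shells: the integrand is at most [2 ^ (- p j)] outside the cube of radius [2 ^ j]. *)
Lemma integral_decay (p : R) : d%:R < p ->
  (\int[leb]_x (((1 + `|x|) `^ (- p))%:E) < +oo)%E.
Proof.
move=> dp; have p0 : 0 <= p by rewrite (le_trans _ (ltW dp)).
(* [a] is the decay of the integrand from one dyadic shell to the next, and [q] multiplies it by the
   volume growth [2 ^ d]; [q < 1] expresses [d < p]. *)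
pose a : R := 2 `^ (- p); pose q := a * 2 ^+ d.
have a0 : 0 <= a by exact: powR_ge0.
have q0 : 0 <= q by rewrite mulr_ge0 ?exprn_ge0.
have q1 : q < 1.
  rewrite /q /a -powR_mulrn// -powRD; last by rewrite pnatr_eq0 implybT.
  by rewrite /powR pnatr_eq0/= -[ltRHS]expR0 ltr_expR pmulr_llt0 ?ln_gt0 ?ltr1n// addrC subr_lt0.
have mc j : measurable (cube (2 ^+ j.+1)) by exact: measurable_cube.
pose g j x : \bar R := (a ^+ j * \1_(cube (2 ^+ j.+1)) x)%:E.
have g0 j x : (0 <= g j x)%E by rewrite lee_fin mulr_ge0 ?exprn_ge0.
have mg j : measurable_fun setT (g j).
  by apply/measurable_EFinP; apply: measurable_funM.
apply: (@le_lt_trans _ _ (\int[leb]_x \sum_(j <oo) g j x)%E).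
  apply: ge0_le_integral => //.
  - apply/measurable_EFinP; apply: (measurableT_comp (measurable_powR (- p))).
    by apply: measurable_funD => //; exact: measurable_norm_rV.
  - apply: ge0_emeasurable_sum => //.
  move=> x _.
  have [n0 x0] : exists n, 1 + `|x| < 2 ^+ n.+1.
    exists (Num.bound (1 + `|x|)).
    apply: lt_trans (archi_boundP _) _; first by rewrite addr_ge0.
    by rewrite -natrX ltr_nat (ltn_trans _ (ltn_expl _ _)).
  have [j xj jmin] := ex_minnP (ex_intro (fun n => 1 + `|x| < 2 ^+ n.+1) n0 x0).
  have jx : 2 ^+ j <= 1 + `|x|.
    case: j jmin {xj} => [|j] jmin; first by rewrite expr0 lerDl.
    by rewrite leNgt; apply/negP => /jmin; rewrite ltnn.
  apply: (@le_trans _ _ (g j x)); last first.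
    apply: le_trans (@nneseries_lim_ge _ (g^~ x) xpredT 0%N j.+1 _) => //.
    by rewrite big_nat_recr//= leeDr// sume_ge0.
  rewrite lee_fin indicE mem_set ?mulr1; last first.
    by move=> i; rewrite (le_trans (coord_le_norm x i))// (le_trans _ (ltW xj))// lerDr.
  rewrite /a -powR_mulrn ?powR_ge0// -powRrM mulrC powRrM powR_mulrn//.
  by apply: ler_powRN => //; rewrite exprn_gt0.
rewrite integral_nneseries//.
apply: (@le_lt_trans _ _ ((4 ^+ d / (1 - q))%:E)); last exact: ltry.
apply: lime_le; first by apply: is_cvg_nneseries => n _ _; exact: integral_ge0.
apply: nearW => n.
rewrite (eq_bigr (fun j => (4 ^+ d * q ^+ j)%:E)); last first.
  move=> j _; rewrite /g.
  under eq_integral do rewrite EFinM.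
  rewrite ge0_integralZl//; last 2 first.
  - exact/measurable_EFinP.
  - by rewrite lee_fin exprn_ge0.
  rewrite integral_indic// setIT.
  transitivity ((a ^+ j)%:E * leb (cube (2 ^+ j.+1)))%E => //.
  rewrite lebesgue_cube ?exprn_ge0// -EFinM; congr EFin.
  rewrite (_ : 2 ^+ j.+1 + 2 ^+ j.+1 = 4 * 2 ^+ j); last by rewrite exprS; ring.
  by rewrite exprMn mulrCA -exprM mulnC exprM -exprMn.
rewrite sumEFin lee_fin -mulr_sumr ler_wpM2l ?exprn_ge0//.
have q1' : 0 < 1 - q by rewrite subr_gt0.
rewrite -[(1 - q)^-1]mul1r ler_pdivlMr// mulrC big_mkord.
by rewrite -[1 - q]opprB mulNr -subrX1 opprB gerBl exprn_ge0.
Qed.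

End lebesgue_space.

(** * The mean number of components *)

Section affine_invariance.
Context (R : realType) (d : nat).
Local Notation T := 'rV[R]_d.
Variables (S : set T) (A : set (conf R d)).
Hypotheses (S0 : S 0) (A_invariant : translation_invariant A).

Lemma dilate1 (X : set T) : dilate 1 X = X.
Proof. by apply/funext => x; rewrite dilateE// invr1 scale1r. Qed.

Lemma connected_seq_affine r x n (u : n.-tuple T) : 0 < r ->
  connected_seq S r [seq x + r *: y | y <- u] <-> connected_seq S 1 u.
Proof.
move=> r0; have := connected_seqP S0 (map_tuple (fun y => x + r *: y) u) r0.
have -> : adj S r (map_tuple (fun y => x + r *: y) u) = adj S 1 u; last first.
  by move=> ->; rewrite -connected_seqP.
apply/funext => i; apply/funext => j; rewrite /adj !tnth_map !dilateE//.
by rewrite opprD addrACA subrr add0r -scalerBr scalerA mulVf ?gt_eqF// invr1.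
Qed.

Lemma admissible_affine r x n (u : n.-tuple T) : 0 < r ->
  admissible S A r [seq x + r *: y | y <- u] <-> admissible S A 1 u.
Proof.
move=> r0; rewrite /admissible (connected_seq_affine _ _ r0) !dilate_confE//.
have -> : dilate_conf r^-1 (conf_of_seq [seq x + r *: y | y <- u]) =
    translate_conf (r^-1 *: x) (conf_of_seq u).
  apply: conf_inj; apply/seteqP; split=> z /=.
    move=> [_ /= /mapP[y yu ->] <-]; exists y => //.
    by rewrite scalerDr scalerA mulVf ?gt_eqF// scale1r addrC.
  move=> [y yu <-]; exists (x + r *: y); first exact: map_f.
  by rewrite scalerDr scalerA mulVf ?gt_eqF// scale1r addrC.
have -> : dilate_conf 1^-1 (conf_of_seq u) = conf_of_seq u.
  by apply: conf_inj; rewrite /= invr1 dilate1.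
split=> -[Au cu]; split=> //; last exact: A_invariant.
have := A_invariant (- (r^-1 *: x)) Au; congr A; apply: conf_inj.
apply/seteqP; split=> z /=.
  by move=> [_ [y yu <-] <-]; rewrite addrK.
by move=> zu; exists (z + r^-1 *: x); [exists z|rewrite addrK].
Qed.

Lemma pattern_admissible n (y : n.-tuple T) :
  @pattern R d S n.+1 A y =
  \1_[set u : n.+1.-tuple T | admissible S A 1 u] (tcons (0 : T, y)).
Proof.
apply: eq_indicP; rewrite /= /admissible /connected_seq dilate1 dilate_confE//.
have -> : dilate_conf 1^-1 (conf_of_seq (0 :: y)) = conf_of_seq (0 :: y).
  by apply: conf_inj; rewrite /= invr1 dilate1.
by [].
Qed.

End affine_invariance.

Section intensity.
Context (R : realType) (d : nat).
Local Notation T := 'rV[R]_d.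
Local Notation leb := (@lebesgue_rV R d).
Variables (S : set T) (A : set (conf R d)) (n : nat).
Hypotheses (mS : measurable S) (mA : measurable A).
Hypotheses (S0 : S 0) (A_invariant : translation_invariant A).
Implicit Types (M : T -> R) (p : T * n.-tuple T).

Local Notation nbhd := (@neighbourhood R d S n.+1).

(* For [M := m], [e := rho t] and [c := t * rho t ^ d], [intensity] is, up to
   normalisation, the density of the mean component count in the variables
   [x] and [y_i := (x_i - x) / rho t]. *)
Definition density_product M (e : R) p : R :=
  M p.1 * \prod_(i < n) M (p.1 + e *: tnth p.2 i).

Definition local_mass M (e : R) p : \bar R :=
  (\int[leb]_(z in nbhd p.2) (M (p.1 + e *: z))%:E)%E.

Definition intensity M (e c : R) p : R :=
  @pattern R d S n.+1 A p.2 * density_product M e p *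
  expR (- (c * fine (local_mass M e p))).

Lemma neighbourhoodP (y : n.-tuple T) z :
  nbhd y z <-> S z \/ exists i, S (z - tnth y i).
Proof.
split=> [[Sz|[i /= ni [x Sx xz]]]|[Sz|[i Sz]]]; [by left| |by left|].
  right; exists (Ordinal ni); rewrite (tnth_nth 0) /= -xz addrK //.
right; exists i => /=; first exact: ltn_ord.
by exists (z - tnth y i) => //; rewrite (tnth_nth 0) subrK.
Qed.

Lemma measurable_pattern : measurable_fun setT (@pattern R d S n.+1 A : n.-tuple T -> R).
Proof.
rewrite [X in measurable_fun _ X](_ : _ = \1_[set u : n.+1.-tuple T | admissible S A 1 u] \o
    (fun y => tcons (0 : T, y))); last by apply/funext => y; exact: pattern_admissible.
apply: measurableT_comp.
  by apply: measurable_indic; exact: (measurable_admissible mS mA S0).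
by apply: (measurableT_comp (@measurable_tcons _ T n)); exact: measurable_fun_pair.
Qed.

Lemma measurable_density_product M e : measurable_fun setT M ->
  measurable_fun setT (density_product M e).
Proof.
move=> mM; apply: measurable_funM; first exact: measurableT_comp.
apply: measurable_prod => i _; apply: measurableT_comp => //.
apply: measurable_fun_rVD => //; apply: measurable_fun_rVZ.
by apply: (measurableT_comp (measurable_tnth i)).
Qed.

Lemma measurable_neighbourhood_graph :
  measurable [set q : (n.-tuple T) * T | nbhd q.1 q.2].
Proof.
rewrite (_ : [set _ | _] = (snd @^-1` S) `|` \bigcup_(i in [set: 'I_n])
    ((fun q : n.-tuple T * T => q.2 - tnth q.1 i) @^-1` S)).
  apply: measurableU; first by rewrite -[X in measurable X]setTI; exact: measurable_snd.
  apply: fin_bigcup_measurable => // i _.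
  rewrite -[X in measurable X]setTI; apply: measurable_fun_rVB => //.
  by apply: (measurableT_comp (measurable_tnth i)).
apply/seteqP; split=> -[y z] /= => [/neighbourhoodP[Sz|[i Sz]]|[Sz|[i _ Sz]]].
- by left.
- by right; exists i.
- by apply/neighbourhoodP; left.
- by apply/neighbourhoodP; right; exists i.
Qed.

Lemma measurable_neighbourhood y : measurable (nbhd y).
Proof.
have := measurable_xsection y measurable_neighbourhood_graph.
by congr measurable; apply/seteqP; split=> z; rewrite /xsection/= ?inE //= => /set_mem.
Qed.

Lemma measurable_local_mass M e : measurable_fun setT M -> (forall x, 0 <= M x) ->
  measurable_fun setT (local_mass M e).
Proof.
move=> mM M0.
pose f (q : (T * n.-tuple T) * T) : \bar R :=
  ((M (q.1.1 + e *: q.2))%:E * (\1_[set q : (n.-tuple T) * T | nbhd q.1 q.2] (q.1.2, q.2))%:E)%E.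
rewrite (_ : local_mass M e = fun p => \int[leb]_z f (p, z))%E.
  apply: (@measurable_fun_fubini_tonelli_F _ _ _ _ R leb f).
    apply: emeasurable_funM; apply/measurable_EFinP.
      apply: measurableT_comp => //; apply: measurable_fun_rVD.
        exact: measurableT_comp.
      exact: measurable_fun_rVZ.
    apply: (measurableT_comp (measurable_indic measurable_neighbourhood_graph)).
    by apply: measurable_fun_pair => //; exact: measurableT_comp.
  by move=> q; rewrite /f mule_ge0 ?lee_fin.
apply/funext => p; rewrite /local_mass integral_mkcond; apply: eq_integral => z _.
rewrite /f patchE /= indicE; case: ifPn => [/set_mem h|/negP h].
  by rewrite mem_set ?mule1.
by rewrite memNset ?mule0// => h'; apply: h; exact/mem_set.
Qed.

Lemma measurable_intensity M e c : measurable_fun setT M -> (forall x, 0 <= M x) ->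
  measurable_fun setT (intensity M e c).
Proof.
move=> mM M0; apply: measurable_funM.
  apply: measurable_funM; last exact: measurable_density_product.
  exact: (measurableT_comp measurable_pattern).
apply: measurableT_comp => //; apply: measurableT_comp => //.
apply: measurable_funM => //; apply: (measurableT_comp (fine_measurable measurableT)) => //.
exact: measurable_local_mass.
Qed.

Lemma intensity_ge0 M e c p : (forall x, 0 <= M x) -> 0 <= intensity M e c p.
Proof.
by move=> M0; rewrite !mulr_ge0 ?expR_ge0 ?prodr_ge0//.
Qed.

Lemma fineZ (a : R) x : 0 < a -> fine (a%:E * x)%E = a * fine x.
Proof.
move=> a0; case: x => [x| |] //=.
  by rewrite gt0_muley ?lte_fin//= mulr0.
by rewrite gt0_muleNy ?lte_fin//= mulr0.
Qed.

(** Homogeneity in the density. It extracts the factor [t] of the intensity measure, and in the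
    dense regime the power of the rescaling length. *)
Lemma intensityZ M a e c p : 0 < a -> measurable_fun setT M -> (forall x, 0 <= M x) ->
  intensity (fun x => a * M x) e c p = a ^+ n.+1 * intensity M e (a * c) p.
Proof.
move=> a0 mM M0; rewrite /intensity.
have -> : density_product (fun x => a * M x) e p = a ^+ n.+1 * density_product M e p.
  by rewrite /density_product big_split/= prodr_const card_ord exprS mulrACA.
have -> : local_mass (fun x => a * M x) e p = (a%:E * local_mass M e p)%E.
  rewrite /local_mass; under eq_integral do rewrite EFinM.
  rewrite ge0_integralZl//.
  - exact: measurable_neighbourhood.
  - apply/measurable_EFinP; apply: measurable_funTS; apply: measurableT_comp => //.
    by apply: measurable_fun_rVD => //; exact: measurable_fun_rVZ.
  - by move=> z _; rewrite lee_fin.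
  - by rewrite lee_fin ltW.
by rewrite fineZ// mulrA [c * a]mulrC; ring.
Qed.

End intensity.

Section mean_formula.
Context (R : realType) (d : nat).
Local Notation T := 'rV[R]_d.
Local Notation leb := (@lebesgue_rV R d).
Variables (S : set T) (A : set (conf R d)) (n : nat).
Hypotheses (mS : measurable S) (mA : measurable A).
Hypotheses (S0 : S 0) (S_sym : forall x, S x -> S (- x)).
Hypothesis A_invariant : translation_invariant A.
Variables (nu : {sigma_finite_measure set T -> \bar R}) (g : T -> R).
Hypotheses (mg : measurable_fun setT g) (g0 : forall x, 0 <= g x).
Hypothesis nuE : forall B, measurable B -> (nu B = \int[leb]_(x in B) (g x)%:E)%E.
Local Open Scope ereal_scope.

Lemma integral_density (x : T) (r : R) (f : T -> \bar R) : (0 < r)%R ->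
  measurable_fun setT f -> (forall z, 0 <= f z) ->
  \int[nu]_z f z = \int[leb]_y ((r ^+ d * g (x + r *: y))%:E * f (x + r *: y)%R).
Proof.
move=> r0; have rd0 : (0 <= r ^+ d)%R by rewrite exprn_ge0 ?ltW.
have mphi : measurable_fun setT (fun y : T => (x + r *: y)%R).
  by apply: measurable_fun_rVD => //; exact: measurable_fun_rVZ.
apply: (integral_weighted_image _ _ mphi).
- by apply: measurable_funM => //; exact: measurableT_comp.
- by move=> y; rewrite mulr_ge0.
move=> B mB; transitivity (\int[leb]_(x in B) (g x)%:E); first exact: nuE.
rewrite [LHS]integral_mkcond.
have -> : (fun x => (g x)%:E) \_ B = fun x => (g x)%:E * (\1_B x)%:E.
  by apply/funext => z; rewrite patchE indicE; case: ifPn => _; rewrite ?mule1 ?mule0.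
rewrite [LHS](lebesgue_rV_affine x r0); last 2 first.
- apply: emeasurable_funM; first exact/measurable_EFinP.
  by apply/measurable_EFinP.
- by move=> z; rewrite mule_ge0 ?lee_fin.
by apply: eq_integral => y _; rewrite muleA EFinM.
Qed.

Lemma measurable_zone_mass r : (0 < r)%R ->
  measurable_fun setT (fun s : n.+1.-tuple T => nu (zone S r s)).
Proof.
move=> r0; pose E := [set q : n.+1.-tuple T * T | exists i, dilate r S (tnth q.1 i - q.2)%R].
have mE : measurable E.
  rewrite (_ : E = \bigcup_(i in [set: 'I_n.+1])
      ((fun q : n.+1.-tuple T * T => tnth q.1 i - q.2)%R @^-1` dilate r S)).
    apply: fin_bigcup_measurable => // i _.
    rewrite -[X in measurable X]setTI; apply: measurable_fun_rVB => //.
      by apply: (measurableT_comp (measurable_tnth i)).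
    exact: measurable_dilate.
  by apply/seteqP; split=> q => [[i qi]|[i _ qi]]; exists i.
rewrite (_ : (fun _ => _) = nu \o xsection E); first exact: measurable_fun_xsection.
apply/funext => s /=; congr (nu _); apply/seteqP; split=> z.
  move=> [x /tnthP[i ->] xz]; apply/mem_set; by exists i.
by move=> /set_mem[i xz]; exists (tnth s i) => //; exact: mem_tnth.
Qed.

Let weight r (s : n.+1.-tuple T) : \bar R :=
  (\1_[set u | admissible S A r u] (s : seq T))%:E * (expR (- fine (nu (zone S r s))))%:E.

Let weight_ge0 r s : 0 <= weight r s.
Proof. by rewrite mule_ge0 ?lee_fin ?expR_ge0// indicE. Qed.

Let measurable_weight r : (0 < r)%R -> measurable_fun setT (weight r).
Proof.
move=> r0; apply: emeasurable_funM; apply/measurable_EFinP.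
  rewrite (_ : (fun _ => _) = \1_[set u : n.+1.-tuple T | admissible S A r u]).
    by apply: measurable_indic; exact: (measurable_admissible mS mA S0).
  by apply/funext => s; exact: eq_indicP.
apply: measurableT_comp => //; apply: measurableT_comp => //.
apply: (measurableT_comp (fine_measurable measurableT)) => //.
exact: measurable_zone_mass.
Qed.

Lemma zone_mass (x : T) (r : R) (y : n.-tuple T) : (0 < r)%R ->
  nu (zone S r [seq (x + r *: z)%R | z <- 0%R :: y]) =
  (r ^+ d)%:E * local_mass S g r (x, y).
Proof.
move=> r0; have mz s : measurable (zone S r s) by exact: measurable_zone.
set Z := zone _ _ _.
transitivity (\int[nu]_z (\1_Z z)%:E); first by rewrite integral_indic ?setIT//; exact: mz.
rewrite (integral_density x r0)//; last first.
  by apply/measurable_EFinP/measurable_indic; exact: mz.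
rewrite /local_mass -ge0_integralZl//; last 4 first.
- exact: measurable_neighbourhood.
- apply/measurable_EFinP; apply: measurable_funTS; apply: measurableT_comp => //.
  by apply: measurable_fun_rVD => //; exact: measurable_fun_rVZ.
- by move=> z _; rewrite lee_fin.
- by rewrite lee_fin exprn_ge0 ?ltW.
rewrite [RHS]integral_mkcond.
apply: eq_integral => z _; rewrite patchE indicE EFinM.
(* [zone] tests differences from a tuple point to [z], [neighbourhood] the opposite ones; the
   symmetry of [S] reconciles them. *)
have ZE u : dilate r S (x + r *: u - (x + r *: z))%R <-> S (z - u)%R.
  rewrite dilateE// opprD addrACA subrr add0r -scalerBr scalerA mulVf ?gt_eqF//.
  by rewrite scale1r; split=> /S_sym; rewrite opprB.
have ZN : Z (x + r *: z)%R <-> @neighbourhood R d S n.+1 y z.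
  rewrite neighbourhoodP; split.
    move=> [_ /mapP[u + ->] /ZE].
    rewrite inE => /orP[/eqP ->|/tnthP[i ->]]; first by rewrite subr0; left.
    by right; exists i.
  move=> [Sz|[i Sz]].
    by exists (x + r *: 0)%R; [apply/mapP; exists 0%R => //; exact: mem_head|apply/ZE; rewrite subr0].
  exists (x + r *: tnth y i)%R; last exact/ZE.
  by apply/mapP; exists (tnth y i); rewrite // inE mem_tnth orbT.
have [h|h] := pselect (Z (x + r *: z)%R).
  by rewrite !mem_set ?mule1//; exact/ZN.
by rewrite !memNset ?mule0//= => /ZN.
Qed.

Lemma weight_affine (x : T) (r : R) (y : n.-tuple T) : (0 < r)%R ->
  (g x * \prod_(i < n) (r ^+ d * g (x + r *: tnth y i)))%:E *
    weight r (tcons (x, tuple_map (fun _ (z : T) => x + r *: z : T)%R y)) =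
  (((r ^+ d) ^+ n) * intensity S A g r (r ^+ d) (x, y))%:E.
Proof.
move=> r0; have tE : tuple_map (fun _ (z : T) => x + r *: z : T)%R y = map_tuple (fun z => x + r *: z)%R y.
  by apply: eq_from_tnth => i; rewrite tnth_mktuple tnth_map.
have sE : tcons (x, tuple_map (fun _ (z : T) => x + r *: z : T)%R y) =
    [seq x + r *: z | z <- tcons (0%R : T, y)]%R :> seq T.
  by rewrite tE /= scaler0 addr0.
rewrite /weight sE zone_mass// fineZ ?exprn_gt0//.
rewrite /intensity pattern_admissible//.
have -> : \1_[set u | admissible S A r u] [seq x + r *: z | z <- tcons (0%R : T, y)]%R =
    \1_[set u : n.+1.-tuple T | admissible S A 1 u] (tcons (0%R : T, y)) :> R.
  by apply: eq_indicP; exact: (admissible_affine S0 A_invariant x _ r0).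
rewrite -!EFinM /density_product /= big_split/= prodr_const card_ord; congr EFin.
by ring.
Qed.

(** Only the last [n] points are rescaled around the first one, each contributing a factor
    [r ^ d]. *)
Lemma mean_intensity r : (0 < r)%R ->
  \int[tuple_measure nu n.+1]_s
    ((\1_[set u | admissible S A r u] (s : seq T))%:E * (expR (- fine (nu (zone S r s))))%:E) =
  ((r ^+ d) ^+ n)%:E *
  \int[leb \x tuple_measure leb n]_p (intensity S A g r (r ^+ d) p)%:E.
Proof.
move=> r0; have mI : measurable_fun setT (intensity S A g r (r ^+ d) : T * n.-tuple T -> R).
  exact: measurable_intensity.
have I0 p : (0 <= (intensity S A g r (r ^+ d) (p : T * n.-tuple T))%:E).
  by rewrite lee_fin intensity_ge0.
have rd0 : (0 <= r ^+ d)%R by rewrite exprn_ge0// ltW.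
have rdn0 : (0 <= ((r ^+ d) ^+ n)%:E :> \bar R) by rewrite lee_fin !exprn_ge0 ?ltW.
rewrite -ge0_integralZl//; last by apply/measurable_EFinP.
rewrite fubini_tonelli1//; last 2 first.
- by apply: measurable_funeM; apply/measurable_EFinP.
- by move=> p; rewrite mule_ge0.
have mw := measurable_weight r0.
have mphi x : measurable_fun setT (fun z : T => x + r *: z)%R.
  by apply: measurable_fun_rVD => //; exact: measurable_fun_rVZ.
rewrite -/(weight r _) (integral_tupleS _ mw)//.
(* For the first point the substitution is trivial and merely replaces [nu] by its density. *)
rewrite (@integral_density 0%R 1%R)//; last 2 first.
- exact: measurable_integral_tcons.
- by move=> x; exact: integral_ge0.
apply: eq_integral => x _; rewrite expr1n mul1r add0r scale1r /fubini_F.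
rewrite (@integral_tuple_transport R _ _ T T leb nu n (fun _ (z : T) => r ^+ d * g (x + r *: z))%R
  (fun _ (z : T) => x + r *: z : T)%R)//; last 4 first.
- by move=> _; apply: measurable_funM => //; exact: measurableT_comp.
- by move=> _ z; rewrite mulr_ge0.
- by move=> _ f mf f0; exact: integral_density.
- exact: measurable_cons_section.
rewrite -ge0_integralZl//; last 3 first.
- apply: emeasurable_funM.
    apply/measurable_EFinP; apply: (@measurable_tuple_prod R _ T n (fun _ (z : T) => r ^+ d * g (x + r *: z))%R).
    by move=> _; apply: measurable_funM => //; exact: measurableT_comp.
  apply: (measurableT_comp (measurable_cons_section x mw)).
  by apply: measurable_tuple_map.
- by move=> y _; rewrite mule_ge0 ?weight_ge0// lee_fin prodr_ge0// => i _; rewrite mulr_ge0.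
- by rewrite lee_fin.
by apply: eq_integral => y _; rewrite muleA -EFinM -[RHS]EFinM -weight_affine.
Qed.

End mean_formula.

Section scaled_measure.
Context (R : realType) (d : nat).
Local Notation T := 'rV[R]_d.
Variables (mu : {measure set T -> \bar R}) (a : {nonneg R}).
Hypothesis mu_lf : forall B : set T, measurable B -> bounded_set B -> (mu B < +oo)%E.

Lemma scaled_locally_finite (B : set T) : measurable B -> bounded_set B ->
  (mscale a mu B < +oo)%E.
Proof.
move=> mB bB; rewrite /mscale/=; apply: lte_mul_pinfty => //; exact: mu_lf.
Qed.

(* The dummy argument carries the proof that the sigma-finiteness instance needs. *)
Definition scaled_of (_ : forall B : set T, measurable B -> bounded_set B -> (mu B < +oo)%E) :
  set T -> \bar R := mscale a mu.
Local Notation scaled := (scaled_of mu_lf).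

HB.instance Definition _ := Measure.copy scaled (mscale a mu).

Let scaled_sigma_finite : sigma_finite setT scaled.
Proof.
exists (fun i : nat => @cube R d i%:R).
  apply/seteqP; split=> // x _; exists (Num.bound `|x|) => // j.
  by rewrite (le_trans (coord_le_norm x j))// ltW// archi_boundP.
move=> i; split; first exact: measurable_cube.
apply: scaled_locally_finite; first exact: measurable_cube.
apply/bounded_rVP; exists i%:R => x xi; apply: norm_rV_le => //.
Qed.

HB.instance Definition _ := Measure_isSigmaFinite.Build _ _ _ scaled scaled_sigma_finite.

Definition scaled_measure : {sigma_finite_measure set T -> \bar R} := scaled.

End scaled_measure.

Section component_mean.
Context (R : realType) (d : nat).
Local Notation T := 'rV[R]_d.
Local Notation leb := (@lebesgue_rV R d).
Variables (S : set T) (A : set (conf R d)) (n : nat) (theta : R).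
Hypotheses (d_gt0 : (0 < d)%N).
Hypotheses (mS : measurable S) (mA : measurable A).
Hypotheses (ball_S : eball 0 1 `<=` S) (S_ball : S `<=` eball 0 theta).
Hypothesis theta_ge0 : 0 <= theta.
Hypotheses (S_sym : forall x, S x -> S (- x)).
Hypothesis A_invariant : translation_invariant A.
Variables (mu : {measure set T -> \bar R}) (m : T -> R).
Hypotheses (mm : measurable_fun setT m) (m0 : forall x, 0 <= m x).
Hypothesis mu_lf : forall B : set T, measurable B -> bounded_set B -> (mu B < +oo)%E.
Hypothesis muE : forall B, measurable B -> (mu B = \int[leb]_(x in B) (m x)%:E)%E.
Context (dO : measure_display) (Omega : measurableType dO).
Variables (P : probability Omega R) (eta : Omega -> conf R d) (t r : R).
Hypotheses (t_gt0 : 0 < t) (r_gt0 : 0 < r).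
Hypothesis eta_poisson : poisson_process P (fun B => (t%:E * mu B)%E) eta.

Let nu := scaled_measure (NngNum (ltW t_gt0)) mu_lf.

Let nu_poisson : poisson_process P nu eta. Proof. exact: eta_poisson. Qed.

Lemma component_deviation_scaled (delta C0 N mean : R) :
  0 < delta -> 0 < C0 -> 0 < N ->
  (\int[P]_w component_count n.+1 S A r (eta w) = mean%:E)%E -> mean <= C0 * N ->
  exists B : set Omega, [/\ measurable B,
    (P B <= (2 * (nb_colours d n.+1 theta)%:R *
       expR (- (chernoff_rate (nb_colours d n.+1 theta) delta C0 * N)))%:E)%E &
    forall w, ~ B w -> ((mean - 2 * delta * N)%:E <= component_count n.+1 S A r (eta w)
                        <= (mean + 2 * delta * N)%:E)%E].
Proof. exact: (component_deviation d_gt0 _ mS mA ball_S S_ball theta_ge0 nu_poisson). Qed.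

Lemma mean_component_count :
  (\int[P]_w component_count n.+1 S A r (eta w) =
   ((n.+1`!%:R)^-1 * (t ^+ n.+1 * (r ^+ d) ^+ n))%:E *
   \int[leb \x tuple_measure leb n]_p (intensity S A m r (t * r ^+ d) p)%:E)%E.
Proof.
have S0 : S 0 by exact: S_zero.
have f0 : n.+1`!%:R != 0 :> R by rewrite pnatr_eq0 -lt0n fact_gt0.
have mI c : measurable_fun setT (intensity S A m r c : T * n.-tuple T -> R).
  exact: measurable_intensity.
have nuE B : measurable B -> (nu B = \int[leb]_(x in B) (t * m x)%:E)%E.
  move=> mB; transitivity (t%:E * mu B)%E => //; rewrite muE// -ge0_integralZl//.
  - by apply/measurable_EFinP; exact: measurable_funTS.
  - by move=> x _; rewrite lee_fin.
  - by rewrite lee_fin ltW.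
have mC : measurable_fun setT
    (fun w => counting (isolated_injections S n.+1 A r (eta w)) : \bar R).
  under eq_fun do rewrite counting_isolated_injections//.
  apply: measurable_funeM.
  exact: (measurable_component_count d_gt0 _ mS mA ball_S nu_poisson).
transitivity ((n.+1`!%:R^-1)%:E *
    \int[P]_w counting (isolated_injections S n.+1 A r (eta w)))%E.
  rewrite -ge0_integralZl//; last first.
    by move=> w _; exact: counting_ge0.
  apply: eq_integral => w _; rewrite counting_isolated_injections// muleA -EFinM.
  by rewrite mulVf// mul1e.
rewrite (mean_isolated n.+1 mS mA S0 (S_bounded S_ball) nu_poisson _ r_gt0); last first.
  exact: scaled_locally_finite.
rewrite (mean_intensity n mS mA S0 S_sym A_invariant _ _ nuE r_gt0); last 2 first.
- exact: measurable_funM.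
- by move=> x; rewrite mulr_ge0 ?(ltW t_gt0).
under eq_integral do rewrite intensityZ// EFinM.
rewrite ge0_integralZl//; last 3 first.
- exact/measurable_EFinP.
- by move=> p _; rewrite lee_fin intensity_ge0.
- by rewrite lee_fin exprn_ge0 ?ltW.
by rewrite !muleA -!EFinM; congr (_%:E * _)%E; ring.
Qed.

End component_mean.

(** * Dominated convergence of the means *)

Section limits.
Context (R : realType).

Lemma cvg_prod_seq (I : Type) (r : seq I) (F : I -> nat -> R) (L : I -> R) :
  (forall i, F i t @[t --> \oo] --> L i) ->
  (\prod_(i <- r) F i t) @[t --> \oo] --> \prod_(i <- r) L i.
Proof.
move=> FL; elim: r => [|i r IH].
  by rewrite big_nil; under eq_fun do rewrite big_nil; exact: cvg_cst.
by rewrite big_cons; under eq_fun do rewrite big_cons; exact: cvgM.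
Qed.

Lemma ae_fst d1 d2 (T1 : measurableType d1) (T2 : measurableType d2)
    (m1 : {sigma_finite_measure set T1 -> \bar R})
    (m2 : {sigma_finite_measure set T2 -> \bar R}) (Q : T1 -> Prop) :
  {ae m1, forall x, Q x} -> {ae (m1 \x m2)%E, forall p, Q p.1}.
Proof.
move=> [N [mN N0 QN]]; exists (N `*` setT); split.
- exact: measurableX.
- by rewrite product_measure1E// [X in (X * _)%E](N0 : _ = _) mul0e.
- by move=> p /= nQ; split=> //; exact: QN.
Qed.

End limits.

Section intensity_limit.
Context (R : realType) (d : nat).
Local Notation T := 'rV[R]_d.
Local Notation leb := (@lebesgue_rV R d).
Variables (S : set T) (A : set (conf R d)) (n : nat) (theta : R).
Hypotheses (d_gt0 : (0 < d)%N).
Hypotheses (mS : measurable S) (mA : measurable A).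
Hypotheses (ball_S : eball 0 1 `<=` S) (S_ball : S `<=` eball 0 theta).
Hypothesis theta_ge0 : 0 <= theta.
Hypothesis A_invariant : translation_invariant A.
Local Notation nbhd := (@neighbourhood R d S n.+1).
Local Notation Lam := (leb \x tuple_measure leb n)%E.
Local Notation patt := (@pattern R d S n.+1 A : n.-tuple T -> R).

Let S0 : S 0. Proof. exact: S_zero. Qed.

Lemma pattern01 (y : n.-tuple T) : patt y = 0 \/ patt y = 1.
Proof. by rewrite /pattern indicE; case: (_ \in _); [right|left]. Qed.

Lemma pattern_ge0 (y : n.-tuple T) : 0 <= patt y.
Proof. by have [->|->] := pattern01 y. Qed.

Lemma pattern_bounded (y : n.-tuple T) : patt y != 0 ->
  forall i, `|tnth y i| <= n.+1%:R * theta.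
Proof.
rewrite pattern_admissible// indicE pnatr_eq0 eqb0 negbK => /set_mem[_ conn] i.
apply: norm_rV_le => [|j]; first by rewrite mulr_ge0.
have := @connected_seq_bounded R d S S0 1 n.+1 (tcons (0 : T, y)) theta ltr01 theta_ge0
  (S_bounded S_ball) conn (tnth y i) 0.
by rewrite !inE eqxx mem_tnth orbT mul1r => /(_ isT isT j); rewrite mxE subr0.
Qed.

Lemma neighbourhood_bounded (y : n.-tuple T) : bounded_set (nbhd y).
Proof.
apply/bounded_rVP; exists (theta + \sum_(i < n) `|tnth y i|) => z.
have s0 : 0 <= \sum_(i < n) `|tnth y i| by exact: sumr_ge0.
have SB u : S u -> `|u| <= theta.
  by move=> Su; apply: norm_rV_le => //; exact: (S_bounded S_ball).
move=> /neighbourhoodP[/SB Sz|[i /SB Sz]]; first by rewrite (le_trans Sz)// lerDl.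
rewrite -(subrK (tnth y i) z) (le_trans (ler_normD _ _))// lerD//.
by rewrite (bigD1 i)//= lerDl sumr_ge0.
Qed.

Lemma neighbourhood_finite (y : n.-tuple T) : leb (nbhd y) \is a fin_num.
Proof.
rewrite ge0_fin_numE//; apply: lebesgue_bounded; last exact: neighbourhood_bounded.
exact: measurable_neighbourhood.
Qed.

Definition volume (y : n.-tuple T) : R := fine (leb (nbhd y)).

Lemma volume_ge0 y : 0 <= volume y.
Proof. by rewrite fine_ge0. Qed.

Lemma measurable_volume : measurable_fun setT volume.
Proof.
apply: (measurableT_comp (fine_measurable measurableT)).
rewrite (_ : (fun _ => _) = leb \o xsection [set q : (n.-tuple T) * T | nbhd q.1 q.2]).
  apply: measurable_fun_xsection; exact: measurable_neighbourhood_graph.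
apply/funext => y /=; congr (leb _); apply/seteqP; split=> z.
  by move=> h; apply/mem_set.
by move=> /set_mem.
Qed.

(** Connectedness to the origin confines all points to a fixed cube, so the pattern is dominated by
    the indicator of a box of finite measure. *)
Lemma integral_pattern_lty :
  (\int[tuple_measure leb n]_y (patt y)%:E < +oo)%E.
Proof.
pose K := n.+1%:R * theta; have K0 : 0 <= K by rewrite mulr_ge0.
pose B := [set y : n.-tuple T | forall i, @cube R d K (tnth y i)].
have mB : measurable B.
  rewrite (_ : B = \bigcap_(i in [set: 'I_n]) ((fun y => tnth y i) @^-1` @cube R d K)).
    apply: fin_bigcap_measurable => // i _.
    by rewrite -[X in measurable X]setTI; apply: measurable_tnth => //; exact: measurable_cube.
  by apply/seteqP; split=> y h i; [move=> _; exact: h|exact: (h i I)].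
apply: (@le_lt_trans _ _ (tuple_measure leb n B)).
  rewrite -[X in tuple_measure _ _ X]setIT -integral_indic//.
  apply: ge0_le_integral => //.
  - by move=> y _; rewrite lee_fin pattern_ge0.
  - by apply/measurable_EFinP; exact: measurable_pattern.
  - exact/measurable_EFinP.
  move=> y _; rewrite lee_fin; have [p0|p0] := eqVneq (patt y) 0.
    by rewrite p0 indicE.
  rewrite indicE mem_set; first by have [->|->] := pattern01 y.
  by move=> i j; rewrite (le_trans (coord_le_norm _ j))// pattern_bounded.
rewrite tuple_measure_box; last exact: measurable_cube.
have -> : (\prod_(i < n) leb (@cube R d K) = \prod_(i < n) ((K + K) ^+ d)%:E)%E.
  by apply: eq_bigr => i _; exact: lebesgue_cube.
by rewrite prodEFin ltry.
Qed.

Variables (M : nat -> T -> R) (e c : nat -> R) (Minf : T -> R) (cinf : R).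
Hypotheses (mM : forall t, measurable_fun setT (M t)) (M0 : forall t x, 0 <= M t x).
Hypotheses (mMinf : measurable_fun setT Minf) (Minf0 : forall x, 0 <= Minf x).
Hypotheses (e_cvg : e t @[t --> \oo] --> 0) (c_cvg : c t @[t --> \oo] --> cinf).

(** Continuous convergence at [x]: the arguments [x + e t *: z] move with [t], so pointwise
    convergence would not do. The notion covers a fixed continuous density as well as the varying
    densities of the dense regime. *)
Definition cvg_near (x : T) := forall eps, 0 < eps -> exists2 h, 0 < h &
  \forall t \near \oo, forall z, `|z - x| < h -> `|M t z - Minf x| <= eps.

Definition limit_intensity (p : T * n.-tuple T) : R :=
  patt p.2 * Minf p.1 ^+ n.+1 * expR (- (cinf * (Minf p.1 * volume p.2))).

Lemma limit_intensity_ge0 p : 0 <= limit_intensity p.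
Proof. by rewrite !mulr_ge0 ?expR_ge0 ?pattern_ge0// exprn_ge0. Qed.

Lemma measurable_limit_intensity : measurable_fun setT limit_intensity.
Proof.
have mM1 : measurable_fun setT (fun p : T * n.-tuple T => Minf p.1).
  exact: measurableT_comp.
apply: measurable_funM.
  apply: measurable_funM; last exact: measurable_funX.
  exact: (measurableT_comp (measurable_pattern mS mA S0 (n := n))).
apply: measurableT_comp => //; apply: measurableT_comp => //.
apply: measurable_funM => //; apply: measurable_funM => //.
exact: (measurableT_comp measurable_volume).
Qed.

Let shift_near (x : T) (K h : R) : 0 < h ->
  \forall t \near \oo, forall z, `|z| <= K -> `|x + e t *: z - x| < h.
Proof.
move=> h0; have K1 : 0 < `|K| + 1 by rewrite ltr_wpDl.
move/cvgrPdist_lt : e_cvg => /(_ (h / (`|K| + 1))).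
rewrite divr_gt0// => /(_ isT); apply: filterS => t.
rewrite sub0r normrN ltr_pdivlMr// => et z zK.
rewrite addrAC subrr add0r normrZ; apply: le_lt_trans et.
by rewrite ler_wpM2l// (le_trans zK)// (le_trans (ler_norm K))// lerDl.
Qed.

Lemma cvg_near_shift (x z : T) : cvg_near x -> M t (x + e t *: z) @[t --> \oo] --> Minf x.
Proof.
move=> Mx; apply/cvgrPdist_le => eps eps0; have [h h0 Mh] := Mx eps eps0.
apply: filterS2 Mh (shift_near x `|z| h0) => t Mt et.
by rewrite distrC; apply: Mt; exact: et.
Qed.

(** The neighbourhood is bounded, so for large [t] all shifted points lie in the ball given by
    [cvg_near]. The integrand is then uniformly close to the constant [Minf x] on a set of finite
    volume. *)
Lemma cvg_local_mass (x : T) (y : n.-tuple T) : cvg_near x ->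
  fine (local_mass S (M t) (e t) (x, y)) @[t --> \oo] --> Minf x * volume y.
Proof.
move=> Mx; have [K yK] : exists K, forall z, nbhd y z -> `|z| <= K.
  by have /bounded_rVP := neighbourhood_bounded y.
have v1 : 0 < volume y + 1 by rewrite ltr_wpDl// volume_ge0.
have mN := measurable_neighbourhood mS y.
apply/cvgrPdist_le => eps eps0.
have [eps' eps'0 v_eps] : exists2 eps', 0 < eps' & eps' * volume y <= eps.
  exists (eps / (volume y + 1)); first by rewrite divr_gt0.
  by rewrite mulrAC ler_pdivrMr// ler_wpM2l ?ltW// ltrDl.
have [h h0 Mh] := Mx _ eps'0.
apply: filterS2 Mh (shift_near x K h0) => t Mt et.
have close z : nbhd y z -> `|M t (x + e t *: z) - Minf x| <= eps'.
  by move=> yz; apply: Mt; apply: et; exact: yK.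
have volE : leb (nbhd y) = (volume y)%:E by rewrite fineK// neighbourhood_finite.
have mMt : measurable_fun (nbhd y) (fun z => (M t (x + e t *: z))%:E).
  apply/measurable_EFinP; apply: measurable_funTS; apply: measurableT_comp => //.
  by apply: measurable_fun_rVD => //; exact: measurable_fun_rVZ.
set I := local_mass _ _ _ _.
have I0 : (0 <= I)%E by apply: integral_ge0 => z _; rewrite lee_fin.
have up : (I <= ((Minf x + eps') * volume y)%:E)%E.
  rewrite EFinM -volE -integral_cst//; apply: ge0_le_integral => //.
    by move=> z _; rewrite lee_fin.
  move=> z yz; rewrite lee_fin; have := close z yz.
  by rewrite ler_norml => /andP[_]; rewrite lerBlDl.
have lo : ((Minf x * volume y)%:E <= I + (eps' * volume y)%:E)%E.
  rewrite !EFinM -volE -!integral_cst// -ge0_integralD//.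
  - apply: ge0_le_integral => //.
    + by move=> z _; rewrite lee_fin.
    + exact: emeasurable_funD.
    move=> z yz; rewrite -EFinD lee_fin; have := close z yz.
    by rewrite ler_norml => /andP[+ _]; rewrite lerNl opprB lerBlDl.
  - by move=> z _; rewrite lee_fin.
  - by move=> z _; rewrite lee_fin ltW.
have Ifin : I \is a fin_num by rewrite ge0_fin_numE// (le_lt_trans up)// ltry.
move: up lo; rewrite -(fineK Ifin) -EFinD !lee_fin.
move: (fine I) => f /=; rewrite mulrDl => up lo.
by rewrite ler_norml; apply/andP; split; lra.
Qed.

Lemma cvg_intensity (x : T) (y : n.-tuple T) : cvg_near x ->
  intensity S A (M t) (e t) (c t) (x, y) @[t --> \oo] --> limit_intensity (x, y).
Proof.
move=> Mx; apply: cvgM; first apply: cvgM; first exact: cvg_cst.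
  rewrite exprS; apply: cvgM => /=.
    have := @cvg_near_shift x 0 Mx; under eq_fun do rewrite scaler0 addr0.
    exact.
  have -> : Minf x ^+ n = \prod_(i < n) Minf x by rewrite prodr_const card_ord.
  by apply: cvg_prod_seq => i; exact: cvg_near_shift.
apply: continuous_cvg; first exact: continuous_expR.
by apply: cvgN; apply: cvgM => //; exact: cvg_local_mass.
Qed.

Variables (C p : R).
Hypotheses (C0 : 0 <= C) (dp : d%:R < p).
Hypothesis cvg_nearM : {ae leb, forall x, cvg_near x}.
Hypothesis domination : \forall t \near \oo, forall q,
  intensity S A (M t) (e t) (c t) q <= C * (patt q.2 * (1 + `|q.1|) `^ (- p)).

Let bound (q : T * n.-tuple T) : R := C * (patt q.2 * (1 + `|q.1|) `^ (- p)).

Let bound_ge0 q : 0 <= bound q.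
Proof. by rewrite !mulr_ge0 ?pattern_ge0 ?powR_ge0. Qed.

Let measurable_bound : measurable_fun setT bound.
Proof.
apply: measurable_funM => //; apply: measurable_funM.
  exact: (measurableT_comp (measurable_pattern mS mA S0 (n := n))).
apply: (measurableT_comp (measurable_powR (- p))).
by apply: measurable_funD => //; apply: (measurableT_comp (@measurable_norm_rV R d)).
Qed.

(** The bound is a product of a function of the relative positions, integrable by
    [integral_pattern_lty], and a decaying function of the first point. *)
Let integrable_bound : Lam.-integrable setT (EFin \o bound).
Proof.
apply/integrableP; split; first exact/measurable_EFinP.
have m1 : measurable_fun setT (fun x : T => (1 + `|x|) `^ (- p)).
  apply: (measurableT_comp (measurable_powR (- p))).
  by apply: measurable_funD => //; exact: measurable_norm_rV.
under eq_integral do rewrite /= ger0_norm//.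
rewrite fubini_tonelli1//=; last exact/measurable_EFinP.
pose J := (\int[tuple_measure leb n]_y (patt y)%:E)%E.
have J0 : (0 <= J)%E by apply: integral_ge0 => y _; rewrite lee_fin pattern_ge0.
have Jfin : J \is a fin_num by rewrite ge0_fin_numE// integral_pattern_lty.
rewrite /fubini_F (eq_integral (fun x : T => (C * fine J)%:E * ((1 + `|x|) `^ (- p))%:E)%E).
  rewrite ge0_integralZl//.
  - apply: lte_mul_pinfty => //; last exact: integral_decay.
    by rewrite lee_fin mulr_ge0// fine_ge0.
  - exact/measurable_EFinP.
  - by rewrite lee_fin mulr_ge0// fine_ge0.
move=> x _; transitivity (\int[tuple_measure leb n]_y
    ((C * (1 + `|x|) `^ (- p))%:E * (patt y)%:E))%E.
  by apply: eq_integral => y _; rewrite /bound/= -EFinM; congr EFin; ring.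
rewrite ge0_integralZl//.
- by rewrite -/J -(fineK Jfin) -!EFinM; congr EFin; ring.
- by apply/measurable_EFinP; exact: measurable_pattern.
- by move=> y _; rewrite lee_fin pattern_ge0.
- by rewrite lee_fin mulr_ge0// powR_ge0.
Qed.

Lemma cvg_integral_intensity :
  Lam.-integrable setT (EFin \o limit_intensity) /\
  (\int[Lam]_q (intensity S A (M t) (e t) (c t) q)%:E)%E @[t --> \oo] -->
    (\int[Lam]_q (limit_intensity q)%:E)%E.
Proof.
(* Dominated convergence asks for the bound at every index, so the sequence is shifted past the
   index from which domination holds. *)
have [N _ dom] := domination.
have [] := @dominated_convergence _ _ R Lam setT measurableT
  (fun t q => (intensity S A (M (t + N)) (e (t + N)) (c (t + N)) q)%:E)
  (EFin \o limit_intensity) (EFin \o bound).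
- by move=> t; apply/measurable_EFinP; exact: measurable_intensity.
- by apply/measurable_EFinP; exact: measurable_limit_intensity.
- apply: filterS (ae_fst (tuple_measure leb n) cvg_nearM) => -[x y] /= Mx _.
  apply: cvg_EFin; first exact: nearW.
  rewrite (cvg_shiftn N (fun t => intensity S A (M t) (e t) (c t) (x, y))).
  exact: cvg_intensity.
- exact: integrable_bound.
- apply: aeW => q t _ /=; rewrite lee_fin ger0_norm ?intensity_ge0//.
  by apply: dom => /=; rewrite leq_addl.
move=> i1 _ i2; split; first exact: i1.
rewrite -(cvg_shiftn N); exact: i2.
Qed.

End intensity_limit.

Lemma powR_exprn (R : realType) (x a : R) k : (x `^ (- a)) ^+ k = x `^ (- (a * k%:R)).
Proof. by rewrite -powR_mulrn ?powR_ge0// -powRrM mulNr. Qed.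

(** * Integrable bounds *)

Section domination.
Context (R : realType) (d : nat).
Local Notation T := 'rV[R]_d.
Local Notation leb := (@lebesgue_rV R d).
Variables (S : set T) (A : set (conf R d)) (n : nat) (theta : R).
Hypotheses (d_gt0 : (0 < d)%N).
Hypotheses (mS : measurable S) (mA : measurable A).
Hypotheses (ball_S : eball 0 1 `<=` S) (S_ball : S `<=` eball 0 theta).
Hypothesis theta_ge0 : 0 <= theta.
Hypothesis A_invariant : translation_invariant A.
Implicit Types (M : T -> R).
Local Notation patt := (@pattern R d S n.+1 A : n.-tuple T -> R).

Lemma norm_le_enorm (x : T) : `|x| <= enorm x.
Proof.
apply: norm_rV_le => [|j]; first exact: sqrtr_ge0.
exact: coord_le_enorm.
Qed.

Lemma enorm_le_norm (x : T) : enorm x <= d%:R * `|x|.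
Proof. by apply: enorm_le => // j; exact: coord_le_norm. Qed.

Lemma density_product_le M e U (x : T) (y : n.-tuple T) : (forall x, 0 <= M x) ->
  (forall z, `|z| <= n.+1%:R * theta -> M (x + e *: z) <= U) ->
  patt y * density_product M e (x, y) <= patt y * U ^+ n.+1.
Proof.
move=> M0 MU; have [->|p0] := eqVneq (patt y) 0; first by rewrite !mul0r.
have yK := pattern_bounded d_gt0 ball_S S_ball theta_ge0 p0.
apply: ler_wpM2l; first exact: pattern_ge0.
rewrite /density_product exprS /=; apply: ler_pM => //.
- exact: prodr_ge0.
- by have := MU 0; rewrite normr0 scaler0 addr0; apply; rewrite mulr_ge0.
rewrite (_ : U ^+ n = \prod_(i < n) U); last by rewrite prodr_const card_ord.
by apply: ler_prod => i _; rewrite M0/=; apply: MU.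
Qed.

Lemma local_mass_ge0 M e (q : T * n.-tuple T) : (forall x, 0 <= M x) ->
  (0 <= local_mass S M e q)%E.
Proof. by move=> M0; apply: integral_ge0 => z _; rewrite lee_fin. Qed.

Lemma norm_shift_le (K e : R) (x z : T) (w : R) : `|z| <= K -> 0 <= e -> e * K <= w / 2 ->
  (`|x| + w) / 2 <= `|x + e *: z| + w.
Proof.
move=> zK e0 eK.
have : `|x| <= `|x + e *: z| + e * `|z|.
  rewrite -[leLHS](_ : `|(x + e *: z) - e *: z| = _); last by rewrite addrK.
  by rewrite (le_trans (ler_normB _ _))// normrZ (ger0_norm e0).
have := ler_wpM2l e0 zK; have := normr_ge0 x.
by move: (`|x|) (`|_ + _|) (e * `|z|) (e * K) eK => a b c f; lra.
Qed.

(** Shifts of length at most [1 / 2] can at most halve [1 + |x|], which costs a factor [2 ^ gamma]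
    per point. The exponential is bounded by one. *)
Lemma domination_decay M e c (alpha gamma : R) (q : T * n.-tuple T) :
  (forall x, 0 <= M x) -> 0 < alpha -> 0 < gamma -> 0 <= c -> 0 <= e ->
  e * (n.+1%:R * theta) <= 1 / 2 ->
  (forall x, M x <= alpha * (enorm x + 1) `^ (- gamma)) ->
  intensity S A M e c q <= (alpha * 2 `^ gamma) ^+ n.+1 *
     (patt q.2 * (1 + `|q.1|) `^ (- (gamma * n.+1%:R))).
Proof.
move=> M0 a0 g0 c0 e0 eK Mle; case: q => x y /=.
have x1 : 0 < 1 + `|x| by rewrite ltr_pwDl.
pose U := alpha * 2 `^ gamma * (1 + `|x|) `^ (- gamma).
have MU z : `|z| <= n.+1%:R * theta -> M (x + e *: z) <= U.
  move=> zK; rewrite (le_trans (Mle _))// /U -mulrA ler_wpM2l ?(ltW a0)//.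
  have -> : 2 `^ gamma * (1 + `|x|) `^ (- gamma) = ((1 + `|x|) / 2) `^ (- gamma).
    by rewrite powRM ?ltW// ?invr_ge0// mulrC -powR_inv1// -powRrM mulN1r opprK.
  apply: ler_powRN; rewrite ?(ltW g0)// ?divr_gt0//.
  rewrite addrC (le_trans (norm_shift_le x zK e0 eK))// lerD2r.
  exact: norm_le_enorm.
rewrite (_ : _ * (patt y * _) = patt y * U ^+ n.+1); last first.
  by rewrite /U [in RHS]exprMn powR_exprn mulrCA.
rewrite /intensity (le_trans _ (density_product_le y M0 MU))//.
rewrite ler_piMr//; first by rewrite mulr_ge0 ?pattern_ge0// mulr_ge0 ?prodr_ge0.
by rewrite -expR0 ler_expR oppr_le0 mulr_ge0// fine_ge0// local_mass_ge0.
Qed.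

Lemma eball_norm (z : T) : eball 0 1 z -> `|z| <= 1.
Proof. by rewrite /eball/= subr0; exact: le_trans (norm_le_enorm z). Qed.

Lemma unit_ball_volume : leb (eball 0 1) = (fine (leb (eball 0 1)))%:E.
Proof.
rewrite fineK// ge0_fin_numE//; apply: lebesgue_bounded; first exact: measurable_eball.
by apply/bounded_rVP; exists 1 => z; exact: eball_norm.
Qed.

Lemma unit_ball_volume_gt0 : 0 < fine (leb (eball 0 1)).
Proof. by rewrite -lte_fin -unit_ball_volume; exact: lebesgue_ball_gt0. Qed.

Lemma local_mass_lty M e B (q : T * n.-tuple T) : measurable_fun setT M ->
  (forall x, 0 <= M x <= B) -> (local_mass S M e q < +oo)%E.
Proof.
move=> mM MB; apply: (@le_lt_trans _ _ (\int[leb]_(z in @neighbourhood R d S n.+1 q.2) B%:E)%E).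
  apply: ge0_le_integral => //.
  - exact: measurable_neighbourhood.
  - by move=> z _; rewrite lee_fin; have /andP[] := MB (q.1 + e *: z).
  - apply/measurable_EFinP; apply: measurable_funTS; apply: measurableT_comp => //.
    by apply: measurable_fun_rVD => //; exact: measurable_fun_rVZ.
  - by move=> z _; rewrite lee_fin; have /andP[] := MB (q.1 + e *: z).
rewrite integral_cst; last exact: measurable_neighbourhood.
apply: lte_mul_pinfty => //.
  by have /andP[h1 h2] := MB 0; rewrite lee_fin (le_trans h1).
by have := neighbourhood_finite mS S_ball theta_ge0 q.2; rewrite ge0_fin_numE.
Qed.

Lemma local_mass_ge M e L (q : T * n.-tuple T) : measurable_fun setT M ->
  (forall x, 0 <= M x) -> 0 <= L -> (forall z, `|z| <= 1 -> L <= M (q.1 + e *: z)) ->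
  ((L * fine (leb (eball 0 1)))%:E <= local_mass S M e q)%E.
Proof.
move=> mM M0 L0 ML; rewrite EFinM -unit_ball_volume.
have mMe : measurable_fun setT (fun z : T => (M (q.1 + e *: z))%:E).
  apply/measurable_EFinP; apply: measurableT_comp => //.
  by apply: measurable_fun_rVD => //; exact: measurable_fun_rVZ.
have mB := @measurable_eball R d 0 1.
rewrite -integral_cst//.
apply: (@le_trans _ _ (\int[leb]_(z in eball 0 1) (M (q.1 + e *: z))%:E)%E).
  apply: ge0_le_integral => //.
  - exact: measurable_funTS.
  - by move=> z /eball_norm z1; rewrite lee_fin ML.
apply: ge0_subset_integral => //.
- exact: measurable_neighbourhood.
- exact: measurable_funTS.
- by move=> z _; rewrite lee_fin.
- by move=> z /ball_S Sz; left.
Qed.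

(** A single term of the exponential series: [(b v) ^ (k+1) / (k+1)! <= exp (b v)]. *)
Lemma pow_expRN_le (k : nat) (v b : R) : 0 < b -> 0 <= v ->
  v ^+ k.+1 * expR (- (b * v)) <= k.+1`!%:R / b ^+ k.+1.
Proof.
move=> b0 v0; have bv0 : 0 <= b * v by rewrite mulr_ge0 ?(ltW b0).
have f0 : 0 < k.+1`!%:R :> R by rewrite ltr0n fact_gt0.
have := expR_ge1Dxn k bv0; rewrite exprMn => h.
rewrite expRN ler_pdivlMr ?exprn_gt0// mulrAC ler_pdivrMr ?expR_gt0//.
rewrite -ler_pdivrMl// mulrC [v ^+ _ * _]mulrC.
by apply: le_trans h; rewrite ler_wpDl.
Qed.

(** With [w = |x| + 1 / s], every [z] in the unit ball satisfies [enorm (x + e *: z) + 1 / s <= (d +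
    1) * w]: a factor [d] from comparing norms, one more [w] for the summand [1 / s]. As [S]
    contains the unit ball, the local mass is at least [dense_rate * w ^ (- gamma)]. *)
Definition dense_rate (alpha gamma : R) : R :=
  alpha * d.+1%:R `^ (- gamma) * fine (leb (eball 0 1)).

(* Near the origin only the exponential factor keeps the intensity bounded; away
   from it the decay of the density suffices. *)
Lemma domination_dense (alpha gamma s r : R) (q : T * n.-tuple T) :
  0 < alpha -> 0 < gamma -> 0 < s -> 0 < r -> r <= 1 ->
  r * (n.+1%:R * theta) <= 1 / 2 ->
  intensity S A (fun u => alpha * (enorm u + s^-1) `^ (- gamma)) (r / s) 1 q <=
  (alpha * 2 `^ gamma) ^+ n.+1 * 2 `^ (gamma * n.+1%:R) *
    (1 + n.+1`!%:R / dense_rate alpha gamma ^+ n.+1) *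
    (patt q.2 * (1 + `|q.1|) `^ (- (gamma * n.+1%:R))).
Proof.
move=> a0 g0 s0 r0 r1 rK; set b := dense_rate _ _; case: q => x y /=.
set M := fun u => _; set e := r / s; set p := gamma * n.+1%:R.
have si0 : 0 < s^-1 by rewrite invr_gt0.
have e0 : 0 <= e by rewrite divr_ge0 ?ltW.
have M0 u : 0 <= M u by rewrite mulr_ge0 ?powR_ge0 ?(ltW a0).
pose w := `|x| + s^-1; have w0 : 0 < w by rewrite ltr_wpDl.
pose v := w `^ (- gamma); have v0 : 0 <= v by exact: powR_ge0.
pose U := alpha * 2 `^ gamma * v.
have U0 : 0 <= U by rewrite !mulr_ge0 ?powR_ge0 ?(ltW a0).
have p0 : 0 <= p by rewrite mulr_ge0 ?(ltW g0).
have MU z : `|z| <= n.+1%:R * theta -> M (x + e *: z) <= U.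
  move=> zK; rewrite /M /U -mulrA ler_wpM2l ?(ltW a0)//.
  have -> : 2 `^ gamma * v = (w / 2) `^ (- gamma).
    by rewrite powRM ?(ltW w0)// ?invr_ge0// mulrC -powR_inv1// -powRrM mulN1r opprK.
  apply: ler_powRN; rewrite ?(ltW g0)// ?divr_gt0//.
  rewrite (le_trans (norm_shift_le x zK e0 _))// ?lerD2r ?norm_le_enorm//.
  by rewrite /e mulrAC [_ / s]mulrC [_ / 2]mulrC -[leRHS]mulrC ler_wpM2l ?(ltW si0)// -div1r.
have mM : measurable_fun setT M.
  apply: measurable_funM => //; apply: (measurableT_comp (measurable_powR (- gamma))).
  by apply: measurable_funD => //; exact: measurable_enorm.
have exp_le : expR (- (1 * fine (local_mass S M e (x, y)))) <= expR (- (b * v)).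
  rewrite ler_expR lerN2 mul1r -lee_fin fineK; last first.
    rewrite ge0_fin_numE ?local_mass_ge0//.
    apply: (@local_mass_lty _ _ (alpha * s^-1 `^ (- gamma))) => // u.
    rewrite M0 ler_wpM2l ?(ltW a0)//; apply: ler_powRN; rewrite ?(ltW g0)//.
    by rewrite lerDr sqrtr_ge0.
  have -> : b * v = alpha * (d.+1%:R * w) `^ (- gamma) * fine (leb (eball 0 1)).
    by rewrite /b /dense_rate powRM ?(ltW w0)// [alpha * (_ * _)]mulrA mulrAC.
  apply: local_mass_ge => //; first by rewrite mulr_ge0 ?powR_ge0 ?(ltW a0).
  move=> z z1; rewrite ler_wpM2l ?(ltW a0)//; apply: ler_powRN; rewrite ?(ltW g0)//=.
    by rewrite ltr_wpDl// sqrtr_ge0.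
  have h : `|x + e *: z| <= w.
    rewrite (le_trans (ler_normD _ _))// lerD2l normrZ ger0_norm//.
    rewrite (le_trans (ler_wpM2l e0 z1))// mulr1 /e -[leRHS]mul1r.
    by rewrite ler_wpM2r// ltW.
  rewrite -natr1 mulrDl mul1r lerD//; last by rewrite lerDr.
  by rewrite (le_trans (enorm_le_norm _))// ler_wpM2l.
have int_le : intensity S A M e 1 (x, y) <=
    patt y * ((alpha * 2 `^ gamma) ^+ n.+1 * (v ^+ n.+1 * expR (- (b * v)))).
  rewrite [_ ^+ _ * (_ * _)]mulrA -exprMn -/U mulrA /intensity.
  apply: ler_pM => //; last exact: density_product_le.
  by rewrite mulr_ge0 ?pattern_ge0// mulr_ge0 ?prodr_ge0.
apply: (le_trans int_le); set C1 := _ ^+ n.+1.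
have C10 : 0 <= C1 by rewrite exprn_ge0// mulr_ge0 ?powR_ge0 ?(ltW a0).
rewrite [leRHS](_ : _ = patt y * (C1 *
  (2 `^ p * (1 + n.+1`!%:R / b ^+ n.+1) * (1 + `|x|) `^ (- p)))); last by ring.
apply: ler_wpM2l; first exact: pattern_ge0.
apply: ler_wpM2l => //.
have b0 : 0 < b.
  by rewrite !mulr_gt0 ?powR_gt0// unit_ball_volume_gt0.
have k0 : 0 <= n.+1`!%:R / b ^+ n.+1 by rewrite divr_ge0 ?exprn_ge0 ?(ltW b0).
have half z : 0 < z -> 2 `^ p * z `^ (- p) = (z / 2) `^ (- p).
  by move=> z0; rewrite powRM ?(ltW z0)// ?invr_ge0// mulrC -powR_inv1// -powRrM mulN1r opprK.
have x1 : 0 < 1 + `|x| by rewrite ltr_pwDl.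
rewrite [leRHS]mulrAC half// mulrDr mulr1.
(* If [|x| >= 1] then [w >= (1 + |x|) / 2]. Otherwise [((1 + |x|) / 2) ^ (- p) >= 1], and the
   product of power and exponential is bounded by a constant. *)
have [xge|xlt] := leP 1 `|x|.
  apply: ler_wpDr; first by rewrite mulr_ge0 ?powR_ge0.
  rewrite powR_exprn -/p (@le_trans _ _ (w `^ (- p)))//.
    by rewrite ler_piMr ?powR_ge0// -expR0 ler_expR oppr_le0 mulr_ge0// ltW.
  apply: ler_powRN; rewrite ?divr_gt0//.
  by rewrite /w; move: xge si0; lra.
apply: ler_wpDl; first exact: powR_ge0.
rewrite (le_trans (pow_expRN_le _ b0 v0))// ler_peMl//.
apply: (@le_trans _ _ (1 `^ (- p))); first by rewrite powR1.
by apply: ler_powRN; rewrite ?divr_gt0//; move: xlt; lra.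
Qed.

End domination.

Lemma lebesgue_rV_dilate (R : realType) (d : nat) (s : R) (f g : 'rV[R]_d -> \bar R) :
  0 < s -> measurable_fun setT f -> measurable_fun setT g ->
  (forall x, (0 <= f x)%E) -> (forall x, (0 <= g x)%E) ->
  (forall x, f (s *: x) = g x) ->
  (\int[lebesgue_rV]_x f x = (s ^+ d)%:E * \int[lebesgue_rV]_x g x)%E.
Proof.
move=> s0 mf mg f0 g0 fg; rewrite (lebesgue_rV_affine 0 s0)//.
rewrite -ge0_integralZl//; last by rewrite lee_fin exprn_ge0// ltW.
by apply: eq_integral => x _; rewrite add0r fg.
Qed.

(** * The three regimes *)

Section component_ratio.
Context (R : realType) (d : nat).
Local Notation T := 'rV[R]_d.
Local Notation leb := (@lebesgue_rV R d).
Variables (S : set T) (A : set (conf R d)) (n : nat) (theta : R).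
Hypotheses (d_gt0 : (0 < d)%N).
Hypotheses (mS : measurable S) (mA : measurable A).
Hypotheses (ball_S : eball 0 1 `<=` S) (S_ball : S `<=` eball 0 theta).
Hypothesis theta_ge0 : 0 <= theta.
Hypotheses (S_sym : forall x, S x -> S (- x)).
Hypothesis A_invariant : translation_invariant A.
Variables (mu : {measure set T -> \bar R}).
Hypothesis mu_lf : forall B : set T, measurable B -> bounded_set B -> (mu B < +oo)%E.
Context (dO : measure_display) (Omega : measurableType dO).
Variables (P : probability Omega R) (eta : nat -> Omega -> conf R d) (rho : nat -> R).
Hypothesis eta_poisson : forall t, (0 < t)%N ->
  poisson_process P (fun B => (t%:R%:E * mu B)%E) (eta t).
Hypothesis rho_gt0 : forall t, (0 < t)%N -> 0 < rho t.

(** The common end of all regimes: once the mean is [a * N t * J t] with [J t] convergent,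
    eventually it is at most [(|a * L| + 1) * N t], so deviations are exponentially small in
    [N t]. *)
Lemma component_ratio_cvg (N : nat -> R) (J : nat -> \bar R) (a L : R) :
  N t / ln t%:R @[t --> \oo] --> +oo ->
  (\forall t \near \oo, \int[P]_w component_count n.+1 S A (rho t) (eta t w) =
    (a * N t)%:E * J t)%E ->
  J t @[t --> \oo] --> L%:E ->
  {ae P, forall w, (component_count n.+1 S A (rho t) (eta t w) * ((N t)^-1)%:E)%E
     @[t --> \oo] --> (a * L)%:E}.
Proof.
move=> NL meanE JL.
have /fine_cvgP[Jfin fJL] := JL.
pose mean t := a * N t * fine (J t).
have mean_cvg : mean t / N t @[t --> \oo] --> a * L.
  have aJ : a * fine (J t) @[t --> \oo] --> a * L by exact: cvgMr.
  apply: cvg_trans aJ; apply: near_eq_cvg.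
  move/cvgryPgt : NL => /(_ 0); apply: filterS => t h; rewrite /mean.
  have N0 : N t != 0 by apply: contraTneq h => ->; rewrite mul0r ltxx.
  by rewrite [a * N t]mulrC -[N t * a * _]mulrA [RHS]mulrC mulKf.
pose C0 := `|a * L| + 1; have C00 : 0 < C0 by rewrite ltr_wpDl.
pose col := nb_colours d n.+1 theta.
apply: (@ae_ratio_cvg R dO Omega P _ mean N (a * L) (2 * col%:R)
  (fun delta => chernoff_rate col (delta / 2) C0)) => //.
- by move=> delta delta0; apply: chernoff_rate_gt0 => //; [exact: nb_colours_gt0|rewrite divr_gt0].
move=> delta delta0.
move/cvgrPdist_le : mean_cvg => /(_ 1 ltr01) near1.
apply: filterS3 near1 (filterI meanE Jfin) (nbhs_infty_gt 0) => t close [meanEt Jt] t0 N0.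
have meanN : mean t <= C0 * N t.
  rewrite -ler_pdivrMr//; move: close; rewrite distrC => /(le_trans (ler_norm _)) h.
  by rewrite /C0; have := ler_norm (a * L); move: h; lra.
have meanE' : (\int[P]_w component_count n.+1 S A (rho t) (eta t w) = (mean t)%:E)%E.
  by rewrite meanEt /mean -{1}(fineK Jt) -EFinM.
have d2 : 0 < delta / 2 by rewrite divr_gt0.
have tR : 0 < t%:R :> R by rewrite ltr0n.
have [B [mB PB dev]] := component_deviation_scaled d_gt0 mS mA ball_S S_ball theta_ge0 mu_lf
  tR (rho_gt0 t0) (eta_poisson t0) d2 C00 N0 meanE' meanN.
by exists B; split => // w /dev; rewrite mulrCA divff ?mulr1.
Qed.

(** Only the first point is rescaled, the relative positions are kept. Since
    [s (x + (r / s) z) = s x + r z], the shift scale becomes [r / s]. *)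
Lemma integral_intensity_dilate (M : T -> R) (r c s : R) : 0 < s ->
  measurable_fun setT M -> (forall x, 0 <= M x) ->
  (\int[leb \x tuple_measure leb n]_p (intensity S A M r c p)%:E =
   (s ^+ d)%:E * \int[leb \x tuple_measure leb n]_p
     (intensity S A (fun u => M (s *: u)) (r / s) c p)%:E)%E.
Proof.
move=> s0 mM M0.
have mMs : measurable_fun setT (fun u : T => M (s *: u)).
  by apply: measurableT_comp => //; exact: measurable_fun_rVZ.
have Ms0 (u : T) : 0 <= M (s *: u) by [].
have S0 : S 0 by exact: S_zero.
have mI1 : measurable_fun setT (EFin \o intensity S A M r c : T * n.-tuple T -> \bar R).
  by apply/measurable_EFinP; exact: measurable_intensity.
have mI2 : measurable_fun setT
    (EFin \o intensity S A (fun u => M (s *: u)) (r / s) c : T * n.-tuple T -> \bar R).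
  by apply/measurable_EFinP; exact: measurable_intensity.
have sd0 : (0 <= (s ^+ d)%:E :> \bar R)%E by rewrite lee_fin exprn_ge0// ltW.
have I0 (M' : T -> R) r' p : (forall x, 0 <= M' x) ->
    (0 <= (EFin \o intensity S A M' r' c : T * n.-tuple T -> \bar R) p)%E.
  by move=> M'0; rewrite lee_fin intensity_ge0.
rewrite (fubini_tonelli1 _ mI1); last by move=> p; exact: I0.
rewrite (fubini_tonelli1 _ mI2); last by move=> p; exact: I0.
apply: (lebesgue_rV_dilate s0).
- by apply: (measurable_fun_fubini_tonelli_F _ mI1) => p; exact: I0.
- by apply: (measurable_fun_fubini_tonelli_F _ mI2) => p; exact: I0.
- by move=> x; apply: integral_ge0 => y _; exact: I0.
- by move=> x; apply: integral_ge0 => y _; exact: I0.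
move=> x; apply: eq_integral => y _; congr EFin.
have shift (z : T) : s *: (x + r / s *: z) = s *: x + r *: z.
  by rewrite scalerDr scalerA mulrCA divff ?mulr1// gt_eqF.
rewrite /intensity /density_product /local_mass /=; congr (_ * (_ * _) * expR (- (_ * fine _))).
  by apply: eq_bigr => i _; rewrite shift.
by apply: eq_integral => z _; rewrite shift.
Qed.

End component_ratio.

Section regimes.
Context (R : realType) (d : nat).
Local Notation T := 'rV[R]_d.
Local Notation leb := (@lebesgue_rV R d).
Variables (S : set T) (A : set (conf R d)) (n : nat) (theta : R).
Hypotheses (d_gt0 : (0 < d)%N).
Hypotheses (mS : measurable S) (mA : measurable A).
Hypotheses (ball_S : eball 0 1 `<=` S) (S_ball : S `<=` eball 0 theta).
Hypothesis theta_ge0 : 0 <= theta.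
Hypotheses (S_sym : forall x, S x -> S (- x)).
Hypothesis A_invariant : translation_invariant A.
Variables (mu : {measure set T -> \bar R}) (m : T -> R).
Hypotheses (mm : measurable_fun setT m) (m0 : forall x, 0 <= m x).
Hypothesis mu_lf : forall B : set T, measurable B -> bounded_set B -> (mu B < +oo)%E.
Hypothesis muE : forall B, measurable B -> (mu B = \int[leb]_(x in B) (m x)%:E)%E.
Context (dO : measure_display) (Omega : measurableType dO).
Variables (P : probability Omega R) (eta : nat -> Omega -> conf R d) (rho : nat -> R).
Hypothesis eta_poisson : forall t, (0 < t)%N ->
  poisson_process P (fun B => (t%:R%:E * mu B)%E) (eta t).
Hypothesis rho_gt0 : forall t, (0 < t)%N -> 0 < rho t.
Hypothesis rho_cvg0 : rho t @[t --> \oo] --> 0.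
Local Notation Lam := (leb \x tuple_measure leb n)%E.
Local Notation lim_int M c := (\int[Lam]_q (@limit_intensity R d S A n M c q)%:E)%E.

Lemma rho_small (K h : R) : 0 < h -> \forall t \near \oo, rho t * K <= h.
Proof.
move=> h0; have K1 : 0 < `|K| + 1 by rewrite ltr_wpDl.
move/cvgrPdist_le : rho_cvg0 => /(_ (h / (`|K| + 1))).
rewrite divr_gt0// => /(_ isT); apply: filterS2 (nbhs_infty_gt 0) => t t0.
rewrite sub0r normrN ler_pdivlMr// (gtr0_norm (rho_gt0 t0)); apply: le_trans.
by rewrite ler_wpM2l ?(ltW (rho_gt0 t0))// (le_trans (ler_norm K))// lerDl.
Qed.

Lemma cvg_near_cst (x : T) : {for x, continuous m} -> cvg_near (fun=> m) m x.
Proof.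
move=> cm eps eps0; move/cvgrPdist_le : cm => /(_ eps eps0) /nbhs_normP[h /= h0 hm].
exists h => //; apply: nearW => _ z xz; rewrite distrC; apply: hm.
by rewrite /= distrC.
Qed.

(** Sparse and thermodynamic regimes together: the value of [c], zero or positive, is felt only in
    the exponential factor of the limit. *)
Lemma decay_regime (alpha gamma c : R) :
  {ae leb, forall x, {for x, continuous m}} ->
  0 < alpha -> 0 < gamma -> d%:R < gamma * n.+1%:R ->
  (forall x, m x <= alpha * (enorm x + 1) `^ (- gamma)) ->
  t%:R * rho t ^+ d @[t --> \oo] --> c ->
  t%:R ^+ n.+1 * (rho t ^+ d) ^+ n / ln t%:R @[t --> \oo] --> +oo ->
  lim_int m c \is a fin_num /\
  {ae P, forall w, (component_count n.+1 S A (rho t) (eta t w) *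
      ((t%:R ^+ n.+1 * (rho t ^+ d) ^+ n)^-1)%:E)%E @[t --> \oo] -->
    ((n.+1`!%:R^-1)%:E * lim_int m c)%E}.
Proof.
move=> cm a0 g0 dg mle cc NL.
have C0 : 0 <= (alpha * 2 `^ gamma) ^+ n.+1.
  by rewrite exprn_ge0// mulr_ge0 ?powR_ge0 ?(ltW a0).
have [||int_lim cvg_lim] := @cvg_integral_intensity R d S A n theta d_gt0 mS mA ball_S
  S_ball theta_ge0 (fun=> m) rho (fun t => t%:R * rho t ^+ d) m c (fun=> mm) (fun=> m0)
  mm m0 rho_cvg0 cc _ _ C0 dg.
- by apply: filterS cm => x; exact: cvg_near_cst.
- apply: filterS2 (nbhs_infty_gt 0) (rho_small (n.+1%:R * theta) (_ : 0 < 1 / 2)).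
    move=> t t0 rs q; apply: (domination_decay A d_gt0 ball_S S_ball theta_ge0) => //.
    + by rewrite mulr_ge0// exprn_ge0// ltW// rho_gt0.
    + by rewrite ltW// rho_gt0.
  by rewrite divr_gt0.
have Lfin : lim_int m c \is a fin_num by exact: (integrable_fin_num measurableT int_lim).
split => //; rewrite -(fineK Lfin) -EFinM.
apply: (component_ratio_cvg d_gt0 mS mA ball_S S_ball theta_ge0 mu_lf eta_poisson rho_gt0 NL).
  apply: filterS (nbhs_infty_gt 0) => t t0.
  by apply: (mean_component_count n d_gt0 mS mA ball_S S_ball S_sym A_invariant mm m0 mu_lf
    muE _ (rho_gt0 t0) (eta_poisson t0)); rewrite ltr0n.
by rewrite (fineK Lfin); exact: cvg_lim.
Qed.

Lemma enormZ (s : R) (u : T) : 0 <= s -> enorm (s *: u) = s * enorm u.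
Proof.
move=> s0; rewrite /enorm; under eq_bigr do rewrite mxE exprMn.
by rewrite -mulr_sumr sqrtrM ?sqr_ge0// sqrtr_sqr ger0_norm.
Qed.

Lemma continuous_enorm : continuous (@enorm R d).
Proof.
have sum_cont : continuous (fun u : T => \sum_(j < d) u 0 j ^+ 2).
  apply: continuous_big; first exact: add_continuous.
  move=> j _ u; apply: (@continuous_comp _ _ _ (fun u : T => u 0 j) (fun a => a ^+ 2)).
    exact: coord_continuous.
  exact: exprn_continuous.
move=> x; apply: continuous_comp; last exact: sqrt_continuous.
exact: sum_cont.
Qed.

Lemma cvg_near_powR (alpha gamma : R) (s : nat -> R) (x : T) : 0 < gamma ->
  (s t)^-1 @[t --> \oo] --> 0 -> x != 0 ->
  cvg_near (fun t u => alpha * (enorm u + (s t)^-1) `^ (- gamma))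
    (fun u => alpha * enorm u `^ (- gamma)) x.
Proof.
move=> g0 s0 x0.
have ex0 : 0 < enorm x.
  by rewrite (lt_le_trans _ (norm_le_enorm x))// normr_gt0.
have cpow1 : {for enorm x, continuous (fun v : R => v `^ (- gamma))}.
  apply: differentiable_continuous; apply/derivable1_diffP.
  by apply: derivable_powR; rewrite in_itv/= ex0.
have cpow : {for enorm x, continuous (fun v : R => alpha * v `^ (- gamma))}.
  by apply: cvgMr; exact: cpow1.
move=> eps eps0.
move/cvgrPdist_le : cpow => /(_ eps eps0) /nbhs_normP[h /= h0 hpow].
have h2 : 0 < h / 2 by rewrite divr_gt0.
have ce : enorm z @[z --> x] --> enorm x := @continuous_enorm x.
move/cvgrPdist_lt : ce => /(_ _ h2) /nbhs_normP[e /= e0 he].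
exists e => //; move/cvgrPdist_lt : s0 => /(_ _ h2); apply: filterS => t st z xz.
rewrite distrC; apply: hpow => /=.
have {}he : `|enorm x - enorm z| < h / 2 by apply: he; rewrite /= distrC.
move: st; rewrite sub0r normrN => st.
rewrite opprD addrA (le_lt_trans (ler_normB _ _))//.
by rewrite [ltRHS](splitr h) ltrD.
Qed.

(* With [s := (t * rho t ^ d) ^ (1 / gamma)] and [x := s * u], the density becomes
   [s ^ (- gamma) * alpha * (enorm u + 1 / s) ^ (- gamma)] and the factor [c] of
   [intensity] becomes 1. *)
Lemma dense_regime (alpha gamma : R) :
  0 < alpha -> 0 < gamma -> d%:R < gamma * n.+1%:R ->
  (forall x, m x = alpha * (enorm x + 1) `^ (- gamma)) ->
  t%:R * rho t ^+ d @[t --> \oo] --> +oo ->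
  t%:R * (t%:R * rho t ^+ d) `^ (d%:R / gamma - 2) / ln t%:R @[t --> \oo] --> +oo ->
  let Minf (u : T) := alpha * enorm u `^ (- gamma) in
  lim_int Minf 1 \is a fin_num /\
  {ae P, forall w, (component_count n.+1 S A (rho t) (eta t w) *
      ((t%:R * (t%:R * rho t ^+ d) `^ (d%:R / gamma - 1))^-1)%:E)%E @[t --> \oo] -->
    ((n.+1`!%:R^-1)%:E * lim_int Minf 1)%E}.
Proof.
move=> a0 g0 dg mE coo NL0 Minf.
pose cc t : R := t%:R * rho t ^+ d; pose s t : R := cc t `^ gamma^-1.
have gi0 : 0 < gamma^-1 by rewrite invr_gt0.
have cc1 : \forall t \near \oo, 1 <= cc t by move/cvgryPge : coo; apply.
have s1 : \forall t \near \oo, 0 < s t.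
  by apply: filterS cc1 => t h; rewrite powR_gt0// (lt_le_trans ltr01).
have s_cvg : (s t)^-1 @[t --> \oo] --> 0.
  apply/cvgrPdist_le => eps eps0.
  move/cvgryPge : coo => /(_ ((eps^-1) `^ gamma)); apply: filterS2 s1 => t st h.
  rewrite sub0r normrN ger0_norm ?invr_ge0 ?(ltW st)//.
  rewrite invf_ple ?posrE//.
  rewrite -[leLHS]powRr1 ?invr_ge0 ?(ltW eps0)// -(@divff _ gamma) ?gt_eqF// powRrM.
  by apply: ge0_ler_powR => //; rewrite ?(ltW gi0)// nnegrE ?powR_ge0// (le_trans _ h)// powR_ge0.
(* Once the base is at least one, raising the exponent from [d / gamma - 2] to [d / gamma - 1] only
   increases the expression; this gives the growth of the normalisation itself. *)
have NL : t%:R * (t%:R * rho t ^+ d) `^ (d%:R / gamma - 1) / ln t%:R @[t --> \oo] --> +oo.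
  apply/cvgryPge => K; move/cvgryPge : NL0 => /(_ `|K|).
  apply: filterS3 cc1 (nbhs_infty_gt 1) => t c1 t1 h.
  apply: (le_trans (ler_norm K)); apply: (le_trans h).
  rewrite ler_wpM2r ?invr_ge0 ?ln_ge0 ?ler1n ?(ltnW t1)// ler_wpM2l//.
  by apply: ler_powR => //; lra.
pose M t (u : T) : R := alpha * (enorm u + (s t)^-1) `^ (- gamma).
have mM t : measurable_fun setT (M t).
  apply: measurable_funM => //; apply: (measurableT_comp (measurable_powR (- gamma))).
  by apply: measurable_funD => //; exact: measurable_enorm.
have M0 t u : 0 <= M t u by rewrite mulr_ge0 ?powR_ge0 ?(ltW a0).
have mMinf : measurable_fun setT Minf.
  apply: measurable_funM => //; apply: (measurableT_comp (measurable_powR (- gamma))).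
  exact: measurable_enorm.
have Minf0 u : 0 <= Minf u by rewrite mulr_ge0 ?powR_ge0 ?(ltW a0).
have e_cvg : rho t / s t @[t --> \oo] --> 0.
  by rewrite -(mulr0 0); exact: cvgM.
set C := (alpha * 2 `^ gamma) ^+ n.+1 * 2 `^ (gamma * n.+1%:R) *
  (1 + n.+1`!%:R / dense_rate d alpha gamma ^+ n.+1).
have C0 : 0 <= C.
  rewrite !mulr_ge0 ?powR_ge0 ?exprn_ge0// ?mulr_ge0 ?powR_ge0 ?(ltW a0)//.
  rewrite addr_ge0// divr_ge0// exprn_ge0// !mulr_ge0 ?powR_ge0 ?(ltW a0)//.
  exact: fine_ge0.
have [||int_lim cvg_lim] := @cvg_integral_intensity R d S A n theta d_gt0 mS mA ball_S
  S_ball theta_ge0 M (fun t => rho t / s t) (fun=> 1) Minf 1 mM M0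
  mMinf Minf0 e_cvg (cvg_cst _) C _ C0 dg.
(* The limiting density is continuous except at the origin, which is a null set since [d > 0]. *)
- exists [set 0]; split; [exact: measurable_set1_rV|exact: lebesgue_point|].
  move=> x /= ncv; apply: contrapT => /eqP x0; apply: ncv.
  exact: cvg_near_powR.
- have h1 := rho_small (n.+1%:R * theta) (_ : 0 < 1 / 2).
  have h2 := rho_small 1 ltr01.
  apply: filterS3 (filterI (nbhs_infty_gt 0) s1) (h1 _) h2; last by rewrite divr_gt0.
  move=> t [t0 st] r1 r2 q; rewrite mulr1 in r2.
  by apply: (domination_dense A d_gt0 mS ball_S S_ball theta_ge0) => //; exact: rho_gt0.
have Lfin : lim_int Minf 1 \is a fin_num by exact: (integrable_fin_num measurableT int_lim).
split => //; rewrite -(fineK Lfin) -EFinM.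
apply: (component_ratio_cvg d_gt0 mS mA ball_S S_ball theta_ge0 mu_lf eta_poisson rho_gt0 NL
  (J := fun t => \int[Lam]_q (intensity S A (M t) (rho t / s t) 1 q)%:E)%E).
  apply: filterS3 cc1 s1 (nbhs_infty_gt 0) => t c1 st t0.
  have tR : 0 < t%:R :> R by rewrite ltr0n.
  have c0 : 0 < cc t by rewrite (lt_le_trans ltr01).
  rewrite (mean_component_count n d_gt0 mS mA ball_S S_ball S_sym A_invariant mm m0 mu_lf
    muE tR (rho_gt0 t0) (eta_poisson t0)).
  rewrite (integral_intensity_dilate _ d_gt0 mS mA ball_S _ _ st mm m0).
  pose b := s t `^ (- gamma); have b0 : 0 < b by exact: powR_gt0.
  have sg : s t `^ gamma = cc t.
    by rewrite /s -powRrM mulVf ?gt_eqF// powRr1// ltW.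
  have bE : b = (cc t)^-1 by rewrite /b powRN sg.
  have -> : (fun u => m (s t *: u)) = fun u => b * M t u.
    apply/funext => u; rewrite mE /M mulrCA; congr (_ * _).
    rewrite /b -powRM ?(ltW st)//; last by rewrite addr_ge0 ?sqrtr_ge0 ?invr_ge0 ?(ltW st).
    by rewrite enormZ ?(ltW st)// mulrDr divff// gt_eqF.
  under eq_integral do rewrite (intensityZ A mS)// -/(cc t) bE mulVf ?gt_eqF// EFinM.
  rewrite ge0_integralZl//; last 3 first.
  - by apply/measurable_EFinP; apply: measurable_intensity => //; exact: S_zero.
  - by move=> q _; rewrite lee_fin intensity_ge0.
  - by rewrite lee_fin exprn_ge0// invr_ge0 ltW.
  (* The powers combine as [t ^ (n+1) * rho ^ (d n) * s ^ d * cc ^ (- (n+1)) = t * cc ^ (d / gamma -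
     1)], because [s ^ d = cc ^ (d / gamma)]. *)
  rewrite !muleA -!EFinM; congr (_%:E * _)%E; rewrite -!mulrA; congr (_ * _).
  have sd : s t ^+ d = cc t `^ (d%:R / gamma).
    by rewrite -powR_mulrn ?powR_ge0// /s -powRrM mulrC.
  rewrite sd powRB; last by rewrite (gt_eqF c0) implybT.
  rewrite powRr1 ?(ltW c0)// -/(cc t).
  have -> : (t%:R ^+ n.+1 * ((rho t ^+ d) ^+ n * (cc t `^ (d%:R / gamma) * (cc t)^-1 ^+ n.+1))) =
    t%:R * (cc t `^ (d%:R / gamma) * (cc t ^+ n * (cc t)^-1 ^+ n.+1)).
    by rewrite /cc exprMn exprS; ring.
  by congr (_ * (_ * _)); rewrite exprS mulrCA -exprMn divff ?gt_eqF// expr1n mulr1.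
by rewrite (fineK Lfin); exact: cvg_lim.
Qed.

End regimes.

(** * The limit constants as integrals of [limit_intensity] *)

Section limit_constants.
Context (R : realType) (d : nat).
Local Notation T := 'rV[R]_d.
Local Notation leb := (@lebesgue_rV R d).
Variables (S : set T) (A : set (conf R d)) (n : nat) (theta : R).
Hypotheses (d_gt0 : (0 < d)%N).
Hypotheses (mS : measurable S) (mA : measurable A).
Hypotheses (ball_S : eball 0 1 `<=` S) (S_ball : S `<=` eball 0 theta).
Hypothesis theta_ge0 : 0 <= theta.
Local Notation Lam := (leb \x tuple_measure leb n)%E.
Local Notation lim_int M c := (\int[Lam]_q (@limit_intensity R d S A n M c q)%:E)%E.
Local Notation patt := (@pattern R d S n.+1 A : n.-tuple T -> R).

Lemma neighbourhood_volume (y : n.-tuple T) :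
  leb (@neighbourhood R d S n.+1 y) = (volume S y)%:E.
Proof. by rewrite fineK// (neighbourhood_finite mS S_ball theta_ge0). Qed.

(** For [c = 0] the exponential is one, and the integral factors by Tonelli into its density part
    and its pattern part. *)
Lemma sparse_limitE (m : T -> R) : measurable_fun setT m -> (forall x, 0 <= m x) ->
  sparse_limit S n.+1 A m = ((n.+1`!%:R^-1)%:E * lim_int m 0)%E.
Proof.
move=> mm m0; rewrite /sparse_limit; congr (_ * _)%E.
have S0 : S 0 by exact: S_zero.
have mp : measurable_fun setT (fun y : n.-tuple T => (patt y)%:E).
  by apply/measurable_EFinP; exact: measurable_pattern.
have p0 (y : n.-tuple T) : (0 <= (patt y)%:E)%E by rewrite lee_fin pattern_ge0.
pose J := (\int[tuple_measure leb n]_y (patt y)%:E)%E.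
have J0 : (0 <= J)%E by exact: integral_ge0.
have Jfin : J \is a fin_num.
  by rewrite ge0_fin_numE// (integral_pattern_lty n d_gt0 mS mA ball_S S_ball theta_ge0).
rewrite fubini_tonelli1//; last 2 first.
- by apply/measurable_EFinP; exact: measurable_limit_intensity.
- by move=> q; rewrite lee_fin limit_intensity_ge0.
rewrite -/J -(fineK Jfin) muleC -ge0_integralZl//; last 3 first.
- by apply/measurable_EFinP; exact: measurable_funX.
- by move=> x _; rewrite lee_fin exprn_ge0.
- by rewrite lee_fin fine_ge0.
apply: eq_integral => x _; rewrite muleC fineK// /J -ge0_integralZl//; last first.
  by rewrite lee_fin exprn_ge0.
apply: eq_integral => y _; rewrite /limit_intensity /= mul0r oppr0 expR0 mulr1 mulrC.
by rewrite EFinM.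
Qed.

Lemma thermodynamic_limitE (c : R) (m : T -> R) :
  thermodynamic_limit S n.+1 A c m = ((c ^+ n / n.+1`!%:R)%:E * lim_int m c)%E.
Proof.
rewrite /thermodynamic_limit; congr (_ * _)%E; apply: eq_integral => q _.
by rewrite neighbourhood_volume -!EFinM /= /limit_intensity [c * _ * _]mulrAC [c * (_ * _)]mulrA.
Qed.

Lemma dense_limitE (alpha gamma : R) : 0 < alpha ->
  dense_limit S n.+1 A alpha gamma =
  ((n.+1`!%:R^-1)%:E * lim_int (fun u => alpha * enorm u `^ (- gamma)) 1)%E.
Proof.
move=> a0; rewrite /dense_limit; set M := fun u : T => _.
have ak : alpha ^+ n.+1 != 0 by rewrite expf_neq0// gt_eqF.
have mM : measurable_fun setT M.
  apply: measurable_funM => //; apply: (measurableT_comp (measurable_powR (- gamma))).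
  exact: measurable_enorm.
have M0 u : 0 <= M u by rewrite mulr_ge0 ?powR_ge0 ?(ltW a0).
transitivity ((alpha ^+ n.+1 / n.+1`!%:R)%:E *
    ((alpha ^+ n.+1)^-1%:E * lim_int M 1))%E; last first.
  by rewrite muleA -EFinM mulrAC divff// mul1r.
congr (_ * _)%E; rewrite -ge0_integralZl//; last 3 first.
- by apply/measurable_EFinP; apply: measurable_limit_intensity => //; exact: S_zero.
- by move=> q _; rewrite lee_fin limit_intensity_ge0.
- by rewrite lee_fin invr_ge0 exprn_ge0// ltW.
apply: eq_integral => q _; rewrite neighbourhood_volume -!EFinM /=; congr EFin.
rewrite /limit_intensity mul1r /M exprMn powR_exprn.
by rewrite [patt q.2 * (_ * _)]mulrCA !mulrA mulVf// mul1r.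
Qed.

End limit_constants.

Theorem theorem3p13 (R : realType) (d : nat) (d_gt0 : (0 < d)%N)
  (S : set 'rV[R]_d) (theta : R)
  (S_borel : measurable S) (S_sym : [set - s | s in S] = S)
  (theta_ge1 : 1 <= theta)
  (ball_S : eball 0 1 `<=` S) (S_ball : S `<=` eball 0 theta)
  (mu : {measure set 'rV[R]_d -> \bar R}) (m : 'rV[R]_d -> R)
  (mu_neq0 : mu setT != 0%E)
  (mu_locally_finite :
    forall B : set 'rV[R]_d, measurable B -> bounded_set B -> (mu B < +oo)%E)
  (m_measurable : measurable_fun setT m) (m_ge0 : forall x, 0 <= m x)
  (m_bounded : exists M, forall x, m x <= M)
  (mu_density : forall B, measurable B ->
    mu B = (\int[lebesgue_rV]_(x in B) (m x)%:E)%E)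
  (dO : measure_display) (Omega : measurableType dO) (P : probability Omega R)
  (eta : nat -> Omega -> conf R d)
  (eta_poisson : forall t, (0 < t)%N ->
    poisson_process P (fun B => (t%:R%:E * mu B)%E) (eta t))
  (rho : nat -> R) (rho_gt0 : forall t, (0 < t)%N -> 0 < rho t)
  (rho_cvg0 : rho t @[t --> \oo] --> 0)
  (k : nat) (k_gt0 : (0 < k)%N)
  (A : set (conf R d)) (A_measurable : measurable A)
  (A_card : forall x, A x -> (points x #= `I_k)%card)
  (A_invariant : translation_invariant A) :
  (forall alpha gamma c : R,
    {ae lebesgue_rV, forall x, {for x, continuous m}} ->
    0 < alpha -> 0 < gamma -> d%:R < gamma * k%:R ->
    (forall x, m x <= alpha * (enorm x + 1) `^ (- gamma)) ->
    0 <= c ->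
    t%:R * rho t ^+ d @[t --> \oo] --> c ->
    t%:R ^+ k * rho t ^+ (d * (k - 1)) / ln t%:R @[t --> \oo] --> +oo ->
    (c = 0 ->
      {ae P, forall w,
        (component_count k S A (rho t) (eta t w) *
          ((t%:R ^+ k * rho t ^+ (d * (k - 1)))^-1)%:E)%E @[t --> \oo]
          --> sparse_limit S k A m}) /\
    (0 < c ->
      {ae P, forall w,
        (component_count k S A (rho t) (eta t w) *
          (t%:R^-1)%:E)%E @[t --> \oo]
          --> thermodynamic_limit S k A c m})) /\
  (forall alpha gamma : R,
    0 < alpha -> 0 < gamma -> d%:R < gamma * k%:R ->
    (forall x, m x = alpha * (enorm x + 1) `^ (- gamma)) ->
    t%:R * rho t ^+ d @[t --> \oo] --> +oo ->
    t%:R * (t%:R * rho t ^+ d) `^ (d%:R / gamma - 2) / ln t%:R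
      @[t --> \oo] --> +oo ->
    {ae P, forall w,
      (component_count k S A (rho t) (eta t w) *
          ((t%:R * (t%:R * rho t ^+ d) `^ (d%:R / gamma - 1))^-1)%:E)%E
        @[t --> \oo] --> dense_limit S k A alpha gamma}).

Proof.
have theta_ge0 : 0 <= theta by rewrite (le_trans _ theta_ge1).
have {}S_sym x : S x -> S (- x) by move=> Sx; rewrite -S_sym; exists x.
case: k k_gt0 A_card => // n _ _.
have rhoE t : rho t ^+ (d * (n.+1 - 1)) = (rho t ^+ d) ^+ n by rewrite subn1 exprM.
split=> [alpha gamma c cm a0 g0 dg mle c0 tc NL|alpha gamma a0 g0 dg mE tc NL]; last first.
  have [_] := dense_regime d_gt0 S_borel A_measurable ball_S S_ball theta_ge0 S_sym A_invariant
    m_measurable m_ge0 mu_locally_finite mu_density eta_poisson rho_gt0 rho_cvg0 a0 g0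
    dg mE tc NL.
  by rewrite (dense_limitE n d_gt0 S_borel A_measurable ball_S S_ball theta_ge0).
pose N t : R := t%:R ^+ n.+1 * (rho t ^+ d) ^+ n.
have NE t : t%:R ^+ n.+1 * rho t ^+ (d * (n.+1 - 1)) = N t by rewrite rhoE.
have {}NL : N t / ln t%:R @[t --> \oo] --> +oo.
  by apply: cvg_trans NL; apply: near_eq_cvg; apply: nearW => t; rewrite NE.
have [Lfin cvgF] := decay_regime d_gt0 S_borel A_measurable ball_S S_ball theta_ge0 S_sym
  A_invariant m_measurable m_ge0 mu_locally_finite mu_density eta_poisson rho_gt0 rho_cvg0
  cm a0 g0 dg mle tc NL.
split=> [c_eq0|c_gt0].
  rewrite c_eq0 in cvgF.
  rewrite (sparse_limitE n d_gt0 S_borel A_measurable ball_S S_ball theta_ge0)//.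
  apply: filterS cvgF => w h; apply: cvg_trans h; apply: near_eq_cvg; apply: nearW => t.
  by rewrite NE.
rewrite (thermodynamic_limitE A n S_borel S_ball theta_ge0).
apply: filterS cvgF => w h.
(* The ratio known so far is taken against [t ^ k * rho ^ (d (k-1)) = t * (t * rho ^ d) ^ (k-1)];
   multiplying by this convergent power changes the normalisation to [t] and produces the factor
   [c ^ (k-1)]. *)
have cn : ((t%:R * rho t ^+ d) ^+ n)%:E @[t --> \oo] --> (c ^+ n)%:E.
  apply: cvg_EFin; first exact: nearW.
  exact: (continuous_cvg _ (@exprn_continuous R n c) tc).
move: h; rewrite -(fineK Lfin) -!EFinM => h.
rewrite [c ^+ n / _]mulrC mulrAC EFinM.
have := cvgeM (mule_def_fin _ _) h cn; move=> /(_ eventually_filter isT isT).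
apply: cvg_trans; apply: near_eq_cvg; apply: filterS (nbhs_infty_gt 0) => t t0.
have tR : t%:R != 0 :> R by rewrite pnatr_eq0 gt_eqF.
have rR : rho t != 0 by rewrite gt_eqF ?rho_gt0.
rewrite -muleA -EFinM; congr (_ * _%:E)%E.
rewrite exprMn exprS !invfM.
by field; rewrite !expf_neq0// tR.
Qed.
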